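(* Let $K$ be a real valued field, $x=(x_1,\dots,x_n)$, $\mathfrak m=\langle x_1,\dots,x_n\rangle\subset K\{x\}$ and $f\in\mathfrak m^2$. Let $H(f)=\big(\frac{\partial^2f}{\partial x_i\partial x_j}(0)\big)_{i,j=1,\dots,n}$ be the Hessian matrix at $0$. (1) Let $\mathrm{char}(K)\ne2$ and $\operatorname{rank}H(f)=k$. Then $f$ is right equivalent to $$a_1x_1^2+\dots+a_kx_k^2+g(x_{k+1},\dots,x_n)$$ with $a_i\in K$, $a_i\neq0$, and $g\in\mathfrak m^3$. $g$ is called the residual part of $f$; it is uniquely determined up to right equivalence in $K\{x_{k+1},\dots,x_n\}$. (2) Let $\mathrm{char}(K)=2$ and $\operatorname{rank}H(f)=2l$ (in characteristic $2$ the rank of the Hessian matrix is even). Then $f$ is right equivalent to $$\sum_{i\text{ odd},\,i=1}^{2l-1}\big(a_ix_i^2+x_ix_{i+1}+a_{i+1}x_{i+1}^2\big)+\sum_{i=2l+1}^n d_ix_i^2+h(x_{2l+1},\dots,x_n)$$ with $a_i,d_i\in K$ and $h\in\langle x_{2l+1},\dots,x_n\rangle^3$. $g:=\sum_{i=2l+1}^nd_ix_i^2+h(x_{2l+1},\dots,x_n)$ is called the residual part of $f$; it is uniquely determined up to right equivalence in $K\{x_{2l+1},\dots,x_n\}$.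
   Context: A real valued field is a field $K$ with a map $|\ |:K\to\mathbb R_{\ge 0}$ such that $|a|=0\Leftrightarrow a=0$, $|ab|=|a||b|$, $|a+b|\le|a|+|b|$ (the trivial valuation is allowed; $K$ need not be complete). A power series $\sum c_\alpha x^\alpha\in K[[x]]$ is convergent if $\sum|c_\alpha|\varepsilon^\alpha<\infty$ for some $\varepsilon\in(\mathbb R_{>0})^n$; $K\{x\}$ is the local ring of convergent power series (similarly in other sets of variables). Here $g$ in (1) is an element of $K\{x_{k+1},\dots,x_n\}$ and $h$ in (2) is an element of $K\{x_{2l+1},\dots,x_n\}$. Two elements $f,g\in K\{x\}$ are right equivalent if there is an automorphism $\varphi$ of the local $K$-algebra $K\{x\}$ with $\varphi(f)=g$ (similarly in other sets of variables). It is not assumed that $f$ has an isolated singularity.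
   Formalization: In (2), uniqueness of the residual part is proved only for normal forms whose parts Σ(a_i x_i²+x_i x_{i+1}+a_{i+1}x_{i+1}²) are right equivalent (e.g. same a_i); otherwise it fails: over F_2, x²+xy+y²+z²+z³ ~ x²+xy+z²+z³+z⁴. *)

(* Defs.v *)
From HB Require Import structures.
From mathcomp Require Import all_boot all_order all_algebra.
From mathcomp Require Import finmap.
From mathcomp Require Import all_classical all_reals ereal esum.

Set Implicit Arguments.
Unset Strict Implicit.
Unset Printing Implicit Defensive.

Import Order.TTheory GRing.Theory Num.Theory.
Local Open Scope classical_set_scope.
Local Open Scope ring_scope.

(** * Real valued fields *)

Record real_valuation (R : realType) (K : fieldType) := RealValuation {
  absv :> K -> R;
  absv_ge0 : forall a, 0 <= absv a;
  absv_eq0 : forall a, absv a = 0 <-> a = 0;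
  absvM : forall a b, absv (a * b) = absv a * absv b;
  absvD : forall a b, absv (a + b) <= absv a + absv b }.

Section Absv.
Variables (R : realType) (K : fieldType) (v : real_valuation R K).

Lemma absv0 : v 0 = 0. Proof. by apply/absv_eq0. Qed.

Lemma absv1 : v 1 = 1.
Proof.
have v1N0 : v 1 != 0 by apply/eqP => /absv_eq0 /eqP; rewrite oner_eq0.
by apply: (mulfI v1N0); rewrite -absvM !mulr1.
Qed.

Lemma absv_sum (T : Type) (r : seq T) (P : pred T) (F : T -> K) :
  v (\sum_(i <- r | P i) F i) <= \sum_(i <- r | P i) v (F i).
Proof.
elim/big_ind2: _ => [|x x' y y' lex ley|//]; first by rewrite absv0.
exact: le_trans (absvD _ _ _) (lerD lex ley).
Qed.

End Absv.

(** * Formal power series *)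

(* Multi-indices are finite functions [I -> nat] over the finite type [I] of
   variables, added pointwise.  Using an arbitrary [I] lets the ring in the
   variables [x_i] with [P i] be the ring over the subtype [{i | P i}]. *)
Notation mindex I := {ffun I -> nat}.

Definition mexp (A : comPzRingType) (I : finType) (e : I -> A) (a : mindex I) :
    A :=
  \prod_i e i ^+ a i.

(* An alias, so that the product below is not the pointwise one. *)
Definition fps (K : fieldType) (I : finType) := mindex I -> K.

(* Boxes of multi-indices, to enumerate the index set of the product. *)
Section Box.
Variable I : finType.
Implicit Types (a b : mindex I) (d : nat).

Definition box d := {ffun I -> 'I_d.+1}.
Definition bval d (b : box d) : mindex I := [ffun i => nat_of_ord (b i)].
Definition binv d (a : mindex I) : box d := [ffun i => inord (a i)].
Definition bnd a : nat := \sum_i a i.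

Lemma bval_inj d : injective (@bval d).
Proof.
move=> b c /ffunP bc; apply/ffunP => i; apply/val_inj.
by have := bc i; rewrite !ffunE.
Qed.

Lemma binvK d a : (forall i, (a i <= d)%N) -> bval (binv d a) = a.
Proof. by move=> ad; apply/ffunP => i; rewrite !ffunE inordK ?ltnS. Qed.

Lemma bvalK d (b : box d) : binv d (bval b) = b.
Proof.
by apply/bval_inj; rewrite binvK// => i; rewrite ffunE -ltnS.
Qed.

Lemma bval_le d (b : box d) i : (bval b i <= d)%N.
Proof. by rewrite ffunE -ltnS. Qed.

Lemma bnd_le a i : (a i <= bnd a)%N.
Proof. by rewrite /bnd (bigD1 i)//= leq_addr. Qed.

Lemma addm_left a b c i : b + c = a -> (b i <= a i)%N.
Proof. by move=> <-; rewrite ffunE; exact: leq_addr. Qed.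

Lemma addm_right a b c i : b + c = a -> (c i <= a i)%N.
Proof. by move=> <-; rewrite ffunE; exact: leq_addl. Qed.

End Box.

Section FormalSeries.
Variables (K : fieldType) (I : finType).
Implicit Types (f g h : fps K I) (a b : mindex I).

Definition fps_zero : fps K I := fun=> 0.
Definition fps_opp f : fps K I := fun a => - f a.
Definition fps_add f g : fps K I := fun a => f a + g a.

Lemma fps_addA : associative fps_add.
Proof. by move=> f g h; apply/funext => a; rewrite /fps_add addrA. Qed.
Lemma fps_addC : commutative fps_add.
Proof. by move=> f g; apply/funext => a; rewrite /fps_add addrC. Qed.
Lemma fps_add0 : left_id fps_zero fps_add.
Proof. by move=> f; apply/funext => a; rewrite /fps_add add0r. Qed.
Lemma fps_addN : left_inverse fps_zero fps_opp fps_add.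
Proof. by move=> f; apply/funext => a; rewrite /fps_add addNr. Qed.

HB.instance Definition _ := gen_eqMixin (fps K I).
HB.instance Definition _ := gen_choiceMixin (fps K I).
HB.instance Definition _ := GRing.isZmodule.Build (fps K I)
  fps_addA fps_addC fps_add0 fps_addN.

Definition fps_scale (c : K) f : fps K I := fun a => c * f a.

Definition fps_one : fps K I := fun a => (a == 0)%:R.

Definition fps_mul f g : fps K I := fun a =>
  \sum_(p \in [set p : mindex I * mindex I | p.1 + p.2 = a]) f p.1 * g p.2.

Lemma fps_mulE d f g a : (forall i, (a i <= d)%N) ->
  fps_mul f g a =
  \sum_(x : box I d) \sum_(y : box I d)
    (f (bval x) * g (bval y)) *+ (bval x + bval y == a).
Proof.
move=> ad; rewrite pair_big/=.
pose P := [pred p : box I d * box I d | bval p.1 + bval p.2 == a].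
pose F (p : box I d * box I d) := (bval p.1, bval p.2).
have Finj : injective F.
  by case=> x y [x' y'] [/bval_inj -> /bval_inj ->].
rewrite /fps_mul (fsbigE [seq F p | p <- enum P]).
  rewrite big_map big_enum_cond/= big_mkcond/=; apply: eq_bigr => p _.
  rewrite (_ : (p \in P) = (bval p.1 + bval p.2 == a)); last by rewrite inE.
  case: eqP => [pa|//]; rewrite mem_set//=.
  by rewrite map_inj_uniq// enum_uniq.
  by move=> _ /mapP[p /[!mem_enum] /eqP pa ->].
move=> -[b c]/= bca /negP[]; apply/mapP; exists (binv d b, binv d c).
    rewrite mem_enum inE /= !binvK ?bca//.
      by move=> i; exact: leq_trans (addm_right i bca) (ad i).
    by move=> i; exact: leq_trans (addm_left i bca) (ad i).
  rewrite /F/= !binvK// => i.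
    exact: leq_trans (addm_right i bca) (ad i).
  exact: leq_trans (addm_left i bca) (ad i).
Qed.

Lemma fps_mulC : commutative fps_mul.
Proof.
move=> f g; apply/funext => a; rewrite !(@fps_mulE (bnd a))//;
  try exact: bnd_le.
rewrite exchange_big; apply: eq_bigr => x _; apply: eq_bigr => y _.
by rewrite mulrC addrC.
Qed.

Lemma fps_mul3 f g h a (d := bnd a) :
  fps_mul f (fps_mul g h) a =
  \sum_(x : box I d) \sum_(y : box I d) \sum_(z : box I d)
    (f (bval x) * (g (bval y) * h (bval z))) *+
      (bval x + (bval y + bval z) == a).
Proof.
rewrite (@fps_mulE d); last exact: bnd_le.
apply: eq_bigr => x _.
transitivity (\sum_(w : box I d) \sum_(y : box I d) \sum_(z : box I d)
    (f (bval x) * (g (bval y) * h (bval z))) *+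
      (bval y + bval z == bval w) *+ (bval x + bval w == a)).
  apply: eq_bigr => w _; rewrite (@fps_mulE d); last exact: bval_le.
  rewrite mulr_sumr -sumrMnl; apply: eq_bigr => y _.
  rewrite mulr_sumr -sumrMnl; apply: eq_bigr => z _.
  by rewrite mulrnAr.
rewrite exchange_big/=; apply: eq_bigr => y _.
rewrite exchange_big/=; apply: eq_bigr => z _.
have [xyza|xyza] := eqVneq (bval x + (bval y + bval z)) a; last first.
  rewrite big1// => w _; have [yzw|] := eqVneq (bval y + bval z) (bval w);
    last by rewrite mulr0n mul0rn.
  by rewrite -yzw (negbTE xyza).
have yzd i : ((bval y + bval z)%R i <= d)%N.
  exact: leq_trans (addm_right i xyza) (bnd_le _ _).
rewrite (bigD1 (binv d (bval y + bval z)))//= binvK// xyza !eqxx big1 ?addr0//.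
move=> w wN; rewrite (_ : _ == _ = false) ?mul0rn//.
by apply: contraNF wN => /eqP ->; rewrite bvalK.
Qed.

Lemma fps_mulA : associative fps_mul.
Proof.
move=> f g h; rewrite (fps_mulC (fps_mul f g)); apply/funext => a.
rewrite !fps_mul3 [RHS]exchange_big/=; apply: eq_bigr => x _.
rewrite [RHS]exchange_big/=; apply: eq_bigr => y _.
apply: eq_bigr => z _; rewrite mulrA [f _ * g _ * _]mulrC.
by rewrite (addrC (bval z)) addrA.
Qed.

Lemma fps_mul1 : left_id fps_one fps_mul.
Proof.
move=> f; apply/funext => a; rewrite (@fps_mulE (bnd a)); last exact: bnd_le.
move: (bnd a) (@bnd_le _ a) => d ad.
have E0 : bval (binv d (0 : mindex I)) = 0.
  by rewrite binvK// => i; rewrite ffunE.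
rewrite (bigD1 (binv d 0))//= [X in _ + X]big1 ?addr0; last first.
  move=> x xN0; apply: big1 => y _; rewrite /fps_one (_ : _ == 0 = false).
    by rewrite mul0r mul0rn.
  by apply: contraNF xN0 => /eqP <-; rewrite bvalK.
rewrite E0 (bigD1 (binv d a))//= [X in _ + X]big1 ?addr0; last first.
  move=> y yN; rewrite add0r (_ : _ == _ = false)//.
  by apply: contraNF yN => /eqP <-; rewrite bvalK.
by rewrite binvK// add0r /fps_one !eqxx mul1r.
Qed.

Lemma fps_mulDl : left_distributive fps_mul +%R.
Proof.
move=> f g h; apply/funext => a.
transitivity (fps_mul f h a + fps_mul g h a); last by [].
rewrite !(@fps_mulE (bnd a)); try exact: bnd_le.
rewrite -big_split; apply: eq_bigr => x _.
rewrite -big_split; apply: eq_bigr => y _.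
by rewrite /= -mulrnDl -mulrDl.
Qed.

Lemma fps_one_neq0 : fps_one != 0.
Proof.
apply/eqP => /(congr1 (fun f => f 0)); rewrite /fps_one eqxx => /eqP.
by rewrite oner_eq0.
Qed.

HB.instance Definition _ := GRing.Zmodule_isComNzRing.Build (fps K I)
  fps_mulA fps_mulC fps_mul1 fps_mulDl fps_one_neq0.

Lemma fps_scaleA c c' f : fps_scale c (fps_scale c' f) = fps_scale (c * c') f.
Proof. by apply/funext => a; rewrite /fps_scale mulrA. Qed.
Lemma fps_scale1 : left_id 1 fps_scale.
Proof. by move=> f; apply/funext => a; rewrite /fps_scale mul1r. Qed.
Lemma fps_scaleDr : right_distributive fps_scale +%R.
Proof. by move=> c f g; apply/funext => a; rewrite /fps_scale mulrDr. Qed.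
Lemma fps_scaleDl f : {morph fps_scale^~ f : c c' / c + c'}.
Proof. by move=> c c'; apply/funext => a; rewrite /fps_scale mulrDl. Qed.

HB.instance Definition _ := GRing.Zmodule_isLmodule.Build K (fps K I)
  fps_scaleA fps_scale1 fps_scaleDr fps_scaleDl.

Lemma fps_scaleAl (c : K) (f g : fps K I) : c *: (f * g) = (c *: f) * g.
Proof.
apply/funext => a; transitivity (c * fps_mul f g a); first by [].
transitivity (fps_mul (fps_scale c f) g a); last by [].
rewrite !(@fps_mulE (bnd a)); try exact: bnd_le.
rewrite mulr_sumr; apply: eq_bigr => x _.
rewrite mulr_sumr; apply: eq_bigr => y _.
by rewrite mulrnAr /fps_scale mulrA.
Qed.

HB.instance Definition _ :=
  GRing.Lmodule_isLalgebra.Build K (fps K I) fps_scaleAl.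
HB.instance Definition _ := GRing.Lalgebra_isComAlgebra.Build K (fps K I).

Lemma coefM d f g a : (forall i, (a i <= d)%N) ->
  (f * g) a = \sum_(x : box I d) \sum_(y : box I d)
    (f (bval x) * g (bval y)) *+ (bval x + bval y == a).
Proof. exact: fps_mulE. Qed.

Definition fps_var (i : I) : fps K I := fun a =>
  (a == [ffun j => (j == i) : nat])%:R.

(* Formal partial derivative: the coefficient at [a] is
   [(a i + 1) * f_(a + e_i)]. *)
Definition fps_deriv (i : I) f : fps K I := fun a =>
  f (a + [ffun j => (j == i) : nat]) *+ (a i).+1.

Definition fps_at0 f : K := f 0.

End FormalSeries.

Definition hessian (K : fieldType) (n : nat) (f : fps K 'I_n) : 'M[K]_n :=
  \matrix_(i, j) fps_at0 (fps_deriv i (fps_deriv j f)).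

(** * Convergent power series *)

Section Convergence.
Variables (R : realType) (K : fieldType) (v : real_valuation R K).
Variable I : finType.
Implicit Types (f g : fps K I) (e : I -> R).

Definition convergent f : Prop := exists e : I -> R,
  (forall i, 0 < e i) /\
  (\esum_(a in [set: mindex I]) (v (f a) * mexp e a)%:E < +oo)%E.

Lemma mexp_ge0 e a : (forall i, 0 < e i) -> 0 <= mexp e a.
Proof. by move=> e0; apply: prodr_ge0 => i _; rewrite exprn_ge0// ltW. Qed.

Lemma ler_mexp e e' a :
  (forall i, 0 < e i) -> (forall i, e i <= e' i) -> mexp e a <= mexp e' a.
Proof.
move=> e0 ee'; apply: ler_prod => i _.
have e'0 : 0 <= e' i := le_trans (ltW (e0 i)) (ee' i).
by rewrite exprn_ge0 ?(ltW (e0 i))//= lerXn2r ?nnegrE ?(ltW (e0 i)).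
Qed.

Lemma mexpD e (a b : mindex I) : mexp e (a + b) = mexp e a * mexp e b.
Proof. by rewrite -big_split; apply: eq_bigr => i _; rewrite ffunE exprD. Qed.

(* Convergence as boundedness of the sums over boxes. *)
Lemma convergentP f : convergent f <-> exists e : I -> R,
  (forall i, 0 < e i) /\ exists M, forall d,
  \sum_(b : box I d) v (f (bval b)) * mexp e (bval b) <= M.
Proof.
split=> -[e [e0]].
  move=> cvg; exists e; split=> //.
  set S := (X in (X < _)%E) in cvg.
  have S0 : (0 <= S)%E.
    by apply: esum_ge0 => a _; rewrite lee_fin mulr_ge0 ?absv_ge0 ?mexp_ge0.
  exists (fine S) => d; rewrite -lee_fin fineK ?ge0_fin_numE//.
  apply: esum_ge; exists [set` [seq bval b | b <- enum {: box I d}]].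
    by split => //; apply: finite_seq.
  rewrite -fsbig_seq/=; last by rewrite map_inj_uniq ?enum_uniq//; exact: bval_inj.
  by rewrite big_map big_enum/= sumEFin.
move=> [M HM]; exists e; split=> //; apply: (@le_lt_trans _ _ M%:E); last exact: ltry.
apply: ge_ereal_sup => _ [X [finX _] <-].
rewrite fsbig_finite//= sumEFin lee_fin.
pose d := (\sum_(a <- fset_set X) bnd a)%N.
have Xd a : a \in fset_set X -> bval (binv d a) = a.
  move=> aX; apply: binvK => i; apply: leq_trans (bnd_le a i) _.
  by rewrite /d (big_rem a)//= leq_addr.
apply: le_trans (HM d); rewrite big_seq_cond.
pose F a := v (f a) * mexp e a.
rewrite -big_seq_cond -/(F _).
have -> : \sum_(a <- fset_set X) F a =
    \sum_(b <- [seq binv d a | a <- fset_set X]) F (bval b).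
  by rewrite big_map big_seq [RHS]big_seq; apply: eq_bigr => a /Xd ->.
rewrite big_uniq/=; last first.
  rewrite map_inj_in_uniq ?fset_uniq// => a b /Xd {2}<- /Xd {2}<-.
  by move=> ->.
rewrite [leLHS]big_mkcond; apply: ler_sum => b _; case: ifP => // _.
by rewrite mulr_ge0 ?absv_ge0 ?mexp_ge0.
Qed.

Definition cvg_pred : {pred fps K I} := fun f => `[< convergent f >].

Lemma convergent_delta (m : mindex I) : convergent (fun a => (a == m)%:R).
Proof.
apply/convergentP; exists (fun=> 1); split=> [_|]; first exact: ltr01.
exists 1 => d.
have [md|mNd] := boolP [forall i, (m i <= d)%N].
  have bm : bval (binv d m) = m by rewrite binvK//; exact/forallP.
  rewrite (bigD1 (binv d m))//= [X in _ + X]big1; last first.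
    move=> b bN; rewrite (_ : _ == _ = false) ?absv0 ?mul0r//.
    by apply: contraNF bN => /eqP <-; rewrite bvalK.
  by rewrite bm eqxx absv1 mul1r addr0 /mexp big1// => i _; rewrite expr1n.
rewrite big1 ?ler01// => b _; rewrite (_ : _ == _ = false) ?absv0 ?mul0r//.
apply: contraNF mNd => /eqP <-; apply/forallP => i; exact: bval_le.
Qed.

Lemma convergent2P f g : convergent f -> convergent g ->
  exists e : I -> R, (forall i, 0 < e i) /\ exists M, forall d,
    \sum_(b : box I d) v (f (bval b)) * mexp e (bval b) <= M /\
    \sum_(b : box I d) v (g (bval b)) * mexp e (bval b) <= M.
Proof.
move=> /convergentP[e [e0 [M HM]]] /convergentP[e' [e'0 [M' HM']]].
pose m i := Num.min (e i) (e' i).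
have m0 i : 0 < m i by rewrite lt_min e0 e'0.
exists m; split=> //; exists (Num.max M M') => d.
split; rewrite le_max; apply/orP; [left|right].
  apply: le_trans (HM d); apply: ler_sum => b _.
  by rewrite ler_wpM2l ?absv_ge0// ler_mexp// => i; rewrite ge_min lexx.
apply: le_trans (HM' d); apply: ler_sum => b _.
by rewrite ler_wpM2l ?absv_ge0// ler_mexp// => i; rewrite ge_min lexx orbT.
Qed.

Lemma convergentD f g : convergent f -> convergent g -> convergent (f + g).
Proof.
move=> cf cg; have [e [e0 [M HM]]] := convergent2P cf cg.
apply/convergentP; exists e; split=> //; exists (M + M) => d.
have [fM gM] := HM d; apply: le_trans (lerD fM gM).
rewrite -big_split; apply: ler_sum => b _ /=.
by rewrite -mulrDl ler_wpM2r ?mexp_ge0// absvD.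
Qed.

Lemma convergentZ (c : K) f : convergent f -> convergent (c *: f).
Proof.
move=> /convergentP[e [e0 [M HM]]].
apply/convergentP; exists e; split=> //; exists (v c * M) => d.
apply: le_trans (ler_wpM2l (absv_ge0 v c) (HM d)).
rewrite mulr_sumr; apply: ler_sum => b _.
by rewrite [(c *: f) _]/(c * f _) absvM mulrA.
Qed.

Lemma convergentM f g : convergent f -> convergent g -> convergent (f * g).
Proof.
move=> cf cg; have [e [e0 [M HM]]] := convergent2P cf cg.
apply/convergentP; exists e; split=> //; exists (M * M) => d.
have [fM gM] := HM d.
pose w (h : fps K I) (b : box I d) := v (h (bval b)) * mexp e (bval b).
have w0 h b : 0 <= w h b by rewrite mulr_ge0 ?absv_ge0 ?mexp_ge0.
apply: (@le_trans _ _ (\sum_x w f x * \sum_y w g y)); last first.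
  by rewrite -mulr_suml ler_pM// sumr_ge0.
apply: (@le_trans _ _ (\sum_(b : box I d) \sum_x \sum_y
    (w f x * w g y) *+ (bval x + bval y == bval b))).
  apply: ler_sum => b _.
  rewrite (coefM _ _ (@bval_le _ _ b)).
  apply: (@le_trans _ _ ((\sum_x \sum_y
    v ((f (bval x) * g (bval y)) *+ (bval x + bval y == bval b)))
      * mexp e (bval b))).
    rewrite ler_wpM2r ?mexp_ge0//; apply: le_trans (absv_sum _ _ _ _) _.
    by apply: ler_sum => x _; exact: absv_sum.
  rewrite mulr_suml; apply: ler_sum => x _.
  rewrite mulr_suml; apply: ler_sum => y _.
  have [<-|_] := eqVneq; last by rewrite !mulr0n absv0 mul0r.
  by rewrite !mulr1n absvM mexpD mulrACA.
rewrite exchange_big/=; apply: ler_sum => x _.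
rewrite exchange_big/= mulr_sumr; apply: ler_sum => y _.
have [xyd|xyNd] := boolP [exists b : box I d, bval x + bval y == bval b].
  have [b xyb] := existsP xyd.
  rewrite (bigD1 b)//= xyb mulr1n [X in _ + X]big1 ?addr0// => b' b'b.
  rewrite (_ : _ == _ = false)//; apply: contraNF b'b.
  by rewrite (eqP xyb) => /eqP /bval_inj ->.
rewrite big1; first by apply: mulr_ge0; exact: w0.
move=> b _; rewrite (_ : _ == _ = false)//.
by apply: contraNF xyNd => xyb; apply/existsP; exists b.
Qed.

Lemma cvg_subalg : GRing.subsemialg_closed cvg_pred.
Proof.
split.
- exact/asboolP/convergent_delta.
- split.
    apply/asboolP/convergentP; exists (fun=> 1); split=> [_|]; first exact: ltr01.
    by exists 0 => d; rewrite big1// => b _; rewrite absv0 mul0r.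
  by move=> f g /asboolP cf /asboolP cg; exact/asboolP/convergentD.
- by move=> c f /asboolP cf; exact/asboolP/convergentZ.
- by move=> f g /asboolP cf /asboolP cg; exact/asboolP/convergentM.
Qed.

HB.instance Definition _ :=
  GRing.isSubalgClosed.Build K (fps K I) cvg_pred cvg_subalg.

Record cps := Cps { fps_of :> fps K I; _ : fps_of \in cvg_pred }.

HB.instance Definition _ := [isSub for fps_of].
HB.instance Definition _ := [Choice of cps by <:].
HB.instance Definition _ := [SubChoice_isSubComNzRing of cps by <:].
HB.instance Definition _ := [SubZmodule_isSubLmodule of cps by <:].
HB.instance Definition _ := [SubNzRing_SubLmodule_isSubLalgebra of cps by <:].
HB.instance Definition _ := [SubLalgebra_isSubAlgebra of cps by <:].

Lemma cps_var_subproof (i : I) : fps_var K i \in cvg_pred.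
Proof. exact/asboolP/convergent_delta. Qed.

Definition cps_var (i : I) : cps := Cps (cps_var_subproof i).

(* The [k]-th power of the ideal generated by the variables, which is the ideal
   generated by the [k]-fold products of variables. *)
Definition maxideal_exp (k : nat) : set cps :=
  [set f | exists c : {ffun 'I_k -> I} -> cps,
     f = \sum_(s : {ffun 'I_k -> I}) c s * \prod_(j < k) cps_var (s j)].

Definition right_equiv (f g : cps) : Prop :=
  exists phi : {lrmorphism cps -> cps}, bijective phi /\ phi f = g.

End Convergence.

Arguments cvg_pred {R K} v {I} _.

(** * Inclusion of a ring of series in fewer variables *)

Section Inclusion.
Variables (R : realType) (K : fieldType) (v : real_valuation R K).
Variables (I : finType) (P : pred I).

Definition fps_incl (g : fps K {i : I | P i}) : fps K I := fun a =>
  if [forall i, P i || (a i == 0%N)] then g [ffun j => a (val j)] else 0.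

Lemma fps_incl_subproof (g : cps v {i : I | P i}) :
  fps_incl g \in cvg_pred v.
Proof.
have /asboolP/convergentP[e [e0 [M HM]]] := valP g.
pose e' i := if insub i is Some j then e j else 1.
have e'0 i : 0 < e' i by rewrite /e'; case: insubP => [j _ _|_]; rewrite ?ltr01.
apply/asboolP/convergentP; exists e'; split=> //; exists M => d.
apply: le_trans (HM d).
pose S (b : box I d) := [forall i, P i || (bval b i == 0%N)].
pose r (b : box I d) : box {i : I | P i} d := [ffun j => b (val j)].
pose x (b : box {i : I | P i} d) : box I d :=
  [ffun i => if insub i is Some j then b j else ord0].
have rx : cancel x r.
  by move=> b; apply/ffunP => j; rewrite !ffunE valK.
have Sx b : S (x b).
  apply/forallP => i; rewrite !ffunE.
  by case: insubP => [j -> //|/negbTE ->] /=.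
have xr b : S b -> x (r b) = b.
  move=> /forallP Sb; apply/ffunP => i; rewrite !ffunE.
  case: insubP => [j _ <-|/negbTE Pi]; first by rewrite ffunE.
  by apply/val_inj; have := Sb i; rewrite Pi ffunE => /eqP /esym.
rewrite (bigID S)/= [X in _ + X]big1 ?addr0; last first.
  by move=> b /negbTE Sb; rewrite /fps_incl -/(S b) Sb absv0 mul0r.
rewrite (reindex_onto x r)//=.
rewrite (eq_bigl xpredT); last by move=> b; rewrite Sx rx eqxx.
apply: ler_sum => b _; rewrite /fps_incl -/(S (x b)) Sx.
have -> : [ffun j : {i : I | P i} => bval (x b) (val j)] = bval b.
  by apply/ffunP => j; rewrite !ffunE valK.
rewrite ler_wpM2l ?absv_ge0// /mexp.
rewrite (bigID P)/= [X in _ * X]big1 ?mulr1; last first.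
  by move=> i /negbTE Pi; rewrite !ffunE insubF.
rewrite le_eqVlt; apply/orP; left; apply/eqP; rewrite big_sub/=.
by apply: eq_bigr => j _; rewrite /e' !ffunE valK.
Qed.

Definition cps_incl (g : cps v {i : I | P i}) : cps v I :=
  Cps (fps_incl_subproof g).

End Inclusion.

(** * Normal forms *)

Section NormalForms.
Variables (R : realType) (K : fieldType) (v : real_valuation R K).

Definition diag_form (I : finType) (P : pred I) (a : I -> K) : cps v I :=
  \sum_(i | P i) a i *: cps_var v i ^+ 2.

(* Variables are numbered from 0: the pairs are [(x_i, x_(i+1))] for [i] even,
   [i + 1 < 2 * l]. *)
Definition pair_form (n l : nat) (a : 'I_n -> K) : cps v 'I_n :=
  \sum_(p : 'I_n * 'I_n |
        [&& ~~ odd p.1, p.2 == p.1.+1 :> nat & (p.2 < l.*2)%N])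
    (a p.1 *: cps_var v p.1 ^+ 2 + cps_var v p.1 * cps_var v p.2
     + a p.2 *: cps_var v p.2 ^+ 2).

(* Normal form for characteristic not 2; [g] is the residual part. *)
Definition normal_form (n k : nat) (a : 'I_n -> K)
    (g : cps v {i : 'I_n | (k <= i)%N}) : cps v 'I_n :=
  diag_form (fun i : 'I_n => (i < k)%N) a + cps_incl g.

(* Normal form for characteristic 2; [g] is the residual part, of the form
   [residual2 d h].

   The residual part is only determined by the series together with the
   equivalence class of [pair_form l a], not by the series alone.  Over 'F_2
   (with the trivial valuation), x -> x + z^2, z -> z + y followed by
   x -> x + y w, where w is the root of w^2 + w = y + z without constant term,
   maps x^2 + x y + y^2 + (z^2 + z^3) to x^2 + x y + (z^2 + z^3 + z^4).
   But z^2 + z^3 and z^2 + z^3 + z^4 are not right equivalent over 'F_2: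
   z -> z + a z^2 + ... maps z^2 + z^3 to
   z^2 + z^3 + (a^2 + a) z^4 + ..., and a^2 + a = 0. *)
Definition normal_form2 (n l : nat) (a : 'I_n -> K)
    (g : cps v {i : 'I_n | (l.*2 <= i)%N}) : cps v 'I_n :=
  pair_form l a + cps_incl g.

Definition residual2 (I : finType) (d : I -> K) (h : cps v I) : cps v I :=
  diag_form xpredT d + h.

End NormalForms.

(* Main.v *)
Require Import Defs.
From HB Require Import structures.
From mathcomp Require Import all_boot all_order all_algebra.
From mathcomp Require Import all_classical all_reals.
From mathcomp Require Import ring lra.

(* Existence.  After a linear change of variables f = q(x_I) + (squares of the
   other variables) + r, where the quadratic form q has a nondegenerate polar
   form and r has order at least 3.  A coordinate change x_I -> x_I + t turns
   q(x_I) + g, with g free of x_I, into f exactly when t solves a fixed point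
   equation which is contracting both for the order of series and for weighted
   l1-norms.  The fixed point is built coefficientwise, so that K need not be
   complete; no derivative and no division by 2 occurs, so that all
   characteristics are treated at once.

   Uniqueness.  Let phi map q + g to q + g'.  The linear part of phi preserves
   the radical of the polar form, and its restriction M to x_I preserves the
   polar form of q (but not q itself, in characteristic 2).  The graph of M is
   totally isotropic for the polar form of Q(y, x) = q(y) - q(x), hence has a
   complement which is totally singular for Q.  Solving for x_I the condition
   that (phi x_I, x_I) lies in this complement gives a graph over the other
   variables on which q(phi x_I) = q(x_I), and restricting phi(q + g) = q + g'
   to it gives an equivalence of g and g'. *)

Set Implicit Arguments.
Unset Strict Implicit.
Unset Printing Implicit Defensive.

Import Order.TTheory GRing.Theory Num.Theory.
Local Open Scope ring_scope.

(** * Orders and weighted norms *)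

Section MultiIndices.
Variable I : finType.
Implicit Types (a b : mindex I).

(** Automorphisms of [cps] are abstract algebra automorphisms, with no continuity assumed. Division
    by variables, a form of Hadamard's lemma, shows that homomorphisms do not lower orders and are
    determined by the images of the variables. Constructing one thus amounts to finding convergent
    series of order at least 1.

    These series solve fixed point equations. Replacing the radius [rho] by [t * rho] multiplies the
    norm of a series of order [k] by at most [t ^+ k], so terms of higher order become negligible
    and some ball is mapped to itself. An invariant ball suffices: the limit itself is obtained from
    the orders alone.

    In the uniqueness part, both series are brought to the same [q] by a linear change that fixes
    the other variables. As [M] need not preserve [q], a relation such as [phi x_I = M x_I] does not
    make [q (phi x_I)] and [q x_I] agree; membership of the pair in a totally singular space of [Q]
    does. Being complementary to the graph of [M] is exactly solvability: the linear part of the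
    pair (phi x_I, x_I) runs through that graph, where the equations of the totally singular space
    are coordinates. *)

Definition em (i : I) : mindex I := [ffun j => (j == i) : nat].

Lemma bndD a b : bnd (a + b) = (bnd a + bnd b)%N.
Proof. by rewrite /bnd -big_split; apply: eq_bigr => i _; rewrite ffunE. Qed.

Lemma bnd0 : bnd (0 : mindex I) = 0%N.
Proof. by rewrite /bnd big1// => i _; rewrite ffunE. Qed.

Lemma bnd_em i : bnd (em i) = 1%N.
Proof.
rewrite /bnd (bigD1 i)//= ffunE eqxx big1// => j /negbTE ji.
by rewrite ffunE ji.
Qed.

Lemma bnd_eq0 a : bnd a = 0%N -> a = 0.
Proof.
move=> a0; apply/ffunP => i; rewrite ffunE.
by have := bnd_le a i; rewrite a0 leqn0 => /eqP.
Qed.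

Lemma em_inj : injective em.
Proof.
move=> i j /ffunP/(_ i); rewrite !ffunE eqxx.
by case: eqP => // ->.
Qed.

Lemma mindex_subK a i : (0 < a i)%N -> exists b, a = b + em i.
Proof.
move=> ai; exists [ffun j => (a j - (j == i))%N]; apply/ffunP => j.
rewrite !ffunE; have [->|_] := eqVneq j i; first exact: esym (subnK ai).
by rewrite subn0 [RHS]addn0.
Qed.

Lemma bnd_gt0 a : (0 < bnd a)%N -> exists i, (0 < a i)%N.
Proof.
move=> a0; apply/existsP; rewrite -[X in is_true X]negbK negb_exists.
apply: contraL a0 => /forallP a0; rewrite -leqNgt leqn0 /bnd big1// => i _.
by apply/eqP; rewrite -leqn0 leqNgt.
Qed.

Lemma addm_inj b : injective (fun a => a + b).
Proof.
move=> a a' /ffunP ab; apply/ffunP => i; have := ab i; rewrite !ffunE.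
exact: addIn.
Qed.

(** Lets boxes of different sizes be exchanged: a multi-index outside the smaller box has an entry,
    hence a degree, above [d]. *)
Lemma sum_box_eq (V : zmodType) (F : mindex I -> V) d m :
  (forall a, (d < bnd a)%N -> F a = 0) -> (d <= m)%N ->
  \sum_(b : box I m) F (bval b) = \sum_(b : box I d) F (bval b).
Proof.
move=> F0 dm.
pose S (b : box I m) := [forall i, (bval b i <= d)%N].
rewrite (bigID S)/= [X in _ + X]big1 ?addr0; last first.
  move=> b; rewrite negb_forall => /existsP[i]; rewrite -ltnNge => di.
  by apply: F0; apply: leq_trans di (bnd_le _ _).
rewrite (reindex_onto (fun b : box I d => binv m (bval b))
                      (fun b : box I m => binv d (bval b)))/=; last first.
  move=> b /forallP Sb; rewrite [bval (binv d _)]binvK ?bvalK//.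
have mb (b : box I d) i : (bval b i <= m)%N by rewrite (leq_trans (bval_le _ _)).
apply: eq_big => [b|b _]; last by rewrite binvK.
rewrite /S binvK// bvalK eqxx andbT; apply/forallP => i; exact: bval_le.
Qed.

End MultiIndices.

(** * Coefficients of formal series and the order filtration *)

Section Order.
Variables (K : fieldType) (I : finType).
Implicit Types (f g : fps K I) (a b : mindex I) (k l : nat).

Definition ordge k f := forall a, (bnd a < k)%N -> f a = 0.

Lemma fpsDE f g a : (f + g) a = f a + g a. Proof. by []. Qed.
Lemma fpsNE f a : (- f) a = - f a. Proof. by []. Qed.
Lemma fpsZE c f a : (c *: f) a = c * f a. Proof. by []. Qed.
Lemma fps1E a : (1 : fps K I) a = (a == 0)%:R. Proof. by []. Qed.
Lemma fps_sumE (T : Type) (r : seq T) (P : pred T) (F : T -> fps K I) a :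
  (\sum_(i <- r | P i) F i) a = \sum_(i <- r | P i) F i a.
Proof. exact: (big_morph (fun f : fps K I => f a)). Qed.

Lemma ordge_le k l f : (k <= l)%N -> ordge l f -> ordge k f.
Proof. by move=> kl fl a ak; apply: fl; apply: leq_trans ak kl. Qed.

Lemma ordgeD k f g : ordge k f -> ordge k g -> ordge k (f + g).
Proof. by move=> fk gk a ak; rewrite fpsDE fk// gk// addr0. Qed.

Lemma ordgeN k f : ordge k f -> ordge k (- f).
Proof. by move=> fk a ak; rewrite fpsNE fk// oppr0. Qed.

Lemma ordgeB k f g : ordge k f -> ordge k g -> ordge k (f - g).
Proof. by move=> fk gk; apply/ordgeD/ordgeN. Qed.

Lemma ordgeZ k c f : ordge k f -> ordge k (c *: f).
Proof. by move=> fk a ak; rewrite fpsZE fk// mulr0. Qed.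

Lemma ordge_sum k (T : Type) (r : seq T) (P : pred T) (F : T -> fps K I) :
  (forall i, P i -> ordge k (F i)) -> ordge k (\sum_(i <- r | P i) F i).
Proof.
move=> Fk; elim/big_ind: _ => //; first exact: ordgeD.
Qed.

Lemma ordgeM k l f g : ordge k f -> ordge l g -> ordge (k + l) (f * g).
Proof.
move=> fk gl a akl; rewrite (Defs.coefM _ _ (@bnd_le _ a)).
rewrite big1// => x _; rewrite big1// => y _.
have [xya|] := eqVneq; last by rewrite mulr0n.
have xykl : (bnd (bval x) + bnd (bval y) < k + l)%N by rewrite -bndD xya.
have [xk|kx] := ltnP (bnd (bval x)) k; first by rewrite fk// mul0r mul0rn.
rewrite gl ?mulr0 ?mul0rn// ltnNge; apply: contraL xykl => ly.
by rewrite -leqNgt leq_add.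
Qed.

Lemma ordgeMl k f g : ordge k f -> ordge k (g * f).
Proof. exact: (@ordgeM 0). Qed.

Lemma ordgeMr k f g : ordge k f -> ordge k (f * g).
Proof. by rewrite mulrC; exact: ordgeMl. Qed.

Lemma ordge_var i : ordge 1 (fps_var K i).
Proof.
move=> a a1; rewrite /fps_var; case: eqP => // ae.
by move: a1; rewrite ae (bnd_em i).
Qed.

Lemma ordge_eq0 f : (forall k, ordge k f) -> f = 0.
Proof. by move=> f0; apply/funext => a; apply: (f0 (bnd a).+1). Qed.

Lemma ordge1P f : ordge 1 f <-> f 0 = 0.
Proof.
split=> [f1|f0 a]; first by apply: f1; rewrite bnd0.
by rewrite ltnS leqn0 => /eqP /bnd_eq0 ->.
Qed.

Lemma coef0M f g : (f * g) 0 = f 0 * g 0.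
Proof.
have bE (x : box I 0) : bval x = 0.
  by apply/ffunP => i; rewrite !ffunE ord1.
rewrite (Defs.coefM (d := 0)); last by move=> i; rewrite ffunE.
rewrite (bigD1 (binv 0 0))//= [X in _ + X]big1 ?addr0; last first.
  by move=> x /eqP[]; rewrite -[x]bvalK bE.
rewrite (bigD1 (binv 0 0))//= [X in _ + X]big1 ?addr0; last first.
  by move=> x /eqP[]; rewrite -[x]bvalK bE.
by rewrite !bE addr0 eqxx.
Qed.

Lemma ordge_mexp (J : finType) (e : J -> fps K I) (b : mindex J) :
  (forall j, ordge 1 (e j)) -> ordge (bnd b) (mexp e b).
Proof.
move=> e1; rewrite /mexp /bnd; elim/big_rec2: _ => // j y x _ yx.
by apply: ordgeM => //; elim: (b j) => // m IH; rewrite exprS; apply: (@ordgeM 1).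
Qed.

Lemma coefXM i f a : (fps_var K i * f) (a + em i) = f a.
Proof.
set c := a + em i.
have ac j : (a j <= bnd c)%N.
  by apply: leq_trans (bnd_le c j); rewrite /c ffunE leq_addr.
have ec j : (em i j <= bnd c)%N.
  by apply: leq_trans (bnd_le c j); rewrite /c [(a + _) j]ffunE leq_addl.
have cd := @bnd_le _ c; rewrite (Defs.coefM _ _ cd).
move: (bnd c) ac ec {cd} => d ad ed.
rewrite (bigD1 (binv _ (em i)))//= [X in _ + X]big1 ?addr0; last first.
  move=> x xN; apply: big1 => y _; rewrite /fps_var (_ : _ == _ = false).
    by rewrite mul0r mul0rn.
  by apply: contraNF xN => /eqP xe; rewrite -[x]bvalK xe.
rewrite (bigD1 (binv _ a))//= [X in _ + X]big1 ?addr0; last first.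
  move=> y yN; rewrite [X in _ *+ nat_of_bool X](_ : _ = false)// binvK//.
  apply: contraNF yN; rewrite /c addrC => /eqP /addm_inj ye.
  by rewrite -[y]bvalK ye.
by rewrite !binvK// /fps_var eqxx mul1r /c addrC eqxx.
Qed.

Lemma coefXM0 i f a : a i = 0%N -> (fps_var K i * f) a = 0.
Proof.
move=> ai; rewrite (Defs.coefM _ _ (@bnd_le _ a)).
rewrite big1// => x _; rewrite big1// => y _.
have [xya|] := eqVneq; last by rewrite mulr0n.
rewrite /fps_var; case: eqP; rewrite ?mul0r ?mul0rn// => xe.
by have := congr1 (fun b : mindex I => b i) xya; rewrite /= ai xe !ffunE eqxx.
Qed.

End Order.

(** * Weighted l1-norms and convergence *)

Section Norm.
Variables (R : realType) (K : fieldType) (v : real_valuation R K).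
Variable I : finType.
Implicit Types (f g : fps K I) (a : mindex I) (rho C : R).

(* The weighted l1-norm of [f], with the same radius [rho] in all variables,
   is at most [C]. *)
Definition normle rho C f := forall s : seq (mindex I), uniq s ->
  \sum_(a <- s) v (f a) * rho ^+ bnd a <= C.

Lemma absvN x : v (- x) = v x.
Proof.
have /eqP := absvM v (-1) (-1); rewrite mulrNN mulr1 absv1 => /eqP h.
have : (v (-1) - 1) * (v (-1) + 1) = 0 by rewrite -subr_sqr expr1n expr2 -h subrr.
move/eqP; rewrite mulf_eq0 => /orP[|] /eqP h1; last first.
  by have := absv_ge0 v (-1); lra.
by rewrite -mulN1r absvM (_ : v (-1) = 1) ?mul1r//; lra.
Qed.

(** Every finite set of multi-indices lies in the box whose side is the sum of their degrees. Boxes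
    are convenient for products, arbitrary finite sets for limits and for shifted or injected
    indices. *)
Lemma normle_box rho C f : 0 <= rho -> normle rho C f <->
  forall d, \sum_(b : box I d) v (f (bval b)) * rho ^+ bnd (bval b) <= C.
Proof.
move=> rho0; split=> [fC d|fC s us].
  have us : uniq [seq bval b | b <- enum {: box I d}].
    by rewrite map_inj_uniq ?enum_uniq//; exact: bval_inj.
  by have := fC _ us; rewrite big_map big_enum.
pose d := (\sum_(a <- s) bnd a)%N.
have sd a : a \in s -> bval (binv d a) = a.
  move=> aX; apply: binvK => i; apply: leq_trans (bnd_le a i) _.
  by rewrite /d (big_rem a)//= leq_addr.
apply: le_trans (fC d); pose F a := v (f a) * rho ^+ bnd a.
have -> : \sum_(a <- s) v (f a) * rho ^+ bnd a =
    \sum_(b <- [seq binv d a | a <- s]) F (bval b).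
  by rewrite big_map big_seq [RHS]big_seq; apply: eq_bigr => a /sd ->.
rewrite big_uniq/=; last first.
  by rewrite map_inj_in_uniq// => a b /sd + /sd + ab; rewrite ab => -> ->.
rewrite [leLHS]big_mkcond; apply: ler_sum => b _; case: ifP => // _.
by rewrite mulr_ge0 ?absv_ge0 ?exprn_ge0.
Qed.

Lemma normle_ge0 rho C f : normle rho C f -> 0 <= C.
Proof. by move=> /(_ [::] isT); rewrite big_nil. Qed.

Lemma normle_weaken rho C C' f : C <= C' -> normle rho C f -> normle rho C' f.
Proof. by move=> CC' fC s us; apply: le_trans CC'; exact: fC. Qed.

Lemma normle_zero rho : normle rho 0 (0 : fps K I).
Proof. by move=> s _; rewrite big1// => a _; rewrite absv0 mul0r. Qed.

Lemma normleD rho C C' f g : 0 <= rho ->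
  normle rho C f -> normle rho C' g -> normle rho (C + C') (f + g).
Proof.
move=> rho0 fC gC s us; apply: le_trans (lerD (fC s us) (gC s us)).
rewrite -big_split; apply: ler_sum => a _ /=.
by rewrite -mulrDl ler_wpM2r ?exprn_ge0// absvD.
Qed.

Lemma normleN rho C f : normle rho C f -> normle rho C (- f).
Proof.
move=> fC s us; apply: le_trans (fC s us).
by apply: ler_sum => a _; rewrite fpsNE absvN.
Qed.

Lemma normleB rho C C' f g : 0 <= rho ->
  normle rho C f -> normle rho C' g -> normle rho (C + C') (f - g).
Proof. by move=> rho0 fC gC; apply: normleD => //; exact: normleN. Qed.

Lemma normleZ rho C c f : normle rho C f -> normle rho (v c * C) (c *: f).
Proof.
move=> fC s us; apply: le_trans (ler_wpM2l (absv_ge0 v c) (fC s us)).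
by rewrite mulr_sumr; apply: ler_sum => a _; rewrite fpsZE absvM mulrA.
Qed.

Lemma normle_sum rho (T : Type) (r : seq T) (C : T -> R) (F : T -> fps K I) :
  0 <= rho -> (forall i, normle rho (C i) (F i)) ->
  normle rho (\sum_(i <- r) C i) (\sum_(i <- r) F i).
Proof.
move=> rho0 FC; elim/big_rec2: _ => [|i y x _ yx]; first exact: normle_zero.
exact: normleD.
Qed.

Lemma normleM rho C C' f g : 0 <= rho ->
  normle rho C f -> normle rho C' g -> normle rho (C * C') (f * g).
Proof.
move=> rho0 fC gC; apply/normle_box => // d.
pose w (h : fps K I) a := v (h a) * rho ^+ bnd a.
have w0 h a : 0 <= w h a by rewrite mulr_ge0 ?absv_ge0 ?exprn_ge0.
apply: (@le_trans _ _ ((\sum_(x : box I d) w f (bval x)) *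
                       (\sum_(y : box I d) w g (bval y)))); last first.
  apply: ler_pM; rewrite ?sumr_ge0//.
    exact: (iffLR (normle_box _ _ rho0) fC).
  exact: (iffLR (normle_box _ _ rho0) gC).
rewrite mulr_suml.
apply: (@le_trans _ _ (\sum_(b : box I d) \sum_(x : box I d) \sum_(y : box I d)
    (w f (bval x) * w g (bval y)) *+ (bval x + bval y == bval b))).
  apply: ler_sum => b _; rewrite (Defs.coefM _ _ (@bval_le _ _ b)).
  apply: le_trans (ler_wpM2r (exprn_ge0 _ rho0) (absv_sum _ _ _ _)) _.
  rewrite mulr_suml; apply: ler_sum => x _.
  apply: le_trans (ler_wpM2r (exprn_ge0 _ rho0) (absv_sum _ _ _ _)) _.
  rewrite mulr_suml; apply: ler_sum => y _.
  have [<-|_] := eqVneq; last by rewrite !mulr0n absv0 mul0r.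
  by rewrite !mulr1n absvM bndD exprD mulrACA.
rewrite exchange_big/=; apply: ler_sum => x _.
rewrite exchange_big/= mulr_sumr; apply: ler_sum => y _.
have [/existsP[b xyb]|xyN] :=
    boolP [exists b : box I d, bval x + bval y == bval b].
  rewrite (bigD1 b)//= xyb mulr1n [X in _ + X]big1 ?addr0// => b' b'b.
  rewrite [X in _ *+ nat_of_bool X](_ : _ = false)//; apply: contraNF b'b.
  by rewrite (eqP xyb) => /eqP /bval_inj ->.
rewrite big1; first by apply: mulr_ge0; exact: w0.
move=> b _; rewrite [X in _ *+ nat_of_bool X](_ : _ = false)//.
by apply: contraNF xyN => xyb; apply/existsP; exists b.
Qed.

Lemma normle_delta rho (m : mindex I) : 0 <= rho ->
  normle rho (rho ^+ bnd m) (fun a => (a == m)%:R : K).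
Proof.
move=> rho0 s us; have [ms|msN] := boolP (m \in s).
  rewrite (bigD1_seq m)//= eqxx absv1 mul1r big1 ?addr0// => a /negbTE ->.
  by rewrite absv0 mul0r.
rewrite big_seq big1 ?exprn_ge0// => a as_; case: eqP => [am|_].
  by rewrite -am as_ in msN.
by rewrite absv0 mul0r.
Qed.

Lemma normle_one rho : 0 <= rho -> normle rho 1 (1 : fps K I).
Proof. by move=> rho0; have := normle_delta 0 rho0; rewrite bnd0. Qed.

Lemma normle_var rho i : 0 <= rho -> normle rho rho (fps_var K i).
Proof. by move=> rho0; have := normle_delta (em i) rho0; rewrite bnd_em. Qed.

Lemma normle_mexp (J : finType) rho delta (e : J -> fps K I) (b : mindex J) :
  0 <= rho -> (forall j, normle rho delta (e j)) ->
  normle rho (delta ^+ bnd b) (mexp e b).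
Proof.
move=> rho0 ed; rewrite /mexp /bnd.
elim/big_rec2: _ => [|j y x _ yx]; first exact: normle_one.
rewrite exprD; apply: normleM => //.
elim: (b j) => [|m IH]; first exact: normle_one.
by rewrite !exprS; apply: normleM.
Qed.

(** Each monomial of degree at least [k] gains the factor [t ^+ k]. All later choices of radii play
    this gain for different [k] against each other. *)
Lemma normle_shrink rho C k t f : 0 <= rho -> 0 <= t <= 1 -> ordge k f ->
  normle rho C f -> normle (t * rho) (t ^+ k * C) f.
Proof.
move=> rho0 /andP[t0 t1] fk fC s us.
apply: le_trans (ler_wpM2l (exprn_ge0 k t0) (fC s us)).
rewrite mulr_sumr; apply: ler_sum => a _.
have [ak|ka] := ltnP (bnd a) k; first by rewrite fk// absv0 !mul0r mulr0.
rewrite exprMn [X in _ <= X]mulrCA ler_wpM2l ?absv_ge0//.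
by rewrite ler_wpM2r ?exprn_ge0// ler_wiXn2l.
Qed.

Lemma normle_radius rho rho' C f : 0 < rho -> 0 <= rho' <= rho ->
  normle rho C f -> normle rho' C f.
Proof.
move=> rho0 /andP[r0 r1] fC; have := @normle_shrink rho C 0 (rho' / rho) f.
rewrite divfK ?gt_eqF// expr0 mul1r; apply=> //; first exact: ltW.
by rewrite divr_ge0 ?(ltW rho0)//= ler_pdivrMr// mul1r.
Qed.

Lemma convergent_normle f :
  convergent v f <-> exists rho, 0 < rho /\ exists C, normle rho C f.
Proof.
rewrite convergentP; split=> -[].
  move=> e [e0 [M HM]].
  have [rho [rho0 rhoe]] : exists rho : R, 0 < rho /\ forall i, rho <= e i.
    (* The neutral value 1 keeps the radius positive when there are no variables. *)
    exists (\big[Order.min/1]_i e i); split; last by move=> i; exact: bigmin_le_cond.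
    by elim/big_ind: _ => // x y x0 y0; rewrite lt_min x0.
  exists rho; split => //; exists M; apply/normle_box; first exact: ltW.
  move=> d; apply: le_trans (HM d); apply: ler_sum => b _.
  rewrite ler_wpM2l ?absv_ge0// /bnd expr_sum; apply: ler_prod => i _.
  rewrite exprn_ge0 ?(ltW rho0)//=; apply: lerXn2r;
    rewrite ?nnegrE ?(ltW rho0) ?(ltW (e0 i))//.
move=> rho [rho0 [C fC]]; exists (fun=> rho); split=> //; exists C => d.
apply: le_trans (iffLR (normle_box _ _ (ltW rho0)) fC d).
by apply: ler_sum => b _; rewrite /mexp expr_sum.
Qed.

Lemma normle_common_radius (T : finType) (F : T -> fps K I) :
  (forall i, convergent v (F i)) ->
  exists rho, 0 < rho /\ exists C, forall i, normle rho C (F i).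
Proof.
move=> cF; have /choice[h hP] : forall i, exists p : R * R,
    0 < p.1 /\ normle p.1 p.2 (F i).
  by move=> i; have /convergent_normle[r [r0 [C FC]]] := cF i; exists (r, C).
have [rho [rho0 rhoe]] : exists rho : R, 0 < rho /\ forall i, rho <= (h i).1.
  exists (\big[Order.min/1]_i (h i).1); split; last first.
    by move=> i; exact: bigmin_le_cond.
  by elim/big_ind: _ => // [x y x0 y0|i _]; [rewrite lt_min x0|case: (hP i)].
exists rho; split=> //; exists (\sum_i (h i).2) => i.
have [h0 hn] := hP i; apply: (@normle_weaken _ (h i).2).
  rewrite (bigD1 i)//= lerDl sumr_ge0// => j _.
  by case: (hP j) => _ /normle_ge0.
by apply: normle_radius hn; rewrite ?(ltW rho0) ?rhoe.
Qed.

End Norm.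

(** * Fixed points and substitution *)

Section FixedPoint.
Variables (R : realType) (K : fieldType) (v : real_valuation R K).
Variables (T : Type) (J : finType) (k : nat) (rho delta : R).

Definition admissible (y : T -> fps K J) :=
  forall i, ordge k (y i) /\ normle v rho delta (y i).

(* The iterates stabilise coefficientwise, and the norm bound only involves
   finitely many coefficients at a time: no completeness of [K] is needed. *)
Lemma contraction_fixpoint (F : (T -> fps K J) -> T -> fps K J) :
  0 <= delta ->
  (forall y, admissible y -> admissible (F y)) ->
  (forall y y' d, admissible y -> admissible y' ->
     (forall i, ordge d (y i - y' i)) ->
     forall i, ordge d.+1 (F y i - F y' i)) ->
  exists y, admissible y /\ forall i, F y i = y i.
Proof.
move=> delta0 Fadm Fcontr.
pose u n := iter n F (fun=> 0).
have uadm n : admissible (u n).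
  elim: n => [i|n IH]; last exact: Fadm.
  by split=> //; apply: normle_weaken delta0 _; exact: normle_zero.
have uS n : forall i, ordge n (u n.+1 i - u n i).
  by elim: n => [|n IH] i //; apply: (Fcontr (u n.+1) (u n)).
have uD n m i : ordge n (u (m + n)%N i - u n i).
  elim: m => [|m IH]; first by rewrite subrr.
  rewrite -(subrKA (u (m + n)%N i)); apply: ordgeD => //.
  by apply: ordge_le (uS _ i); rewrite leq_addl.
(* Coefficients of degree [m] no longer change from the iterate [m.+1] on, so they are read off
   there. *)
pose y i : fps K J := fun a => u (bnd a).+1 i a.
have yE n i a : (bnd a < n)%N -> y i a = u n i a.
  move=> an; have /(_ a (leqnn _))/eqP := uD (bnd a).+1 (n - (bnd a).+1)%N i.
  by rewrite subnK// fpsDE fpsNE subr_eq0 => /eqP.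
have yu n i : ordge n (y i - u n i).
  by move=> a an; rewrite fpsDE fpsNE (yE n)// subrr.
have yadm : admissible y.
  move=> i; split=> [a ak|s us].
    by rewrite (yE (bnd a).+1)//; case: (uadm (bnd a).+1 i) => ->.
  pose N := (\sum_(a <- s) bnd a)%N.
  have [_ /(_ s us)] := uadm N.+1 i; apply: le_trans.
  rewrite big_seq [leRHS]big_seq; apply: ler_sum => a as_.
  by rewrite (yE N.+1)// ltnS /N (big_rem a)//= leq_addr.
exists y; split=> // i; apply/eqP; rewrite -subr_eq0; apply/eqP.
apply: ordge_eq0 => n; rewrite -(subrKA (u n.+1 i)); apply: ordgeD.
  by apply: (@ordge_le _ _ n n.+1) => //; apply: Fcontr.
by rewrite -opprB; apply/ordgeN; apply: (@ordge_le _ _ n n.+1).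
Qed.

End FixedPoint.

(** * Substitution into formal series *)

Section Substitution.
Variables (K : fieldType) (I J : finType).
Implicit Types (e : I -> fps K J) (f g : fps K I).

(** When the [e i] have no constant term, only monomials of degree at most [bnd a] reach the
    coefficient at [a], and the box of side [bnd a] contains them all. This replaces the infinite
    sum by a finite one. *)
Definition fsubst e f : fps K J := fun a =>
  \sum_(b : box I (bnd a)) f (bval b) * mexp e (bval b) a.

Lemma fsubstE e f d a : (forall i, ordge 1 (e i)) -> (bnd a <= d)%N ->
  fsubst e f a = \sum_(b : box I d) f (bval b) * mexp e (bval b) a.
Proof.
move=> e1 ad; rewrite (@sum_box_eq _ _ (fun b => f b * mexp e b a) (bnd a))//.
by move=> b ab; rewrite (ordge_mexp e1)// mulr0.
Qed.

Lemma fsubst_approx e f d : (forall i, ordge 1 (e i)) ->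
  ordge d.+1 (fsubst e f - \sum_(b : box I d) f (bval b) *: mexp e (bval b)).
Proof.
move=> e1 a ad; rewrite fpsDE fpsNE (fsubstE _ e1 ad) fps_sumE.
by apply/eqP; rewrite subr_eq0.
Qed.

Lemma fsubstD e f g : fsubst e (f + g) = fsubst e f + fsubst e g.
Proof.
apply/funext => a; rewrite fpsDE -big_split; apply: eq_bigr => b _.
by rewrite fpsDE mulrDl.
Qed.

Lemma fsubstZ e c f : fsubst e (c *: f) = c *: fsubst e f.
Proof.
apply/funext => a; rewrite fpsZE mulr_sumr; apply: eq_bigr => b _.
by rewrite fpsZE mulrA.
Qed.

Lemma mexp0 (A : comPzRingType) (w : I -> A) : mexp w 0 = 1.
Proof. by rewrite /mexp big1// => i _; rewrite ffunE expr0. Qed.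

Lemma mexp_add (A : comPzRingType) (w : I -> A) (a b : mindex I) :
  mexp w (a + b) = mexp w a * mexp w b.
Proof. by rewrite -big_split; apply: eq_bigr => i _; rewrite ffunE exprD. Qed.

Lemma mexp_em (A : comPzRingType) (w : I -> A) i : mexp w (em i) = w i.
Proof.
rewrite /mexp (bigD1 i)//= ffunE eqxx expr1 big1 ?mulr1// => j /negbTE ji.
by rewrite ffunE ji expr0.
Qed.

Lemma fsubst_delta e (m : mindex I) : (forall i, ordge 1 (e i)) ->
  fsubst e (fun b => (b == m)%:R) = mexp e m.
Proof.
move=> e1; apply/funext => a.
rewrite (@fsubstE _ _ (bnd a + bnd m)%N)// ?leq_addr//.
rewrite (bigD1 (binv _ m))//= binvK; last first.
  by move=> i; apply: leq_trans (bnd_le m i) (leq_addl _ _).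
rewrite eqxx mul1r big1 ?addr0// => b bm.
rewrite (_ : _ == m = false) ?mul0r//.
by apply: contraNF bm => /eqP bm; rewrite -[b]bvalK bm.
Qed.

Lemma fsubst1 e : (forall i, ordge 1 (e i)) -> fsubst e 1 = 1.
Proof. by move=> e1; rewrite -[RHS](mexp0 e) -(fsubst_delta 0 e1). Qed.

Lemma fsubst_var e i : (forall i, ordge 1 (e i)) ->
  fsubst e (fps_var K i) = e i.
Proof. by move=> e1; rewrite -[RHS](mexp_em e) -(fsubst_delta _ e1). Qed.

(** Modulo order [d.+1], substitution is the truncated sum [app]. The latter is multiplicative up to
    products of monomials whose exponent leaves the box, and such exponents have degree above
    [d]. *)
Lemma fsubstM e f g : (forall i, ordge 1 (e i)) ->
  fsubst e (f * g) = fsubst e f * fsubst e g.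
Proof.
move=> e1; apply/eqP; rewrite -subr_eq0; apply/eqP; apply: ordge_eq0.
case=> // d.
pose app h := \sum_(b : box I d) h (bval b) *: mexp e (bval b).
have appE h : ordge d.+1 (fsubst e h - app h) by exact: fsubst_approx.
have -> : fsubst e (f * g) - fsubst e f * fsubst e g =
    (fsubst e (f * g) - app (f * g)) - (fsubst e f - app f) * fsubst e g
    - app f * (fsubst e g - app g) + (app (f * g) - app f * app g) by ring.
apply: ordgeD; first apply: ordgeB; first apply: ordgeB => //.
- exact: ordgeMr.
- exact: ordgeMl.
have -> : app (f * g) = \sum_(x : box I d) \sum_(y : box I d) \sum_(b : box I d)
    ((f (bval x) * g (bval y)) *+ (bval x + bval y == bval b))
      *: mexp e (bval b).
  rewrite /app; under eq_bigr => b _.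
    rewrite (Defs.coefM _ _ (@bval_le _ _ b)) scaler_suml.
    under eq_bigr => x _ do rewrite scaler_suml.
    over.
  rewrite exchange_big/=; apply: eq_bigr => x _.
  by rewrite exchange_big.
rewrite /app mulr_suml -sumrB; apply: ordge_sum => x _.
rewrite mulr_sumr -sumrB; apply: ordge_sum => y _.
rewrite -scalerAl -scalerAr scalerA -mexp_add.
have [/existsP[b xyb]|xyN] :=
    boolP [exists b : box I d, bval x + bval y == bval b].
  rewrite (bigD1 b)//= xyb mulr1n big1 ?addr0 ?(eqP xyb) ?subrr//.
  move=> b' b'b; rewrite [X in _ *+ nat_of_bool X](_ : _ = false) ?scale0r//.
  by apply: contraNF b'b => /eqP /bval_inj ->.
rewrite big1 => [|b _]; last first.
  rewrite [X in _ *+ nat_of_bool X](_ : _ = false) ?scale0r//.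
  by apply: contraNF xyN => xyb; apply/existsP; exists b.
rewrite sub0r; apply: ordgeN; apply: ordgeZ.
apply: (@ordge_le _ _ _ (bnd (bval x + bval y))); last exact: ordge_mexp.
rewrite ltnNge; apply: contra xyN => xyd; apply/existsP.
exists (binv d (bval x + bval y)); rewrite binvK// => i.
exact: leq_trans (bnd_le _ _) xyd.
Qed.

Lemma ordge_fsubst k e f : (forall i, ordge 1 (e i)) -> ordge k f ->
  ordge k (fsubst e f).
Proof.
move=> e1 fk a ak; rewrite /fsubst big1// => b _.
have [bk|kb] := ltnP (bnd (bval b)) k; first by rewrite fk// mul0r.
by rewrite (ordge_mexp e1) ?mulr0//; apply: leq_trans ak kb.
Qed.

Lemma ordge_expB (k m : nat) (x y : fps K J) :
  ordge k (x - y) -> ordge k (x ^+ m - y ^+ m).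
Proof. by move=> xy; rewrite subrXX; exact: ordgeMr. Qed.

Lemma ordge_mexpB k e e' (b : mindex I) : (forall i, ordge k (e i - e' i)) ->
  ordge k (mexp e b - mexp e' b).
Proof.
move=> ee; rewrite /mexp; elim/big_rec2: _ => [|i x y _ xy].
  by rewrite subrr.
have -> : e i ^+ b i * y - e' i ^+ b i * x =
  (e i ^+ b i - e' i ^+ b i) * y + e' i ^+ b i * (y - x) by ring.
apply: ordgeD; [apply: ordgeMr; exact: ordge_expB | exact: ordgeMl].
Qed.

Lemma ordge_fsubstB k e e' f : (forall i, ordge k (e i - e' i)) ->
  ordge k (fsubst e f - fsubst e' f).
Proof.
move=> ee a ak; rewrite fpsDE fpsNE /fsubst -sumrB big1// => b _.
by rewrite -mulrBr; have /(_ a ak) := @ordge_mexpB k e e' (bval b) ee;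
  rewrite fpsDE fpsNE => ->; rewrite mulr0.
Qed.

(** After exchanging the sums, the coefficient of [f] at [b] is weighted by the norm of [mexp e b],
    at most [delta ^+ bnd b]: the norm of [f] at radius [delta] appears. *)
Lemma normle_fsubst (R : realType) (v : real_valuation R K)
    rho delta C e f : (0 <= rho) -> (forall i, ordge 1 (e i)) ->
  (forall i, normle v rho delta (e i)) -> normle v delta C f ->
  normle v rho C (fsubst e f).
Proof.
move=> rho0 e1 ed fC s us; pose D := (\sum_(a <- s) bnd a)%N.
apply: (@le_trans _ _ (\sum_(a <- s) \sum_(b : box I D)
   v (f (bval b)) * (v (mexp e (bval b) a) * rho ^+ bnd a))).
  rewrite big_seq [leRHS]big_seq; apply: ler_sum => a as_.
  rewrite (@fsubstE _ _ D)//; last by rewrite /D (big_rem a)//= leq_addr.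
  apply: le_trans (ler_wpM2r (exprn_ge0 _ rho0) (absv_sum _ _ _ _)) _.
  by rewrite mulr_suml; apply: ler_sum => b _; rewrite absvM mulrA.
rewrite exchange_big/=.
have us' : uniq [seq bval b | b <- enum {: box I D}].
  by rewrite map_inj_uniq ?enum_uniq//; exact: bval_inj.
have := fC _ us'; rewrite big_map big_enum/=; apply: le_trans.
apply: ler_sum => b _; rewrite -mulr_sumr ler_wpM2l ?absv_ge0//.
exact: (normle_mexp _ rho0 ed).
Qed.

End Substitution.

(** * Division by variables and homomorphisms *)

Section Division.
Variables (K : fieldType) (I : finType) (P : pred I).
Implicit Types (f g : fps K I) (a : mindex I).

(* Each monomial divisible by some [x_i] with [P i] is divided by exactly one
   such variable. *)
Definition divvar a := [pick i | P i && (0 < a i)%N].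

Definition fdiv i f : fps K I := fun a =>
  if divvar (a + em i) == Some i then f (a + em i) else 0.

Definition frest f : fps K I := fun a => if divvar a is None then f a else 0.

Lemma fdivB i f g : fdiv i (f - g) = fdiv i f - fdiv i g.
Proof.
apply/funext => a; rewrite fpsDE fpsNE /fdiv.
by case: ifP => _ //; rewrite subrr.
Qed.

Lemma fdiv_decomp f : f = frest f + \sum_(i | P i) fps_var K i * fdiv i f.
Proof.
apply/funext => a; rewrite fpsDE fps_sumE /frest.
case Ea: (divvar a) => [i|]; last first.
  rewrite big1 ?addr0// => j Pj.
  rewrite coefXM0//; move: Ea; rewrite /divvar; case: pickP => // /(_ j).
  by rewrite Pj/= lt0n => /negbFE /eqP.
have /andP[Pi ai] : P i && (0 < a i)%N.
  by move: Ea; rewrite /divvar; case: pickP => // j ? [<-].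
have [b ab] := mindex_subK ai; rewrite add0r (bigD1 i)//= {2}ab coefXM.
rewrite big1 ?addr0 => [|j /andP[_ /negbTE ji]].
  by rewrite /fdiv -ab Ea eqxx.
have [/eqP aj|aj] := posnP (a j); first by rewrite coefXM0//; apply/eqP.
have [c ac] := mindex_subK aj; rewrite {1}ac coefXM /fdiv -ac Ea.
by case: eqP => // -[ij]; rewrite ij eqxx in ji.
Qed.

Lemma frest_out f a i : P i -> (0 < a i)%N -> frest f a = 0.
Proof.
move=> Pi ai; rewrite /frest /divvar; case: pickP => // /(_ i).
by rewrite Pi ai.
Qed.

Lemma frest_in f a : (forall i, P i -> a i = 0%N) -> frest f a = f a.
Proof.
move=> a0; rewrite /frest /divvar; case: pickP => // i /andP[Pi].
by rewrite a0.
Qed.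

Lemma ordge_frest k f : ordge k f -> ordge k (frest f).
Proof. by move=> fk a ak; rewrite /frest fk//; case: divvar. Qed.

Lemma ordge_fdiv k i f : ordge k.+1 f -> ordge k (fdiv i f).
Proof.
move=> fk a ak; rewrite /fdiv fk ?if_same//.
by rewrite bndD bnd_em addn1.
Qed.

Lemma normle_fdiv (R : realType) (v : real_valuation R K) rho C i f :
  0 < rho -> normle v rho C f -> normle v rho (C / rho) (fdiv i f).
Proof.
move=> rho0 fC s us; rewrite ler_pdivlMr// mulr_suml.
have us' : uniq [seq a + em i | a <- s].
  by rewrite map_inj_uniq//; exact: addm_inj.
have := fC _ us'; rewrite big_map; apply: le_trans; apply: ler_sum => a _.
rewrite bndD bnd_em addn1 exprSr mulrA ler_wpM2r ?(ltW rho0)//.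
rewrite ler_wpM2r ?exprn_ge0 ?(ltW rho0)// /fdiv.
by case: ifP; rewrite ?absv0 ?absv_ge0.
Qed.

End Division.

(** * Division and units in the ring of convergent series *)

Section ConvergentSeries.
Variables (R : realType) (K : fieldType) (v : real_valuation R K).
Variable I : finType.
Implicit Types (f g : cps v I).

Definition mkcps (f : fps K I) (cf : convergent v f) : cps v I :=
  Cps (asboolT cf : f \in cvg_pred v).

Lemma cps_convergent f : convergent v f.
Proof. by apply/asboolP; exact: (valP f). Qed.

Lemma cps_inj f g : fps_of f = fps_of g -> f = g.
Proof. exact: val_inj. Qed.

Lemma cpsD f g : fps_of (f + g) = fps_of f + fps_of g. Proof. by []. Qed.
Lemma cpsN f : fps_of (- f) = - fps_of f. Proof. by []. Qed.
Lemma cpsM f g : fps_of (f * g) = fps_of f * fps_of g. Proof. by []. Qed.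
Lemma cpsZ c f : fps_of (c *: f) = c *: fps_of f. Proof. by []. Qed.
Lemma cps1 : fps_of (1 : cps v I) = 1. Proof. by []. Qed.
Lemma mkcpsE (f : fps K I) (cf : convergent v f) : fps_of (mkcps cf) = f.
Proof. by []. Qed.
Lemma cps_sum (T : Type) (r : seq T) (P : pred T) (F : T -> cps v I) :
  fps_of (\sum_(i <- r | P i) F i) = \sum_(i <- r | P i) fps_of (F i).
Proof. exact: (big_morph (@fps_of _ _ v I)). Qed.

Lemma convergent_fdiv P i (f : fps K I) :
  convergent v f -> convergent v (fdiv P i f).
Proof.
move=> /convergent_normle[rho [rho0 [C fC]]]; apply/convergent_normle.
by exists rho; split=> //; exists (C / rho); exact: normle_fdiv.
Qed.

Definition cdiv P i f : cps v I := mkcps (convergent_fdiv P i (cps_convergent f)).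

(** Hadamard's lemma without derivatives or integration. It drives all the inductions on orders for
    abstract homomorphisms. *)
Lemma cps_decomp f :
  f = fps_of f 0 *: 1 + \sum_i cps_var v i * cdiv predT i f.
Proof.
apply: cps_inj; rewrite cpsD cps_sum {1}(fdiv_decomp predT f).
congr (_ + _); apply/funext => a; rewrite cpsZ fpsZE cps1 fps1E.
have [->|a0] := eqVneq a 0.
  by rewrite frest_in ?mulr1// => i _; rewrite ffunE.
have /bnd_gt0[i ai] : (0 < bnd a)%N.
  by rewrite lt0n; apply: contraNneq a0 => /bnd_eq0 ->.
by rewrite mulr0; exact: (frest_out _ _ ai).
Qed.

Lemma cdiv_ordge k P i f : ordge k.+1 f -> ordge k (cdiv P i f).
Proof. exact: ordge_fdiv. Qed.

(** The inverse is the fixed point of [y |-> 1 + f * y]. With the factor [t] the norm of [f] drops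
    to at most 1/2, so the ball of radius 2 is invariant. Convergent units are what detects constant
    terms algebraically. *)
Lemma cps_geometric f : ordge 1 f -> exists g, (1 - f) * g = 1.
Proof.
move=> f1; have /convergent_normle[r [r0 [C fC]]] := cps_convergent f.
have C0 := normle_ge0 fC.
pose t := (C + C + 1)^-1.
have t0 : 0 < t by rewrite invr_gt0; lra.
have t1 : t <= 1 by rewrite invf_le1; lra.
have tC : t * C <= 2^-1.
  rewrite /t mulrC ler_pdivrMr; lra.
have ft : normle v (t * r) (2^-1) f.
  apply: (normle_weaken tC); rewrite -[X in X * C]expr1.
  by apply: normle_shrink; rewrite ?(ltW r0) ?(ltW t0).
have tr0 : 0 < t * r by exact: mulr_gt0.
pose F (y : unit -> fps K I) := fun _ : unit => 1 + fps_of f * y tt.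
have [|||y [yadm Fy]] := @contraction_fixpoint _ _ v unit I 0 (t * r) 2 F.
- by [].
- move=> y yadm i; split=> //; have [_ yn] := yadm tt.
  have -> : 2 = 1 + 2^-1 * 2 :> R by lra.
  apply: normleD; rewrite ?(ltW tr0)//; first exact/normle_one/ltW.
  by apply: normleM; rewrite ?(ltW tr0).
- move=> y y' d _ _ yy i; rewrite /F opprD addrACA subrr add0r -mulrBr.
  exact: (@ordgeM _ _ 1).
have cy : convergent v (y tt).
  by apply/convergent_normle; exists (t * r); split => //; exists 2; case: (yadm tt).
exists (mkcps cy); apply: cps_inj; rewrite cpsM cpsD cpsN cps1 mulrBl mul1r /=.
by rewrite -{1}[y tt]Fy /F addrK.
Qed.

End ConvergentSeries.

(** * Algebra homomorphisms between rings of convergent series *)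

Section Homomorphisms.
Variables (R : realType) (K : fieldType) (v : real_valuation R K).
Variables I J : finType.
Implicit Types (f g : cps v I) (phi psi : {lrmorphism cps v I -> cps v J}).

(** If the image of [x_i] had a constant term [c] different from 0, the unit [1 - c^-1 *: x_i] would
    be mapped to a series without constant term, which is not a unit. *)
Lemma hom_local phi i : ordge 1 (phi (cps_var v i)).
Proof.
apply/ordge1P/eqP/negPn/negP => c0; set c := fps_of _ 0 in c0.
have x1 : ordge 1 (c^-1 *: cps_var v i) by apply/ordgeZ/ordge_var.
have [g /(congr1 phi)] := cps_geometric x1.
rewrite rmorphM rmorphB !rmorph1/= linearZ/= => /(congr1 (fun h : cps v J => fps_of h 0)).
rewrite cpsM coef0M cpsD cpsN cpsZ fpsDE fpsNE fpsZE -/c mulVf// cps1 fps1E.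
by rewrite eqxx subrr mul0r => /esym/eqP; rewrite oner_eq0.
Qed.

Lemma hom_decomp phi f : phi f = fps_of f 0 *: 1 +
  \sum_i phi (cps_var v i) * phi (cdiv predT i f) :> cps v J.
Proof.
rewrite [in LHS](cps_decomp f) rmorphD/= linearZ/= rmorph1 rmorph_sum/=.
by congr (_ + _); apply: eq_bigr => i _; rewrite rmorphM.
Qed.

Lemma hom_ordge phi k f : ordge k f -> ordge k (phi f).
Proof.
elim: k f => // k IH f fk; rewrite hom_decomp (_ : fps_of f 0 = 0); last first.
  by apply: fk; rewrite bnd0.
rewrite scale0r add0r cps_sum; apply: ordge_sum => i _.
rewrite cpsM; apply: (@ordgeM _ _ 1); first exact: hom_local.
by apply: IH; exact: cdiv_ordge.
Qed.

(** By [hom_decomp], the difference at [f] is a combination of differences at the quotients of [f],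
    multiplied by series of order at least 1; its order is therefore infinite. *)
Lemma hom_eq phi psi :
  (forall i, phi (cps_var v i) = psi (cps_var v i)) -> phi =1 psi.
Proof.
move=> e f; apply/eqP; rewrite -subr_eq0; apply/eqP/cps_inj/ordge_eq0 => k.
elim: k f => // k IH f; rewrite (hom_decomp phi) (hom_decomp psi).
have -> : forall (a b c : cps v J), (a + b) - (a + c) = b - c.
  by move=> a b c; rewrite opprD addrACA subrr add0r.
rewrite -sumrB cps_sum; apply: ordge_sum => i _.
by rewrite e -mulrBr cpsM; apply: (@ordgeM _ _ 1) => //; exact: hom_local.
Qed.

Variable e : I -> cps v J.

Let e0 i : fps K J := fps_of (e i - fps_of (e i) 0 *: 1).

Let e01 i : ordge 1 (e0 i).
Proof.
by apply/ordge1P; rewrite /e0 cpsD cpsN cpsZ fpsDE fpsNE fpsZE cps1 fps1E eqxx mulr1 subrr.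
Qed.

(** Since the [e0 i] have order at least 1, shrinking the radius by [t] brings their norms from [D]
    to at most [t * D], below the radius [r] at which [f] converges. *)
Lemma convergent_fsubst f : convergent v (fsubst e0 f).
Proof.
have /convergent_normle[r [r0 [C fC]]] := cps_convergent f.
have [r' [r'0 [C' eC]]] := @normle_common_radius _ _ v J I e0
  (fun i => cps_convergent _).
apply/convergent_normle.
pose D := `|C'| + 1; have D0 : 0 < D by rewrite ltr_wpDl.
have eD i : normle v r' D (e0 i).
  by apply: normle_weaken (eC i); apply: le_trans (ler_norm _) _; rewrite lerDl.
pose t := Num.min 1 (r / D).
have t0 : 0 < t by rewrite lt_min ltr01 divr_gt0.
have tr0 : 0 < t * r' by exact: mulr_gt0.
exists (t * r'); split=> //; exists C.
apply: (normle_fsubst (ltW tr0) e01 _ fC) => i.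
apply: (@normle_weaken _ _ _ _ _ (t ^+ 1 * D)).
  by rewrite expr1 -ler_pdivlMr// ge_min lexx orbT.
by apply: normle_shrink; rewrite ?(ltW r'0) ?(ltW t0) ?ge_min ?lexx.
Qed.

(* Dropping the constant terms makes this a homomorphism for every [e]. *)
Definition csubst f : cps v J := mkcps (convergent_fsubst f).

Lemma csubst_zmod_morphism : zmod_morphism csubst.
Proof.
move=> f g; apply: cps_inj; rewrite cpsD cpsN /=.
by rewrite -[- fps_of g]scaleN1r fsubstD fsubstZ scaleN1r.
Qed.

Lemma csubst_monoid_morphism : monoid_morphism csubst.
Proof.
split; first by apply: cps_inj; exact: fsubst1.
by move=> f g; apply: cps_inj; rewrite cpsM /csubst !mkcpsE cpsM fsubstM.
Qed.

Lemma csubst_scalable : scalable csubst.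
Proof. by move=> c f; apply: cps_inj; exact: fsubstZ. Qed.

HB.instance Definition _ :=
  GRing.isZmodMorphism.Build (cps v I) (cps v J) csubst csubst_zmod_morphism.
HB.instance Definition _ :=
  GRing.isMonoidMorphism.Build (cps v I) (cps v J) csubst csubst_monoid_morphism.
HB.instance Definition _ :=
  GRing.isScalable.Build K (cps v I) (cps v J) *:%R csubst csubst_scalable.

Definition csubst_hom : {lrmorphism cps v I -> cps v J} := csubst.

Lemma csubst_var i : ordge 1 (e i) -> csubst_hom (cps_var v i) = e i.
Proof.
move=> /ordge1P ei; apply: cps_inj; rewrite /= (fsubst_var _ e01) /e0 ei.
by rewrite scale0r subr0.
Qed.

End Homomorphisms.

(** * Inverse function theorem *)

Section LinearPart.
Variables (K : fieldType) (I : finType).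
Implicit Types (f g : fps K I) (a : mindex I).

Lemma bnd_eq1 a : bnd a = 1%N -> exists i, a = em i.
Proof.
move=> a1; have /bnd_gt0[i ai] : (0 < bnd a)%N by rewrite a1.
have [b ab] := mindex_subK ai; exists i; rewrite ab (_ : b = 0) ?add0r//.
by apply: bnd_eq0; apply/eqP; rewrite -(eqn_add2r 1) -{1}(bnd_em i) -bndD -ab a1.
Qed.

Lemma ordgeS1P f : ordge 1 f -> (forall i, f (em i) = 0) -> ordge 2 f.
Proof.
move=> f1 fe a; rewrite ltnS leq_eqVlt => /orP[/eqP /bnd_eq1[i ->]//|].
exact: f1.
Qed.

Lemma var_em (i j : I) : fps_var K i (em j) = (i == j)%:R.
Proof. by rewrite /fps_var (inj_eq (@em_inj I)) eq_sym. Qed.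

Lemma ordge_const f : ordge 1 (f - f 0 *: 1).
Proof.
by apply/ordge1P; rewrite fpsDE fpsNE fpsZE fps1E eqxx mulr1 subrr.
Qed.

Lemma coef_emM f g i : ordge 1 f -> (f * g) (em i) = f (em i) * g 0.
Proof.
move=> f1; rewrite -{1}(subrK (g 0 *: 1) g) mulrDr fpsDE.
rewrite (@ordgeM _ _ 1 1)//; [|exact: ordge_const|by rewrite bnd_em].
by rewrite add0r -scalerAr mulr1 fpsZE mulrC.
Qed.

Lemma linear_decomp f : ordge 1 f ->
  ordge 2 (f - \sum_i f (em i) *: fps_var K i).
Proof.
move=> f1; apply: ordgeS1P => [|i].
  by apply: ordgeB => //; apply: ordge_sum => i _; apply/ordgeZ/ordge_var.
rewrite fpsDE fpsNE fps_sumE (bigD1 i)//= fpsZE var_em eqxx mulr1.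
rewrite big1 ?addr0 ?subrr// => j /negbTE ji.
by rewrite fpsZE var_em ji mulr0.
Qed.

End LinearPart.

Section InverseFunction.
Variables (R : realType) (K : fieldType) (v : real_valuation R K).

Lemma fsubst_sum (I J : finType) (e : I -> fps K J) (T : Type) (r : seq T)
    (P : pred T) (F : T -> fps K I) :
  fsubst e (\sum_(i <- r | P i) F i) = \sum_(i <- r | P i) fsubst e (F i).
Proof.
apply: (big_morph (fsubst e)); first exact: fsubstD.
by apply/funext => a; rewrite /fsubst big1// => b _; rewrite mul0r.
Qed.

Lemma fdiv_decomp1 (I : finType) (f : fps K I) : ordge 1 f ->
  f = \sum_i fps_var K i * fdiv predT i f.
Proof.
move=> f1; rewrite {1}(fdiv_decomp predT f) (_ : frest _ _ = 0) ?add0r//.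
apply/funext => a; have [->|a0] := eqVneq a 0.
  by rewrite frest_in ?(ordge1P _).1// => i _; rewrite ffunE.
have /bnd_gt0[i ai] : (0 < bnd a)%N.
  by rewrite lt0n; apply: contraNneq a0 => /bnd_eq0 ->.
exact: (frest_out _ _ ai).
Qed.

(** Write [f] as a sum of products of [x_i] with series of order at least 1. In the difference of
    two products, the extra order comes from the quotient in one term and from [e' i] in the
    other. *)
Lemma fsubst_contraction (I J : finType) d (e e' : I -> fps K J) f :
  (forall i, ordge 1 (e i)) -> (forall i, ordge 1 (e' i)) ->
  (forall i, ordge d (e i - e' i)) -> ordge 2 f ->
  ordge d.+1 (fsubst e f - fsubst e' f).
Proof.
move=> e1 e'1 ee f2; rewrite (@fdiv_decomp1 _ f); last exact: ordge_le f2.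
rewrite !fsubst_sum -sumrB; apply: ordge_sum => i _.
rewrite !fsubstM// !fsubst_var//; set g := fdiv _ _ _.
have g1 : ordge 1 g by exact: ordge_fdiv.
have -> : e i * fsubst e g - e' i * fsubst e' g =
  (e i - e' i) * fsubst e g + e' i * (fsubst e g - fsubst e' g) by ring.
apply: ordgeD; last by apply: (@ordgeM _ _ 1) => //; exact: ordge_fsubstB.
by rewrite -addn1; apply: ordgeM => //; exact: ordge_fsubst.
Qed.

Variable I : finType.

(** The ball has radius [t * rho]. The quadratic gain [t ^+ 2] lets a small [t] confine the
    remainder to half of it; [rho'] is then chosen so that the linear term takes the other half. *)
Lemma inverse_radii (A C rho : R) : 0 < A -> 0 <= C -> 0 < rho ->
  exists t rho', [/\ 0 < t, t <= 1, 0 < rho' & A * (rho' + t ^+ 2 * C) <= t * rho].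
Proof.
move=> A0 C0 rho0; pose D := 2 * A * (C + 1).
have D0 : 0 < D by rewrite !mulr_gt0//; lra.
pose t := Num.min 1 (rho / D).
have t0 : 0 < t by rewrite lt_min ltr01 divr_gt0.
have tD : t * D <= rho by rewrite -ler_pdivlMr// ge_min lexx orbT.
exists t, (t * rho / (2 * A)); split=> //; first by rewrite ge_min lexx.
  by rewrite !mulr_gt0// invr_gt0 mulr_gt0.
have -> : A * (t * rho / (2 * A) + t ^+ 2 * C) = t * (rho / 2 + t * (A * C)).
  by field; rewrite gt_eqF.
rewrite ler_pM2l//.
have : t * (2 * (A * C)) <= rho.
  apply: le_trans tD; rewrite ler_pM2l// /D -mulrA ler_pM2l ?ler_pM2l//; lra.
lra.
Qed.

(** With [r] the nonlinear part of [e], the images [y] of the variables under [psi] have to satisfy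
    [y = L (x - r (y))], a contraction for the order because [r] has order at least 2. *)
Lemma inverse_function_right (e : I -> cps v I) (L : I -> I -> K) :
  (forall i, ordge 1 (e i)) ->
  (forall i j, \sum_k fps_of (e i) (em k) * L k j = (i == j)%:R) ->
  exists psi : {lrmorphism cps v I -> cps v I},
    (forall i, psi (e i) = cps_var v i) /\
    forall i j, fps_of (psi (cps_var v i)) (em j) = L i j.
Proof.
move=> e1 eL.
pose r i : cps v I := e i - \sum_j fps_of (e i) (em j) *: cps_var v j.
have r2 i : ordge 2 (r i).
  by rewrite /r cpsD cpsN cps_sum; exact: linear_decomp.
have [rho0 [rho00 [C rC]]] := @normle_common_radius _ _ v I I (fun i => fps_of (r i))
  (fun i => cps_convergent _).
pose A := \sum_i \sum_j v (L i j) + 1.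
have A0 : 0 < A.
  by rewrite ltr_wpDl// sumr_ge0// => i _; rewrite sumr_ge0// => j _; exact: absv_ge0.
pose C' := `|C|.
have {}rC i : normle v rho0 C' (r i).
  by apply: normle_weaken (rC i); exact: ler_norm.
have [t [rho [t0 t1 rhop bound]]] := inverse_radii A0 (normr_ge0 C) rho00.
pose F (y : I -> fps K I) i :=
  \sum_j L i j *: (fps_var K j - fsubst y (r j)).
have [|||y [yadm Fy]] := @contraction_fixpoint _ _ v I I 1 rho (t * rho0) F.
- by rewrite mulr_ge0// ltW.
- move=> y yadm i; have y1 j : ordge 1 (y j) by case: (yadm j).
  split.
    apply: ordge_sum => j _; apply/ordgeZ/ordgeB; first exact: ordge_var.
    by apply: ordge_fsubst => //; exact: ordge_le (r2 j).
  apply: normle_weaken bound _.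
  apply: (@normle_weaken _ _ _ _ _ (\sum_j v (L i j) * (rho + t ^+ 2 * C'))).
    rewrite -mulr_suml ler_wpM2r//.
      by rewrite addr_ge0 ?(ltW rhop)// mulr_ge0 ?sqr_ge0 ?normr_ge0.
    rewrite /A [in leRHS](bigD1 i)//= -addrA lerDl addr_ge0// sumr_ge0// => k _.
    by rewrite sumr_ge0// => j _; exact: absv_ge0.
  apply: normle_sum => [|j]; first exact: ltW.
  apply/normleZ/normleB; [exact: ltW|exact/normle_var/ltW|].
  apply: (normle_fsubst (ltW rhop) y1) => [k|].
    by case: (yadm k) => _; apply.
  by apply: normle_shrink; rewrite ?(ltW rho00) ?(ltW t0).
- move=> y y' d yadm y'adm yy i; rewrite /F -sumrB; apply: ordge_sum => j _.
  rewrite -scalerBr; apply: ordgeZ.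
  rewrite opprB addrC addrA subrK -opprB; apply: ordgeN.
  by apply: fsubst_contraction => // k; [case: (yadm k)|case: (y'adm k)].
have y1 i : ordge 1 (y i) by case: (yadm i).
have cy i : convergent v (y i).
  by apply/convergent_normle; exists rho; split=> //; exists (t * rho0); case: (yadm i).
pose psi := csubst_hom (fun i => mkcps (cy i)).
have psix i : psi (cps_var v i) = mkcps (cy i) by apply: csubst_var; exact: y1.
have psir i : fps_of (psi (r i)) = fsubst y (r i).
  congr fsubst; apply/funext => j; rewrite (ordge1P _).1 ?scale0r ?subr0//.
  exact: y1.
have yE i : mkcps (cy i) = \sum_j L i j *: (cps_var v j - psi (r j)).
  apply: cps_inj; rewrite cps_sum mkcpsE -[LHS]Fy; apply: eq_bigr => j _.
  by rewrite cpsZ cpsD cpsN psir.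
exists psi; split=> [i|i j].
  have -> : e i = (\sum_j fps_of (e i) (em j) *: cps_var v j) + r i.
    by rewrite addrC subrK.
  rewrite rmorphD/= linear_sum/=; under eq_bigr do rewrite linearZ/= psix yE scaler_sumr.
  rewrite exchange_big/= (eq_bigr (fun j => (i == j)%:R *: (cps_var v j - psi (r j)))).
    rewrite (bigD1 i)//= eqxx scale1r big1 ?addr0 ?subrK// => j /negbTE ij.
    by rewrite eq_sym ij scale0r.
  move=> j _; rewrite -eL scaler_suml; apply: eq_bigr => k _.
  by rewrite scalerA.
have E k : fps_of (L i k *: (cps_var v k - psi (r k))) (em j) =
    L i k * (k == j)%:R.
  rewrite cpsZ fpsZE cpsD cpsN fpsDE fpsNE psir.
  by rewrite (ordge_fsubst y1 (r2 k)) ?bnd_em// [fps_of _ _]var_em subr0.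
rewrite psix yE cps_sum fps_sumE (eq_bigr _ (fun k _ => E k)).
rewrite (bigD1 j)//= eqxx mulr1 big1 ?addr0// => k /negbTE ->.
by rewrite mulr0.
Qed.

(** The one-sided inverse [psi] has the invertible linear part [L], so it has a one-sided inverse in
    turn; as in a group, [psi] is then two-sided. *)
Lemma inverse_function (phi : {lrmorphism cps v I -> cps v I})
    (L : I -> I -> K) :
  (forall i j, \sum_k fps_of (phi (cps_var v i)) (em k) * L k j = (i == j)%:R) ->
  (forall i j, \sum_k L i k * fps_of (phi (cps_var v k)) (em j) = (i == j)%:R) ->
  exists psi : {lrmorphism cps v I -> cps v I},
    cancel phi psi /\ cancel psi phi.
Proof.
move=> pL Lp.
have [psi [psiK psiL]] := inverse_function_right (hom_local phi) pL.
have phiK : cancel phi psi.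
  move=> f; have := @hom_eq _ _ v I I (psi \o phi) idfun psiK f.
  by [].
have psiLp i j : \sum_k fps_of (psi (cps_var v i)) (em k) *
    fps_of (phi (cps_var v k)) (em j) = (i == j)%:R.
  by rewrite -Lp; apply: eq_bigr => k _; rewrite psiL.
have [chi [chiK _]] := inverse_function_right (hom_local psi) psiLp.
have psiK' : cancel psi chi.
  by move=> f; have := @hom_eq _ _ v I I (chi \o psi) idfun chiK f.
exists psi; split=> // f.
by rewrite -[LHS]psiK' phiK psiK'.
Qed.

Lemma coef0_hom (J : finType) (phi : {lrmorphism cps v I -> cps v J}) f :
  fps_of (phi f) 0 = fps_of f 0.
Proof.
rewrite hom_decomp cpsD fpsDE cpsZ fpsZE cps1 fps1E eqxx mulr1 cps_sum fps_sumE.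
rewrite big1 ?addr0// => i _; rewrite cpsM coef0M (ordge1P _).1 ?mul0r//.
exact: hom_local.
Qed.

Lemma fdiv_em0 (f : fps K I) i : fdiv predT i f 0 = f (em i).
Proof.
rewrite /fdiv add0r /divvar; case: pickP => [j|/(_ i)].
  by rewrite ffunE /= lt0b => /eqP ->; rewrite eqxx.
by rewrite ffunE eqxx.
Qed.

(** The chain rule at the origin. *)
Lemma lin_hom (J : finType) (phi : {lrmorphism cps v I -> cps v J}) f j :
  fps_of (phi f) (em j) =
  \sum_i fps_of f (em i) * fps_of (phi (cps_var v i)) (em j).
Proof.
rewrite hom_decomp cpsD fpsDE cpsZ fpsZE cps1 fps1E cps_sum fps_sumE.
rewrite (_ : em j == 0 = false) ?mulr0 ?add0r; last first.
  by apply: contraTF isT => /eqP /(congr1 (@bnd _)); rewrite bnd_em bnd0.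
apply: eq_bigr => i _; rewrite cpsM coef_emM; last exact: hom_local.
by rewrite coef0_hom mulrC; congr (_ * _); exact: fdiv_em0.
Qed.

End InverseFunction.

(** * Quadratic forms and right equivalence *)

Section QuadraticForms.
Variables (K : fieldType) (B : comAlgType K).

(** [A] need not be symmetric: in characteristic 2, symmetric matrices yield no mixed terms. The
    polar form is [A + A^T]. The values lie in any commutative algebra, so that the same form can be
    evaluated at variables and at their images. *)
Definition qform k (A : 'M[K]_k) (y : 'I_k -> B) : B :=
  \sum_i \sum_j A i j *: (y i * y j).

Lemma qformD k (A : 'M[K]_k) (y t : 'I_k -> B) :
  qform A (fun i => y i + t i) =
  qform A y + (\sum_i y i * \sum_j (A + A^T) i j *: t j) + qform A t.
Proof.
have -> : \sum_i y i * \sum_j (A + A^T) i j *: t j =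
    (\sum_i \sum_j A i j *: (y i * t j)) + \sum_i \sum_j A i j *: (t i * y j).
  rewrite [X in _ = _ + X]exchange_big -big_split; apply: eq_bigr => i _ /=.
  rewrite mulr_sumr -big_split; apply: eq_bigr => j _ /=.
  by rewrite !mxE -scalerAr scalerDl (mulrC (t j)).
rewrite /qform -!big_split; apply: eq_bigr => i _ /=.
rewrite -!big_split; apply: eq_bigr => j _ /=.
rewrite -!scalerDr mulrDl !mulrDr; congr (_ *: _).
by rewrite !addrA.
Qed.

Lemma qform_linear k m (A : 'M[K]_k) (M : 'M_(k, m)) (y : 'I_m -> B) :
  qform A (fun i => \sum_j M i j *: y j) = qform (M^T *m A *m M) y.
Proof.
transitivity (\sum_i \sum_j \sum_s \sum_t (M i s * A i j * M j t) *: (y s * y t)).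
  apply: eq_bigr => i _; apply: eq_bigr => j _.
  rewrite mulr_suml scaler_sumr; apply: eq_bigr => s _.
  rewrite mulr_sumr scaler_sumr; apply: eq_bigr => t _.
  rewrite -scalerAl -scalerAr !scalerA; congr (_ *: _).
  by rewrite [A i j * _]mulrC.
rewrite (eq_bigr (fun i => \sum_s \sum_j \sum_t
    (M i s * A i j * M j t) *: (y s * y t))); last first.
  by move=> i _; rewrite exchange_big.
rewrite exchange_big/=; apply: eq_bigr => s _.
rewrite (eq_bigr (fun i => \sum_t \sum_j
    (M i s * A i j * M j t) *: (y s * y t))); last first.
  by move=> i _; rewrite exchange_big.
rewrite exchange_big/=; apply: eq_bigr => t _.
rewrite exchange_big/= !mxE scaler_suml; apply: eq_bigr => j _.
rewrite !mxE mulr_suml scaler_suml; apply: eq_bigr => i _.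
by rewrite !mxE.
Qed.

(** Entries above and below the diagonal cancel in pairs. Two matrices thus give the same form as
    soon as their diagonals and their polar forms agree, which allows forms to be compared without
    dividing by 2. *)
Lemma qform_alternating k (A : 'M[K]_k) (y : 'I_k -> B) :
  A + A^T = 0 -> (forall i, A i i = 0) -> qform A y = 0.
Proof.
move=> AT A0; rewrite /qform.
have AE i j : A j i = - A i j.
  by apply/eqP; rewrite -addr_eq0 addrC; move/matrixP/(_ i j): AT; rewrite !mxE => ->.
pose S (R : rel nat) := \sum_(i < k) \sum_(j < k | R i j) A i j *: (y i * y j).
have -> : \sum_i \sum_j A i j *: (y i * y j) = S ltn + S gtn.
  rewrite -big_split; apply: eq_bigr => i _ /=.
  rewrite (bigD1 i)//= A0 scale0r add0r (bigID (fun j : 'I_k => (i < j)%N))/=.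
  congr (_ + _); apply: eq_bigl => j; rewrite -val_eqE/=; first by case: ltngtP.
  by case: ltngtP.
have -> : S gtn = - S ltn.
  rewrite /S (exchange_big_dep xpredT)//= -sumrN; apply: eq_bigr => i _.
  rewrite -sumrN; apply: eq_bigr => j _.
  by rewrite AE scaleNr mulrC.
by rewrite subrr.
Qed.

End QuadraticForms.

Lemma hom_qform (K : fieldType) (B B' : comAlgType K)
    (phi : {lrmorphism B -> B'}) k (A : 'M[K]_k) y :
  phi (qform A y) = qform A (phi \o y).
Proof.
rewrite /qform rmorph_sum; apply: eq_bigr => i _.
rewrite rmorph_sum; apply: eq_bigr => j _.
by rewrite /= linearZ/= rmorphM.
Qed.

(** * Right equivalence and powers of the maximal ideal *)

Section RightEquivalence.
Variables (R : realType) (K : fieldType) (v : real_valuation R K).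
Variable I : finType.
Implicit Types (f g h : cps v I).

(** [bijective] only provides an inverse function. It is replaced by the substitution of its values
    at the variables, which [hom_eq] shows to be inverse to [phi]. *)
Lemma hom_inverse (phi : {lrmorphism cps v I -> cps v I}) : bijective phi ->
  exists psi : {lrmorphism cps v I -> cps v I}, cancel phi psi /\ cancel psi phi.
Proof.
case=> g phiK gK; pose psi := csubst_hom (fun i => g (cps_var v i)).
have psix i : psi (cps_var v i) = g (cps_var v i).
  by apply: csubst_var; apply/ordge1P; rewrite -(coef0_hom phi) gK; exact/ordge1P/ordge_var.
have psiK : cancel psi phi.
  move=> f; have := @hom_eq _ _ v I I (phi \o psi) idfun.
  by apply=> i; rewrite /= psix gK.
exists psi; split=> // f; apply: (can_inj phiK); exact: psiK.
Qed.

Lemma right_equivI (phi psi : {lrmorphism cps v I -> cps v I}) f g :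
  cancel phi psi -> cancel psi phi -> phi f = g -> right_equiv f g.
Proof. by move=> pK psK fg; exists phi; split=> //; exists psi. Qed.

Lemma right_equiv_sym f g : right_equiv f g -> right_equiv g f.
Proof.
move=> [phi [bphi fg]]; have [psi [phiK psiK]] := hom_inverse bphi.
by exists psi; split; [exists phi|rewrite -fg phiK].
Qed.

Lemma right_equiv_trans f g h :
  right_equiv f g -> right_equiv g h -> right_equiv f h.
Proof.
move=> [phi [bphi fg]] [psi [bpsi gh]].
exists (psi \o phi); split; first exact: bij_comp.
by rewrite /= fg gh.
Qed.

Lemma ordge_prod k (F : 'I_k -> cps v I) : (forall j, ordge 1 (F j)) ->
  ordge k (\prod_(j < k) F j).
Proof.
elim: k F => // k IH F F1; rewrite big_ord_recl cpsM.
by apply: (@ordgeM _ _ 1) => //; exact: IH.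
Qed.

(** Division by variables preserves convergence, so [k] successive divisions write a series of order
    at least [k] as a combination of [k]-fold products with convergent coefficients. *)
Lemma maxideal_expP k f : maxideal_exp k f <-> ordge k f.
Proof.
split=> [[c ->]|].
  rewrite cps_sum; apply: ordge_sum => s _; rewrite cpsM; apply: ordgeMl.
  by apply: ordge_prod => j; exact: ordge_var.
elim: k f => [|k IH] f fk.
  (* There is exactly one function from ['I_0], whose product is empty. *)
  exists (fun=> f); rewrite (eq_bigr (fun=> f)) => [|s _].
    by rewrite sumr_const card_ffun card_ord expn0.
  by rewrite big_ord0 mulr1.
have /choice[c cP] : forall i, exists c : {ffun 'I_k -> I} -> cps v I,
    cdiv predT i f = \sum_s c s * \prod_(j < k) cps_var v (s j).
  by move=> i; apply: IH; exact: cdiv_ordge.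
pose tl (s : {ffun 'I_k.+1 -> I}) : {ffun 'I_k -> I} :=
  [ffun j => s (lift ord0 j)].
pose cns (p : I * {ffun 'I_k -> I}) : {ffun 'I_k.+1 -> I} :=
  [ffun j => if unlift ord0 j is Some j' then p.2 j' else p.1].
exists (fun s : {ffun 'I_k.+1 -> I} => c (s ord0) (tl s)).
rewrite {1}(cps_decomp f) (_ : fps_of f 0 = 0) ?scale0r ?add0r; last first.
  by apply: fk; rewrite bnd0.
rewrite (reindex cns)/=; last first.
  exists (fun s : {ffun 'I_k.+1 -> I} => (s ord0, tl s)) => [[i s] _|s _].
    rewrite /cns/= ffunE unlift_none; congr (_, _).
    by apply/ffunP => j; rewrite !ffunE liftK.
  apply/ffunP => j; rewrite !ffunE; case: unliftP => [j' ->|-> //].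
  by rewrite ffunE.
rewrite -(pair_bigA _ (fun i s => c (cns (i, s) ord0) (tl (cns (i, s))) *
  \prod_(j < k.+1) cps_var v (cns (i, s) j)))/=.
apply: eq_bigr => i _; rewrite cP mulr_sumr; apply: eq_bigr => s _.
rewrite big_ord_recl !ffunE unlift_none/=.
have -> : tl (cns (i, s)) = s by apply/ffunP => j; rewrite !ffunE liftK.
rewrite mulrCA; congr (_ * (_ * _)); apply: eq_bigr => j _.
by rewrite !ffunE liftK.
Qed.

End RightEquivalence.

(** * Inclusion of a ring in fewer variables as a homomorphism *)

Section InclusionHom.
Variables (R : realType) (K : fieldType) (v : real_valuation R K).
Variables (I : finType) (P : pred I).
Implicit Types (g : cps v {i : I | P i}).

Definition incl_hom : {lrmorphism cps v {i : I | P i} -> cps v I} :=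
  csubst_hom (fun j => cps_var v (val j)).

Lemma incl_hom_var j : incl_hom (cps_var v j) = cps_var v (val j).
Proof. exact/csubst_var/ordge_var. Qed.

Lemma fps_incl_varM (j : {i : I | P i}) (g : fps K {i : I | P i}) :
  fps_incl (fps_var K j * g) = fps_var K (val j) * fps_incl g.
Proof.
apply/funext => a; have [aj|aj] := posnP (a (val j)).
  rewrite coefXM0// /fps_incl; case: ifP => // _.
  by rewrite coefXM0// ffunE.
have [b ab] := mindex_subK aj; rewrite ab coefXM /fps_incl.
have -> : [forall i, P i || ((b + em (val j)) i == 0%N)] =
          [forall i, P i || (b i == 0%N)].
  apply: eq_forallb => i; rewrite !ffunE.
  by have [->|_] := eqVneq i (val j); rewrite ?(valP j)//= [(_ + 0)%R]addn0.
case: ifP => // _; rewrite -(coefXM j g); congr (_ _).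
by apply/ffunP => i; rewrite !ffunE (inj_eq val_inj).
Qed.

Lemma fps_inclD (f g : fps K {i : I | P i}) :
  fps_incl (f + g) = fps_incl f + fps_incl g.
Proof.
by apply/funext => a; rewrite fpsDE /fps_incl; case: ifP => // _; rewrite addr0.
Qed.

Lemma fps_incl_sum (T : Type) (r : seq T) (F : T -> fps K {i : I | P i}) :
  fps_incl (\sum_(i <- r) F i) = \sum_(i <- r) fps_incl (F i).
Proof.
apply: (big_morph (@fps_incl K I P)); first exact: fps_inclD.
by apply/funext => a; rewrite /fps_incl if_same.
Qed.

Lemma fps_incl_const c :
  fps_incl (c *: 1 : fps K {i : I | P i}) = c *: 1 :> fps K I.
Proof.
apply/funext => a; rewrite /fps_incl !fpsZE !fps1E; case: ifP => aP.
  congr (_ * _%:R); congr nat_of_bool.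
  apply/eqP/eqP => [/ffunP a0|->]; last by apply/ffunP => j; rewrite !ffunE.
  apply/ffunP => i; rewrite ffunE; have := forallP aP i.
  case: (boolP (P i)) => [Pi _|_ /eqP//].
  by have := a0 (Sub i Pi); rewrite !ffunE.
case: eqP => [a0|]; rewrite ?mulr0//.
by move/forallP: aP => -[] i; rewrite a0 ffunE eqxx orbT.
Qed.

Lemma fps_of_incl g : fps_of (cps_incl g) = fps_incl (fps_of g).
Proof. by []. Qed.

(** Identifies the coefficientwise inclusion with a substitution, to which the results on
    homomorphisms apply. *)
Lemma cps_inclE g : cps_incl g = incl_hom g.
Proof.
apply/eqP; rewrite -subr_eq0; apply/eqP/cps_inj/ordge_eq0 => k.
elim: k g => // k IH g; rewrite hom_decomp {1}(cps_decomp g).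
have -> : cps_incl (fps_of g 0 *: 1 + \sum_i cps_var v i * cdiv predT i g) =
   fps_of g 0 *: 1 + \sum_i cps_var v (val i) * cps_incl (cdiv predT i g).
  apply: cps_inj; rewrite fps_of_incl.
  rewrite !cpsD !cps_sum fps_inclD fps_incl_sum cpsZ fps_incl_const.
  by congr (_ + _); apply: eq_bigr => i _; rewrite !cpsM -fps_incl_varM.
have -> : forall (a b c : cps v I), (a + b) - (a + c) = b - c.
  by move=> a b c; rewrite opprD addrACA subrr add0r.
rewrite -sumrB cps_sum; apply: ordge_sum => i _; rewrite incl_hom_var.
rewrite -mulrBr cpsM; apply: (@ordgeM _ _ 1) => //; exact: ordge_var.
Qed.

Definition push (b : mindex {i : I | P i}) : mindex I :=
  [ffun i => if insub i is Some j then b j else 0%N].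

Lemma push_val b (j : {i : I | P i}) : push b (val j) = b j.
Proof. by rewrite ffunE valK. Qed.

Lemma push_inj : injective push.
Proof.
by move=> b c /ffunP bc; apply/ffunP => j; have := bc (val j); rewrite !push_val.
Qed.

Lemma bnd_push b : bnd (push b) = bnd b.
Proof.
rewrite /bnd (bigID P)/= [X in (_ + X)%N]big1 ?addn0 => [|i /negbTE Pi].
  by rewrite big_sub/=; apply: eq_bigr => j _; exact: push_val.
by rewrite ffunE insubF.
Qed.

Lemma incl_hom_restrict (f : cps v I) :
  (forall a : mindex I, (exists2 i, ~~ P i & (0 < a i)%N) -> fps_of f a = 0) ->
  exists g, incl_hom g = f.
Proof.
move=> f0; have cg : convergent v (fun b => fps_of f (push b)).
  have /convergent_normle[r [r0 [C fC]]] := cps_convergent f.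
  apply/convergent_normle; exists r; split=> //; exists C => s us.
  have us' : uniq (map push s) by rewrite map_inj_uniq//; exact: push_inj.
  have := fC _ us'; rewrite big_map; apply: le_trans.
  by apply: ler_sum => b _; rewrite bnd_push.
exists (mkcps cg); rewrite -cps_inclE; apply: cps_inj; apply/funext => a.
rewrite /= /fps_incl; case: ifP => aP.
  congr (fps_of f _); apply/ffunP => i; rewrite ffunE.
  case: insubP => [j _ <-|/negbTE Pi]; first by rewrite ffunE.
  by have := forallP aP i; rewrite Pi => /eqP.
rewrite f0//; move/negbT: aP; rewrite negb_forall => /existsP[i].
by rewrite negb_or -lt0n => /andP[]; exists i.
Qed.

End InclusionHom.

(** * Hessian, quadratic part and linear part *)

Section Hessian.
Variables (R : realType) (K : fieldType) (v : real_valuation R K) (n : nat).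
Implicit Types (f g : cps v 'I_n).

Local Notation x := (@cps_var R K v 'I_n).

(** The factor is 2 on the diagonal: in characteristic 2 the Hessian only sees the mixed terms. *)
Lemma hessianE (f : fps K 'I_n) i j :
  hessian f i j = f (em i + em j) *+ (i == j).+1.
Proof.
rewrite /hessian mxE /fps_at0 /fps_deriv !ffunE add0r mulr1n.
congr (f _ *+ _); congr S; congr nat_of_bool.
by rewrite eq_sym.
Qed.

Lemma hessianD (f g : fps K 'I_n) : hessian (f + g) = hessian f + hessian g.
Proof. by apply/matrixP => i j; rewrite [RHS]mxE !hessianE -mulrnDl. Qed.

Lemma hessian_ordge3 (f : fps K 'I_n) : ordge 3 f -> hessian f = 0.
Proof.
move=> f3; apply/matrixP => i j.
by rewrite hessianE mxE f3 ?mul0rn// bndD !bnd_em.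
Qed.

Lemma hessian_congr (f g : fps K 'I_n) :
  ordge 3 (f - g) -> hessian f = hessian g.
Proof. by move=> fg; rewrite -(subrK g f) hessianD hessian_ordge3// add0r. Qed.

Lemma hessian_var2 s t i j : hessian (x s * x t) i j =
  (s == i)%:R * (t == j)%:R + (s == j)%:R * (t == i)%:R.
Proof.
rewrite hessianE cpsM; have [<-|si] := eqVneq s i.
  rewrite addrC coefXM [fps_of _ _]var_em.
  have [<-|sj] := eqVneq s j; first by rewrite mulr2n mul1r.
  by rewrite mulr1n mul1r mul0r addr0.
have [<-|sj] := eqVneq s j.
  rewrite coefXM [fps_of _ _]var_em [i == s]eq_sym (negbTE si) mulr1n.
  by rewrite mul0r mul1r add0r.
rewrite coefXM0 ?mul0rn ?mul0r ?addr0//.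
by rewrite !ffunE (negbTE si) (negbTE sj).
Qed.

Lemma hessian_qform (A : 'M[K]_n) : hessian (qform A x) = A + A^T.
Proof.
apply/matrixP => i j.
have lin (T : Type) (r : seq T) (F : T -> cps v 'I_n) :
    hessian (fps_of (\sum_(k <- r) F k)) i j = \sum_(k <- r) hessian (F k) i j.
  rewrite cps_sum hessianE fps_sumE -sumrMnl; apply: eq_bigr => k _.
  by rewrite hessianE.
have scale c (f : cps v 'I_n) : hessian (fps_of (c *: f)) i j = c * hessian f i j.
  by rewrite !hessianE cpsZ fpsZE mulrnAr.
rewrite /qform lin; under eq_bigr => s _ do rewrite lin.
under eq_bigr => s _ do under eq_bigr => t _ do rewrite scale hessian_var2 mulrDr.
under eq_bigr do rewrite big_split/=.
rewrite big_split/= !mxE; congr (_ + _).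
  rewrite (bigD1 i)//= (bigD1 j)//= !eqxx !mulr1 !big1 ?addr0// => [s|t] /negbTE ts.
    by rewrite big1// => t _; rewrite ts mul0r mulr0.
  by rewrite ts !mulr0.
rewrite (bigD1 j)//= (bigD1 i)//= !eqxx !mulr1 !big1 ?addr0// => [s|t] /negbTE ts.
  by rewrite big1// => t _; rewrite ts mul0r mulr0.
by rewrite ts !mulr0.
Qed.

(** Two successive divisions by variables. Each mixed monomial is assigned to one of its two matrix
    entries, so no coefficient is halved. *)
Lemma quadratic_part f : ordge 2 f -> exists A, ordge 3 (f - qform A x).
Proof.
move=> f2; pose g i := cdiv predT i f.
exists (\matrix_(i, j) fps_of (g i) (em j)).
have -> : f - qform (\matrix_(i, j) fps_of (g i) (em j)) x =
    \sum_i x i * (g i - \sum_j fps_of (g i) (em j) *: x j).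
  rewrite [in LHS](cps_decomp f) (_ : fps_of f 0 = 0) ?scale0r ?add0r; last first.
    by apply: f2; rewrite bnd0.
  rewrite -sumrB; apply: eq_bigr => i _; rewrite mulrBr; congr (_ - _).
  by rewrite mulr_sumr; apply: eq_bigr => j _; rewrite mxE scalerAr.
rewrite cps_sum; apply: ordge_sum => i _; rewrite cpsM; apply: (@ordgeM _ _ 1).
  exact: ordge_var.
rewrite cpsD cpsN cps_sum; apply: linear_decomp; exact: cdiv_ordge.
Qed.

Lemma qform_congr (I : finType) k (A : 'M[K]_k) d (y y' : 'I_k -> fps K I) :
  (forall i, ordge d (y i)) -> (forall i, ordge d (y' i)) ->
  forall m, (forall i, ordge m (y i - y' i)) ->
  ordge (m + d) (qform A y - qform A y').
Proof.
move=> yd y'd m yy; rewrite -sumrB; apply: ordge_sum => i _.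
rewrite -sumrB; apply: ordge_sum => j _; rewrite -scalerBr; apply: ordgeZ.
have -> : y i * y j - y' i * y' j = (y i - y' i) * y j + (y j - y' j) * y' i.
  by ring.
by apply: ordgeD; apply: ordgeM.
Qed.

Lemma cps_qform (I : finType) k (A : 'M[K]_k) (y : 'I_k -> cps v I) :
  fps_of (qform A y) = qform A (fun i => fps_of (y i)).
Proof.
rewrite cps_sum; apply: eq_bigr => i _; rewrite cps_sum.
by apply: eq_bigr => j _.
Qed.

Definition jac (I : finType) (phi : {lrmorphism cps v 'I_n -> cps v I}) i j : K :=
  fps_of (phi (x i)) (em j).

Lemma jac_linear (I : finType) (phi : {lrmorphism cps v 'I_n -> cps v I}) i :
  ordge 2 (phi (x i) - \sum_j jac phi i j *: cps_var v j).
Proof. by rewrite cpsD cpsN cps_sum; apply: linear_decomp; exact: hom_local. Qed.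

Section Endomorphism.
Variable phi : {lrmorphism cps v 'I_n -> cps v 'I_n}.

Let L : 'M[K]_n := \matrix_(i, j) jac phi i j.

Lemma hom_quadratic_part (A : 'M[K]_n) f : ordge 3 (f - qform A x) ->
  ordge 3 (phi f - qform (L^T *m A *m L) x).
Proof.
move=> fA; rewrite -(subrKA (phi (qform A x))) cpsD; apply: ordgeD.
  by rewrite -rmorphB; exact: hom_ordge.
rewrite hom_qform -qform_linear cpsD cpsN !cps_qform.
apply: (@qform_congr _ _ _ 1 _ _ _ _ 2) => i.
- exact: hom_local.
- by rewrite cps_sum; apply: ordge_sum => j _; apply/ordgeZ/ordge_var.
- rewrite -cpsN -cpsD /=.
  have := jac_linear phi i; congr (ordge 2 (fps_of (_ - _))).
  by apply: eq_bigr => j _; rewrite mxE.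
Qed.

Lemma hessian_hom f : ordge 2 f -> hessian (phi f) = L^T *m hessian f *m L.
Proof.
move=> f2; have [A fA] := quadratic_part f2.
rewrite (hessian_congr fA) hessian_qform.
rewrite (hessian_congr (hom_quadratic_part fA)) hessian_qform.
by rewrite mulmxDr mulmxDl !trmx_mul trmxK mulmxA.
Qed.

End Endomorphism.

Lemma inverse_function_id (phi : {lrmorphism cps v 'I_n -> cps v 'I_n}) :
  (forall i, ordge 2 (phi (x i) - x i)) ->
  exists psi : {lrmorphism cps v 'I_n -> cps v 'I_n},
    cancel phi psi /\ cancel psi phi.
Proof.
move=> phi1.
have jE i j : fps_of (phi (x i)) (em j) = (i == j)%:R.
  rewrite -(subrK (x i) (phi (x i))) cpsD fpsDE phi1 ?bnd_em// add0r.
  exact: var_em.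
have dE i j : \sum_(k : 'I_n) (i == k)%:R * (k == j)%:R = (i == j)%:R :> K.
  rewrite (bigD1 i)//= eqxx mul1r big1 ?addr0// => k /negbTE.
  by rewrite eq_sym => ->; rewrite mul0r.
apply: (@inverse_function _ _ _ _ phi (fun i j => (i == j)%:R)) => i j.
  by rewrite -dE; apply: eq_bigr => k _; rewrite jE.
by rewrite -dE; apply: eq_bigr => k _; rewrite jE.
Qed.

End Hessian.

(** * Splitting off a nondegenerate quadratic form *)

Section SplitVariables.
Variables (n k : nat) (kn : (k <= n)%N).

Local Notation w := (widen_ord kn).
Local Notation J := {i : 'I_n | (k <= i)%N}.

Lemma split_varP (s : 'I_n) :
  (exists i : 'I_k, s = w i) \/ (exists j : J, s = val j).
Proof.
have [sk|ks] := ltnP s k; [left|right; by exists (Sub s ks)].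
by exists (Ordinal sk); exact/val_inj.
Qed.

Lemma sum_split (V : nmodType) (F : 'I_n -> V) :
  \sum_s F s = \sum_(i < k) F (w i) + \sum_(j : J) F (val j).
Proof.
rewrite (bigID (fun s : 'I_n => (s < k)%N))/= (big_ord_narrow kn).
congr (_ + _); rewrite (eq_bigl (fun s : 'I_n => (k <= s)%N)); first by rewrite big_sub.
by move=> s; rewrite -leqNgt.
Qed.

(** The final 0 is never reached: an index that is not at least [k] is below [k]. *)
Definition glue (T : nmodType) (y : 'I_k -> T) (z : J -> T) (s : 'I_n) : T :=
  if insub s is Some j then z j
  else if insub (val s) is Some i then y i else 0.

Lemma glueL (T : nmodType) (y : 'I_k -> T) z i : glue y z (w i) = y i.
Proof.
rewrite /glue insubF; last by rewrite leqNgt /= ltn_ord.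
case: insubP => [i' _ /val_inj -> //|].
by rewrite /= ltn_ord.
Qed.

Lemma glueR (T : nmodType) (y : 'I_k -> T) z (j : J) : glue y z (val j) = z j.
Proof. by rewrite /glue valK. Qed.

Lemma widen_val (i : 'I_k) (j : J) : (w i == val j) = false.
Proof.
apply/eqP => /(congr1 (@nat_of_ord n))/= ij.
by have := valP j; rewrite /= -ij leqNgt ltn_ord.
Qed.

Lemma widen_inj : injective w.
Proof. by move=> i i' /(congr1 val)/= /val_inj. Qed.

Variables (R : realType) (K : fieldType) (v : real_valuation R K).

Local Notation x := (@cps_var R K v 'I_n).
Local Notation incl := (@incl_hom R K v 'I_n (fun i => (k <= i)%N)).

Definition glue_hom (I : finType) (y : 'I_k -> cps v I) (z : J -> cps v I) :
    {lrmorphism cps v 'I_n -> cps v I} := csubst_hom (glue y z).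

Lemma glue_homL (I : finType) (y : 'I_k -> cps v I) (z : J -> cps v I) i :
  ordge 1 (y i) -> glue_hom y z (x (w i)) = y i.
Proof. by move=> y1; rewrite csubst_var glueL. Qed.

Lemma glue_homR (I : finType) (y : 'I_k -> cps v I) (z : J -> cps v I) j :
  ordge 1 (z j) -> glue_hom y z (x (val j)) = z j.
Proof. by move=> z1; rewrite csubst_var glueR. Qed.

Lemma hom_eq_split (I : finType) (phi psi : {lrmorphism cps v 'I_n -> cps v I}) :
  (forall i, phi (x (w i)) = psi (x (w i))) ->
  (forall j : J, phi (x (val j)) = psi (x (val j))) -> phi =1 psi.
Proof.
move=> eL eR; apply: hom_eq => s.
by have [[i ->]|[j ->]] := split_varP s.
Qed.

Lemma hom_fix_incl (phi : {lrmorphism cps v 'I_n -> cps v 'I_n}) g :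
  (forall j : J, phi (x (val j)) = x (val j)) -> phi (incl g) = incl g.
Proof.
move=> phij; have := @hom_eq _ _ v _ _ (phi \o incl) incl.
by apply=> j; rewrite /= incl_hom_var.
Qed.

Lemma ordge_incl d (g : cps v J) : ordge d (incl g) -> ordge d g.
Proof.
rewrite -cps_inclE => gd b bd.
have := gd (push b); rewrite bnd_push => /(_ bd).
rewrite /= /fps_incl ifT => [<-|].
  by congr (fps_of g _); apply/ffunP => j; rewrite ffunE push_val.
apply/forallP => i; rewrite ffunE.
by case: insubP => [j -> //|_]; rewrite orbT.
Qed.

Definition block_hom (M : 'M[K]_k) : {lrmorphism cps v 'I_n -> cps v 'I_n} :=
  glue_hom (fun i => \sum_j M i j *: x (w j)) (fun j => x (val j)).

Lemma block_homL M i : block_hom M (x (w i)) = \sum_j M i j *: x (w j).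
Proof.
apply: glue_homL; rewrite cps_sum; apply: ordge_sum => j _.
exact/ordgeZ/ordge_var.
Qed.

Lemma block_homR M (j : J) : block_hom M (x (val j)) = x (val j).
Proof. exact/glue_homR/ordge_var. Qed.

Lemma block_homK M M' : M *m M' = 1%:M -> cancel (block_hom M) (block_hom M').
Proof.
move=> MM' f; apply: (@hom_eq_split _ (block_hom M' \o block_hom M) idfun) => [i|j].
  rewrite /= block_homL linear_sum/=.
  under eq_bigr do rewrite linearZ/= block_homL scaler_sumr.
  rewrite exchange_big/= (bigD1 i)//= [X in _ + X]big1 => [|j ji].
    rewrite addr0; under eq_bigr do rewrite scalerA.
    rewrite -scaler_suml; have /matrixP/(_ i i) := MM'.
    by rewrite !mxE eqxx => ->; rewrite scale1r.
  under eq_bigr do rewrite scalerA.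
  rewrite -scaler_suml; have /matrixP/(_ i j) := MM'.
  by rewrite !mxE eq_sym (negbTE ji) => ->; rewrite scale0r.
by rewrite /= !block_homR.
Qed.

Lemma block_hom_qform M (A : 'M[K]_k) :
  block_hom M (qform A (x \o w)) = qform (M^T *m A *m M) (x \o w).
Proof.
rewrite hom_qform -qform_linear; apply: eq_bigr => i _; apply: eq_bigr => j _.
by rewrite /= !block_homL.
Qed.

Lemma normle_qform (I : finType) (A : 'M[K]_k) rho delta (y : 'I_k -> fps K I) :
  0 <= rho -> (forall i, normle v rho delta (y i)) ->
  normle v rho ((\sum_i \sum_j v (A i j)) * delta ^+ 2) (qform A y).
Proof.
move=> rho0 yd; rewrite mulr_suml; apply: normle_sum => // i.
rewrite mulr_suml; apply: normle_sum => // j.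
by apply: normleZ; rewrite expr2; apply: normleM.
Qed.

(** At radius [t * rho] the remainder is of size [t ^+ 3], the quadratic form on a ball of radius
    [D * t ^+ 2] of size [t ^+ 4], and division costs one factor [t]. Hence [D] is dictated by the
    cubic remainder, and [t] only has to make the contribution [q * t] of the quadratic form at most
    1. *)
Lemma splitting_radii (a b C rho : R) : 0 <= a -> 0 <= b -> 0 <= C -> 0 < rho ->
  exists t D, [/\ 0 < t, t <= 1, 0 <= D &
    b * ((t ^+ 3 * C + a * (D * t ^+ 2) ^+ 2) / (t * rho)) <= D * t ^+ 2].
Proof.
move=> a0 b0 C0 rho0; pose D := (b * C + 1) / rho.
have bC0 : 0 <= b * C by rewrite mulr_ge0.
have D0 : 0 <= D by rewrite divr_ge0 ?(ltW rho0)// addr_ge0.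
pose q := b * (a * D ^+ 2).
have q0 : 0 <= q by rewrite mulr_ge0// mulr_ge0// sqr_ge0.
have q1 : 0 < q + 1 by rewrite ltr_wpDl.
exists (q + 1)^-1, D; set t := (q + 1)^-1.
have t0 : 0 < t by rewrite invr_gt0.
split=> //; first by rewrite invf_le1// lerDr.
have -> : b * ((t ^+ 3 * C + a * (D * t ^+ 2) ^+ 2) / (t * rho)) =
    (b * C + q * t) / rho * t ^+ 2.
  by rewrite /q; field; rewrite !gt_eqF.
rewrite ler_wpM2r ?sqr_ge0// /D ler_wpM2r ?invr_ge0 ?(ltW rho0)//.
by rewrite lerD2l /t ler_pdivrMr// mul1r lerDl.
Qed.

(* Looking for [psi] of the form [x i |-> x i + t i] (i < k), the equation
   [q (x + t) + g = q x + r] with [g] free of the first [k] variables says that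
   [B t] consists of the quotients of [r - q t] by these variables, where [B]
   is the polar form of [q]: a contraction in [t]. *)
Lemma splitting (A : 'M[K]_k) (r : cps v 'I_n) :
  A + A^T \in unitmx -> ordge 3 r ->
  exists (psi psi' : {lrmorphism cps v 'I_n -> cps v 'I_n})
      (g : cps v J),
    [/\ cancel psi psi', cancel psi' psi, ordge 3 g,
        forall j : J, psi (x (val j)) = x (val j) &
        psi (qform A (x \o w) + incl g) = qform A (x \o w) + r].
Proof.
move=> Bu r3; pose Bi := invmx (A + A^T).
pose P := fun s : 'I_n => (s < k)%N.
pose F (t : 'I_k -> fps K 'I_n) i :=
  \sum_j Bi i j *: fdiv P (w j) (fps_of r - qform A t).
have [rho0 [rho00 [C0 rC0]]] := (convergent_normle v r).1 (cps_convergent r).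
have C00 := normle_ge0 rC0.
pose a := \sum_i \sum_j v (A i j).
pose b := \sum_i \sum_j v (Bi i j).
have sum_ge0 (M : 'M[K]_k) : 0 <= \sum_i \sum_j v (M i j).
  by rewrite sumr_ge0// => i _; rewrite sumr_ge0// => j _; exact: absv_ge0.
have [t [D [t0 t1 D0 bound]]] := splitting_radii (sum_ge0 A) (sum_ge0 Bi) C00 rho00.
pose rho := t * rho0; have rhop : 0 < rho by exact: mulr_gt0.
have [|||y [yadm Fy]] := @contraction_fixpoint _ _ v 'I_k 'I_n 2 rho (D * t ^+ 2) F.
- by rewrite mulr_ge0// sqr_ge0.
- move=> y yadm i; have y2 j : ordge 2 (y j) by case: (yadm j).
  have rq3 : ordge 3 (fps_of r - qform A y).
    apply: ordgeB => //; apply: ordge_sum => l _; apply: ordge_sum => j _.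
    by apply: ordgeZ; apply: (@ordge_le _ _ _ 4) => //; apply: (@ordgeM _ _ 2 2).
  split.
    by apply: ordge_sum => j _; apply: ordgeZ; exact: ordge_fdiv.
  apply: normle_weaken bound _.
  apply: (@normle_weaken _ _ _ _ _ (\sum_j v (Bi i j) *
     ((t ^+ 3 * C0 + a * (D * t ^+ 2) ^+ 2) / rho))).
    rewrite -mulr_suml ler_wpM2r//.
      rewrite divr_ge0 ?(ltW rhop)// addr_ge0 ?mulr_ge0 ?exprn_ge0//;
        by rewrite ?mulr_ge0 ?exprn_ge0 ?sum_ge0 ?(ltW t0).
    rewrite [in leRHS](bigD1 i)//= lerDl sumr_ge0// => l _.
    by rewrite sumr_ge0// => j _; exact: absv_ge0.
  apply: normle_sum => [|j]; first exact: ltW.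
  apply/normleZ/normle_fdiv => //; apply: normleB; first exact: ltW.
    by apply: normle_shrink; rewrite ?(ltW rho00) ?(ltW t0).
  by apply: normle_qform => [|l]; [exact: ltW|case: (yadm l)].
- move=> y y' d yadm y'adm yy i; rewrite /F -sumrB; apply: ordge_sum => j _.
  rewrite -scalerBr -fdivB; apply/ordgeZ/ordge_fdiv.
  rewrite opprB addrC addrA subrK -opprB; apply: ordgeN.
  (* The other factor of each product, of order at least 2, contributes two orders; division by a
     variable takes one back. *)
  by rewrite -addn2; apply: qform_congr => // l; [case: (yadm l)|case: (y'adm l)].
have y2 i : ordge 2 (y i) by case: (yadm i).
have cy i : convergent v (y i).
  by apply/convergent_normle; exists rho; split=> //; exists (D * t ^+ 2); case: (yadm i).
pose c i : cps v 'I_n := mkcps (cy i).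
have c2 i : ordge 2 (c i) by exact: y2.
pose rr := r - qform A c.
have rrE : fps_of rr = fps_of r - qform A y by rewrite cpsD cpsN cps_qform.
have rr3 : ordge 3 rr.
  rewrite rrE; apply: ordgeB => //.
  apply: ordge_sum => l _; apply: ordge_sum => j _.
  by apply: ordgeZ; apply: (@ordge_le _ _ _ 4) => //; apply: (@ordgeM _ _ 2 2).
have cE i : c i = \sum_j Bi i j *: cdiv P (w j) rr.
  apply: cps_inj; rewrite cps_sum -[LHS]Fy /F; apply: eq_bigr => j _.
  by rewrite cpsZ /cdiv mkcpsE rrE.
have BcE i : \sum_j (A + A^T) i j *: c j = cdiv P (w i) rr.
  under eq_bigr do rewrite cE scaler_sumr.
  rewrite exchange_big/= (bigD1 i)//= [X in _ + X]big1 => [|j ji].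
    rewrite addr0; under eq_bigr do rewrite scalerA.
    rewrite -scaler_suml; have /matrixP/(_ i i) := mulmxV Bu.
    by rewrite mxE !mxE eqxx => ->; rewrite scale1r.
  under eq_bigr do rewrite scalerA.
  rewrite -scaler_suml; have /matrixP/(_ i j) := mulmxV Bu.
  by rewrite mxE !mxE eq_sym (negbTE ji) => ->; rewrite scale0r.
(* What the division leaves over is free of the first [k] variables: it is the residual part. *)
pose rest := rr - \sum_i x (w i) * cdiv P (w i) rr.
have restE : fps_of rest = frest P rr.
  rewrite /rest cpsD cpsN cps_sum [X in X - _](fdiv_decomp P).
  rewrite (eq_bigl (fun s : 'I_n => (s < k)%N))// (big_ord_narrow kn).
  by rewrite addrK.
have [g gE] : exists g, incl g = rest.
  apply: incl_hom_restrict => m [s sk ms]; rewrite restE.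
  by have Ps : P s by [rewrite /P ltnNge]; exact: (frest_out _ Ps ms).
pose psi := glue_hom (fun i => x (w i) + c i) (fun j => x (val j)).
have psiL i : psi (x (w i)) = x (w i) + c i.
  apply: glue_homL; apply: ordgeD; first exact: ordge_var.
  exact: ordge_le (c2 i).
have psiR (j : J) : psi (x (val j)) = x (val j) by exact/glue_homR/ordge_var.
have [psi' [psiK psi'K]] : exists psi' : {lrmorphism cps v 'I_n -> cps v 'I_n},
    cancel psi psi' /\ cancel psi' psi.
  apply: inverse_function_id => s; have [[i ->]|[j ->]] := split_varP s.
    by rewrite psiL addrC addKr.
  by rewrite psiR subrr.
exists psi, psi', g; split=> //.
  apply: ordge_incl; rewrite gE restE; exact: ordge_frest.
rewrite rmorphD/= (hom_fix_incl g psiR) gE hom_qform.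
have -> : qform A (psi \o (x \o w)) = qform A (fun i => x (w i) + c i).
  by apply: eq_bigr => i _; apply: eq_bigr => j _; rewrite /= !psiL.
rewrite qformD /rest /rr; under [X in _ + X + _]eq_bigr do rewrite BcE.
rewrite -/rr -!addrA; congr (_ + _).
by ring.
Qed.

End SplitVariables.

(** * Linear algebra of quadratic forms *)

Section BilinearForm.
Variables (K : fieldType) (n : nat).
Implicit Types (A B : 'M[K]_n) (u w : 'rV[K]_n).

Definition bilin B u w : K := (u *m B *m w^T) 0 0.

Lemma bilinDl B u u' w : bilin B (u + u') w = bilin B u w + bilin B u' w.
Proof. by rewrite /bilin !mulmxDl mxE. Qed.

Lemma bilinDr B u w w' : bilin B u (w + w') = bilin B u w + bilin B u w'.
Proof. by rewrite /bilin linearD/= mulmxDr mxE. Qed.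

Lemma bilinZl B c u w : bilin B (c *: u) w = c * bilin B u w.
Proof. by rewrite /bilin -!scalemxAl mxE. Qed.

Lemma bilinZr B c u w : bilin B u (c *: w) = c * bilin B u w.
Proof. by rewrite /bilin linearZ/= -scalemxAr mxE. Qed.

Lemma bilin_tr B u w : bilin B^T u w = bilin B w u.
Proof.
rewrite /bilin; transitivity ((w *m B *m u^T)^T 0 0); last by rewrite mxE.
by rewrite !trmx_mul trmxK mulmxA.
Qed.

Lemma bilin_addM A B u w : bilin (A + B) u w = bilin A u w + bilin B u w.
Proof. by rewrite /bilin mulmxDr mulmxDl mxE. Qed.

Lemma polarE A u w : bilin (A + A^T) u w = bilin A u w + bilin A w u.
Proof. by rewrite bilin_addM bilin_tr. Qed.

Lemma bilin_nondeg B u : B \in unitmx -> u != 0 ->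
  exists w, bilin B u w = 1.
Proof.
move=> Bu u0; have uB : u *m B != 0.
  by apply: contra u0 => /eqP uB; rewrite -(mulmxK Bu u) uB mul0mx.
have [j uBj] : exists j, (u *m B) 0 j != 0.
  apply/existsP; apply: contraR uB; rewrite negb_exists => /forallP uB.
  apply/eqP/rowP => j; rewrite [RHS]mxE; apply/eqP.
  by have := uB j; rewrite negbK.
exists (((u *m B) 0 j)^-1 *: delta_mx 0 j).
rewrite bilinZr /bilin trmx_delta -colE [X in _ * X]mxE.
by rewrite mulVf.
Qed.

End BilinearForm.

(** * Totally singular complements of totally isotropic subspaces *)

Section Lagrangian.
Variables (K : fieldType) (k n : nat).
Implicit Types (A B : 'M[K]_n) (P G : 'M[K]_(k, n)).

(* [P] spans a totally singular subspace; if it meets the totally isotropic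
   span of [G] in [u], its reflection along [w - u], with [w] singular and
   paired to 1 with [u], meets it in a smaller subspace. *)
Lemma singular_complement A P G :
  A + A^T \in unitmx -> row_free P -> row_free G ->
  (forall y : 'rV_k, bilin A (y *m P) (y *m P) = 0) ->
  G *m (A + A^T) *m G^T = 0 ->
  exists P', [/\ row_free P',
    forall y : 'rV_k, bilin A (y *m P') (y *m P') = 0 &
    (P' :&: G)%MS = 0].
Proof.
move=> Bu Pfree Gfree PA GB.
have [m] := ubnP (\rank (P :&: G)%MS).
elim: m P Pfree PA => // m IH P Pfree PA; rewrite ltnS => rm.
have [PG0|] := eqVneq (P :&: G)%MS 0; first by exists P.
case/rowV0Pn => u; rewrite sub_capmx => /andP[/submxP[yu uP] /submxP[zu uG]] u0.
set B := A + A^T in Bu GB.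
have BE p q : bilin B p q = bilin A p q + bilin A q p by exact: polarE.
have Pu y : bilin B (y *m P) u = 0.
  rewrite uP BE; have := PA (y + yu); rewrite mulmxDl bilinDl !bilinDr !PA.
  by rewrite add0r addr0.
have Gu z : bilin B (z *m G) u = 0.
  rewrite uG /bilin trmx_mul mulmxA -(mulmxA z) -(mulmxA z) GB.
  by rewrite mulmx0 mul0mx mxE.
have Qu : bilin A u u = 0 by rewrite uP.
have [w0 uw0] := bilin_nondeg Bu u0.
have BC p q : bilin B p q = bilin B q p by rewrite !BE addrC.
have uu : bilin B u u = 0 by rewrite BE Qu addr0.
(* Subtracting a multiple of the singular vector [u] from [w0] keeps the pairing with [u] and shifts
   the value of the form linearly, so it can be made 0. *)
have [w uw Qw] : exists2 w, bilin B u w = 1 & bilin A w w = 0.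
  exists (w0 - bilin A w0 w0 *: u); rewrite -scaleNr.
    by rewrite bilinDr bilinZr uu mulr0 addr0.
  rewrite bilinDl !bilinDr !bilinZl !bilinZr Qu !mulr0 addr0.
  have : bilin A w0 u + bilin A u w0 = 1 by rewrite -BE BC.
  by move=> e; rewrite -[X in X + _ + _]mulr1 -e; ring.
have [d dE] : exists d, d = w - 1 *: u by exists (w - 1 *: u).
rewrite -scaleNr in dE.
(* This is the reflection along [d]: the form takes the value -1 at [d], and vectors of the span of
   [P] pair with [d] as with [w], being orthogonal to [u]. *)
pose P' := P + (P *m B *m w^T) *m d.
have yP' y : y *m P' = y *m P + bilin B (y *m P) w *: d.
  rewrite /P' mulmxDr; congr (_ + _); rewrite mulmxA !mulmxA /bilin.
  by rewrite [_ *m w^T in LHS]mx11_scalar mul_scalar_mx.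
have ud : bilin B u d = 1 by rewrite dE bilinDr bilinZr uu mulr0 addr0.
have Bu' y : bilin B u (y *m P') = bilin B (y *m P) w.
  by rewrite yP' bilinDr bilinZr ud mulr1 BC Pu add0r.
have Qd : bilin A d d = - 1.
  rewrite dE bilinDl !bilinDr !bilinZl !bilinZr Qu Qw.
  transitivity (- (bilin A u w + bilin A w u)); first by ring.
  by rewrite -BE uw.
have P'A y : bilin A (y *m P') (y *m P') = 0.
  rewrite yP' bilinDl !bilinDr !bilinZl !bilinZr PA Qd.
  set b := bilin B _ w; set p := y *m P.
  have : bilin A p d + bilin A d p = b.
    by rewrite -BE dE bilinDr bilinZr Pu mulr0 addr0.
  move=> e; have -> : 0 + b * bilin A p d + (b * bilin A d p + b * (b * -1)) =
    b * (bilin A p d + bilin A d p - b) by ring.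
  by rewrite e subrr mulr0.
apply: (IH P') => //.
  apply: inj_row_free => y y0.
  have b0 : bilin B (y *m P) w = 0 by rewrite -Bu' y0 /bilin trmx0 mulmx0 mxE.
  move: y0; rewrite yP' b0 scale0r addr0 => y0.
  by apply: (row_free_inj Pfree); rewrite y0 mul0mx.
(* A vector of the new intersection is orthogonal to [u], because it lies in the span of [G]; so it
   is fixed by the reflection and lay in the old intersection. But [u] is lost: it would also be
   fixed, although it pairs to 1 with [w]. *)
apply: leq_trans rm; apply: rank_ltmx; rewrite /ltmx; apply/andP; split.
  apply/rV_subP => p; rewrite sub_capmx => /andP[/submxP[y pP] /submxP[z pG]].
  have b0 : bilin B (y *m P) w = 0 by rewrite -Bu' -pP pG BC Gu.
  by rewrite sub_capmx {1}pP yP' b0 scale0r addr0 submxMl pG submxMl.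
have uPG : (u <= P :&: G)%MS by rewrite sub_capmx {1}uP uG !submxMl.
apply/negP => /(submx_trans uPG); rewrite sub_capmx => /andP[/submxP[y uy] _].
have b0 : bilin B (y *m P) w = 0 by rewrite -Bu' -uy uu.
have /eqP := uw; rewrite uy yP' b0 scale0r addr0 b0 eq_sym.
by rewrite oner_eq0.
Qed.

Lemma singular_basis A P :
  (forall y : 'rV_k, bilin A (y *m P) (y *m P) = 0) ->
  let Z := P *m A *m P^T in Z + Z^T = 0 /\ forall i, Z i i = 0.
Proof.
move=> PA Z.
have ZE (y z : 'rV_k) : bilin A (y *m P) (z *m P) = bilin Z y z.
  by rewrite /bilin /Z trmx_mul !mulmxA.
have Zd i j : bilin Z (delta_mx 0 i) (delta_mx 0 j) = Z i j.
  by rewrite /bilin trmx_delta -rowE -colE !mxE.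
have Zii i : Z i i = 0 by rewrite -Zd -ZE.
split=> //; apply/matrixP => i j; rewrite mxE [_^T _ _]mxE [RHS]mxE.
have := PA (delta_mx 0 i + delta_mx 0 j).
by rewrite ZE bilinDl !bilinDr !Zd !Zii add0r addr0.
Qed.

End Lagrangian.

(** * Normal forms of symmetric and alternating matrices under congruence *)

Section Congruence.
Variable K : fieldType.

Lemma gram_entry m n (H : 'M[K]_n) (U : 'M_(m, n)) i j :
  (U *m H *m U^T) i j = bilin H (row i U) (row j U).
Proof.
by rewrite /bilin -row_mul !mxE; apply: eq_bigr => k _; rewrite !mxE.
Qed.

(** The rows of [W] form a basis of the orthogonal complement of the rows of [U]; both spans are
    independent because the Gram matrix of [U] is invertible. *)
Lemma gram_split p m (H : 'M[K]_(p + m)) (U : 'M_(p, p + m)) :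
  H^T = H -> U *m H *m U^T \in unitmx ->
  exists W : 'M_(m, p + m), col_mx U W \in unitmx /\
    col_mx U W *m H *m (col_mx U W)^T =
    block_mx (U *m H *m U^T) 0 0 (W *m H *m W^T).
Proof.
move=> HT Du; set D := U *m H *m U^T in Du *.
pose M := H *m U^T.
have UM : U *m M = D by rewrite mulmxA.
have rM : \rank M = p.
  apply/eqP; rewrite eqn_leq rank_leq_col/=.
  by rewrite -[X in (X <= _)%N](mxrank_unit Du) -UM mxrankM_maxr.
have [W [Wfree WM]] : exists W : 'M_(m, p + m), row_free W /\ W *m M = 0.
  have rk : \rank (kermx M) = m by rewrite mxrank_ker rM addKn.
  (* The basis comes with the dimension [\rank (kermx M)] in its type; it is existentially
     quantified first so that this rank can be rewritten to [m]. *)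
  have : exists W : 'M_(\rank (kermx M), p + m), row_free W /\ W *m M = 0.
    exists (row_base (kermx M)); split; first exact: row_base_free.
    have /submxP[T ->] : (row_base (kermx M) <= kermx M)%MS.
      by rewrite eq_row_base.
    by rewrite -mulmxA mulmx_ker mulmx0.
  by rewrite rk.
have MT : U *m H *m W^T = 0.
  by rewrite -(trmx0 _ m p) -WM /M !trmx_mul trmxK HT.
exists W; split; last first.
  rewrite tr_col_mx mul_col_mx mul_col_row MT; congr block_mx.
  by rewrite -mulmxA.
rewrite -row_free_unit; apply: inj_row_free => y.
rewrite -[y]hsubmxK mul_row_col => y0.
have yl : lsubmx y = 0.
  have := congr1 (mulmx^~ M) y0; rewrite mulmxDl -!mulmxA UM WM mulmx0 addr0 mul0mx.
  by move=> yD; rewrite -(mulmxK Du (lsubmx y)) yD mul0mx.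
move: y0; rewrite yl mul0mx add0r => y0.
have -> : rsubmx y = 0 by apply: (row_free_inj Wfree); rewrite y0 mul0mx.
by rewrite row_mx0.
Qed.

Lemma gram_step p m (H : 'M[K]_(p + m)) (U : 'M_(p, p + m)) W (D : 'M_p)
    (L H' : 'M_m) :
  col_mx U W *m H *m (col_mx U W)^T =
    block_mx (U *m H *m U^T) 0 0 (W *m H *m W^T) ->
  U *m H *m U^T = D -> L *m (W *m H *m W^T) *m L^T = H' ->
  (block_mx 1%:M 0 0 L *m col_mx U W) *m H *m
    (block_mx 1%:M 0 0 L *m col_mx U W)^T = block_mx D 0 0 H'.
Proof.
move=> LE <- <-; set Q := block_mx _ _ _ _.
transitivity (Q *m (col_mx U W *m H *m (col_mx U W)^T) *m Q^T).
  by rewrite trmx_mul !mulmxA.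
rewrite LE /Q tr_block_mx !trmx0 !mulmx_block.
by rewrite trmx1 !(mulmx0, mul0mx, addr0, add0r, mul1mx, mulmx1).
Qed.

Lemma block_unit p m (L : 'M[K]_m) : L \in unitmx ->
  block_mx (1%:M : 'M_p) 0 0 L \in unitmx.
Proof. by move=> Lu; rewrite unitmxE det_ublock det1 mul1r -unitmxE. Qed.

(** By polarisation and since 2 is invertible, a nonzero symmetric form has a nonzero value at some
    [u], whose orthogonal complement is treated by induction. Splitting off [u] in front lowers the
    rank by one, so the nonzero diagonal entries come first. *)
Lemma symmetric_normal n (H : 'M[K]_n) : (2 : K) != 0 -> H^T = H ->
  exists (L : 'M_n) (a : 'I_n -> K),
    [/\ L \in unitmx, forall i : 'I_n, (i < \rank H)%N -> a i != 0 &
        L *m H *m L^T =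
        \matrix_(i, j) (if (i == j) && (i < \rank H)%N then a i else 0)].
Proof.
move=> two; elim: n H => [|n IH] H HT.
  exists 1%:M, (fun=> 0); split; rewrite ?unitmx1//; first by case.
  by apply/matrixP; case.
have [H0|Hn0] := eqVneq H 0.
  exists 1%:M, (fun=> 0); split; rewrite ?unitmx1// H0 mxrank0//.
  by rewrite mulmx0 mul0mx; apply/matrixP => i j; rewrite !mxE andbF.
have [u uH] : exists u, bilin H u u != 0.
  apply/not_existsP => uH; have {}uH u : bilin H u u = 0.
    by apply/eqP/negPn/negP; exact: uH.
  case/eqP: Hn0; apply/matrixP => i j; rewrite mxE.
  have := uH (delta_mx 0 i + delta_mx 0 j).
  rewrite bilinDl !bilinDr !uH add0r addr0 -[X in _ + X]bilin_tr HT -mulr2n.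
  rewrite -mulr_natl => /eqP; rewrite mulf_eq0 (negbTE two)/= => /eqP.
  by rewrite /bilin trmx_delta -rowE -colE !mxE.
have Du : u *m H *m u^T \in unitmx by rewrite unitmxE det_mx11 unitfE.
have [W [Lu LE]] := @gram_split 1 n H u HT Du.
have H1T : (W *m H *m W^T)^T = W *m H *m W^T by rewrite !trmx_mul trmxK HT mulmxA.
have [L [a [L1u a0 L1E]]] := IH _ H1T.
have rH : \rank H = (\rank (W *m H *m W^T)).+1.
  transitivity (\rank (col_mx u W *m H *m (col_mx u W)^T)).
    rewrite mxrankMfree ?row_free_unit ?unitmx_tr//.
    by rewrite eqmxMfull// row_full_unit.
  by rewrite LE rank_diag_block_mx mxrank_unit.
exists (block_mx 1%:M 0 0 L *m col_mx u W).
exists (fun i => if unlift ord0 i is Some j then a j else bilin H u u); split.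
- by rewrite unitmx_mul; apply/andP; split; first exact: (@block_unit 1 n).
- move=> i; rewrite rH; case: unliftP => [j ->|-> //].
  by rewrite ltnS => /a0.
apply: etrans (@gram_step 1 n H u W _ L _ LE (erefl _) L1E) _.
rewrite -[RHS](@submxK _ 1 n 1 n) rH.
have rsh (i : 'I_n) : rshift 1 i = lift ord0 i by exact/val_inj.
have lsh (i : 'I_1) : lshift n i = ord0 by rewrite ord1; exact/val_inj.
congr block_mx; apply/matrixP => i j; do 3 rewrite [RHS]mxE.
- by rewrite !lsh eqxx unlift_none !ord1.
- by rewrite lsh rsh mxE.
- by rewrite lsh rsh mxE.
- by rewrite mxE !rsh liftK (inj_eq lift_inj).
Qed.

(** The condition of [pair_form], on natural numbers so that it applies to indices from ordinals of
    different sizes. *)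
Definition pairrel (l i j : nat) := [&& ~~ odd i, j == i.+1 & (j < l.*2)%N].

(** A nonzero alternating form contains a hyperbolic pair [u], [w], whose plane splits off. Two
    dimensions disappear at a time, hence the induction on a bound of [n] and the even rank. *)
Lemma alternating_normal n (H : 'M[K]_n) : (2 : K) = 0 -> H^T = H ->
  (forall u, bilin H u u = 0) ->
  exists (L : 'M_n) (l : nat), [/\ L \in unitmx, \rank H = l.*2 &
    L *m H *m L^T = \matrix_(i, j) (pairrel l i j || pairrel l j i)%:R].
Proof.
move=> two; have [m] := ubnP n; elim: m n H => // m IH n H nm HT HA.
have [H0|Hn0] := eqVneq H 0.
  exists 1%:M, 0%N; split; rewrite ?unitmx1 ?H0 ?mxrank0//.
  by rewrite mulmx0 mul0mx; apply/matrixP => i j; rewrite !mxE /pairrel !ltn0 !andbF.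
have [u u0] : exists u : 'rV_n, u *m H != 0.
  apply/not_existsP => uH; case/eqP: Hn0; apply/row_matrixP => i.
  by rewrite rowE linear0; apply/eqP/negPn/negP; exact: uH.
have [w uw] : exists w, bilin H u w = 1.
  have [j uj] : exists j, (u *m H) 0 j != 0.
    apply/existsP; apply: contraR u0; rewrite negb_exists => /forallP uB.
    apply/eqP/rowP => j; rewrite [RHS]mxE; apply/eqP.
    by have := uB j; rewrite negbK.
  exists (((u *m H) 0 j)^-1 *: delta_mx 0 j).
  by rewrite bilinZr /bilin trmx_delta -colE [X in _ * X]mxE mulVf.
have wu : bilin H w u = 1 by rewrite -bilin_tr HT.
case: n => [|[|n]] in H nm HT HA Hn0 u u0 w uw wu *.
- by move: u0; rewrite (flatmx0 H) mulmx0 eqxx.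
- have E (y : 'rV[K]_1) : y = y 0 0 *: 1%:M by rewrite scalemx1 -mx11_scalar.
  have /eqP := uw; rewrite (E u) (E w) bilinZl bilinZr HA !mulr0.
  by rewrite eq_sym oner_eq0.
pose U : 'M_(2, n.+2) := \matrix_(i < 2) (if i == ord0 then u else w).
pose J2 : 'M[K]_2 := \matrix_(i, j) (i != j)%:R.
have DE : U *m H *m U^T = J2.
  apply/matrixP => i j; rewrite gram_entry !rowK [RHS]mxE.
  by case: i => [[|[|]]] //= ?; case: j => [[|[|]]] //= ?.
have J2u : J2 \in unitmx.
  suff : J2 *m J2 = 1%:M by move/mulmx1_unit => [].
  apply/matrixP => i j; rewrite !mxE big_ord_recl big_ord1 !mxE.
  by case: i => [[|[|]]] //= ?; case: j => [[|[|]]] //= ?;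
    rewrite ?mulr0 ?mulr1 ?add0r ?addr0.
have Du : U *m H *m U^T \in unitmx by rewrite DE.
have [W [Lu LE]] := @gram_split 2 n H U HT Du.
have H1T : (W *m H *m W^T)^T = W *m H *m W^T by rewrite !trmx_mul trmxK HT mulmxA.
have H1A y : bilin (W *m H *m W^T) y y = 0.
  by rewrite -[RHS](HA (y *m W)) /bilin trmx_mul !mulmxA.
have [|L [l [L1u rl L1E]]] := IH n _ _ H1T H1A; first by rewrite -ltnS ltnW.
exists (block_mx 1%:M 0 0 L *m col_mx U W), l.+1; split.
- by rewrite unitmx_mul; apply/andP; split; first exact: (@block_unit 2 n).
- transitivity (\rank (col_mx U W *m H *m (col_mx U W)^T)).
    rewrite mxrankMfree ?row_free_unit ?unitmx_tr//.
    by rewrite eqmxMfull// row_full_unit.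
  by rewrite LE rank_diag_block_mx mxrank_unit// rl.
apply: etrans (@gram_step 2 n H U W _ L _ LE DE L1E) _.
rewrite -[RHS](@submxK _ 2 n 2 n).
congr block_mx; apply/matrixP => i j; do 3 rewrite [RHS]mxE;
  rewrite mxE /pairrel/= ?add2n ?add0n ?negbK.
- by case: i => [[|[|]]] //= ?; case: j => [[|[|]]] //= ?.
- by case: i => [[|[|]]] //= ?; rewrite !andbF.
- by case: j => [[|[|]]] //= ?; rewrite !andbF.
- by rewrite !eqSS doubleS !ltnS.
Qed.

End Congruence.

(** * Cancellation of the quadratic part *)

Section Cancellation.
Variables (R : realType) (K : fieldType) (v : real_valuation R K).
Variables (n k : nat) (kn : (k <= n)%N).

Local Notation w := (widen_ord kn).
Local Notation J := {i : 'I_n | (k <= i)%N}.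
Local Notation x := (@cps_var R K v 'I_n).
Local Notation incl := (@incl_hom R K v 'I_n (fun i => (k <= i)%N)).
Local Notation q A := (qform A (x \o w)).

(** The coordinate projection: [U^T *m A *m U] is [A] padded with zeros, and [U *m L *m U^T] is the
    upper left block of [L]. *)
Definition selmx : 'M[K]_(k, n) := \matrix_(i, s) (w i == s)%:R.

Local Notation U := selmx.

Lemma selmxE (i : 'I_k) s : U i s = (w i == s)%:R. Proof. by rewrite mxE. Qed.

Lemma selmx_mul_tr : U *m U^T = 1%:M.
Proof.
apply/matrixP => i j; rewrite !mxE (bigD1 (w i))//= !mxE eqxx mul1r big1 ?addr0.
  by rewrite (inj_eq (@widen_inj _ _ kn)) eq_sym.
by move=> s /negbTE si; rewrite !mxE eq_sym si mul0r.
Qed.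

Lemma qform_embed (A : 'M[K]_k) : q A = qform (U^T *m A *m U) x.
Proof.
rewrite -qform_linear; have E i : x (w i) = \sum_s U i s *: x s.
  rewrite (bigD1 (w i))//= selmxE eqxx scale1r big1 ?addr0// => s /negbTE si.
  by rewrite selmxE eq_sym si scale0r.
by apply: eq_bigr => i _; apply: eq_bigr => j _; rewrite /= !E.
Qed.

Lemma hessian_block (A : 'M[K]_k) : hessian (q A) = U^T *m (A + A^T) *m U.
Proof.
rewrite qform_embed hessian_qform !trmx_mul trmxK mulmxA.
by rewrite mulmxDr mulmxDl.
Qed.

Lemma ordge_qform_var (A : 'M[K]_k) : ordge 2 (q A).
Proof.
rewrite cps_sum; apply: ordge_sum => i _; rewrite cps_sum.
apply: ordge_sum => j _; rewrite cpsZ cpsM; apply: ordgeZ.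
by apply: (@ordgeM _ _ 1 1); exact: ordge_var.
Qed.

Lemma qform_homogeneous (A : 'M[K]_k) : ordge 3 (q A) -> q A = 0.
Proof.
move=> q3; apply: cps_inj; apply/funext => a.
have [a3|a3] := ltnP (bnd a) 3; first exact: q3.
rewrite cps_sum fps_sumE big1// => i _; rewrite cps_sum fps_sumE big1// => j _.
rewrite cpsZ fpsZE cpsM; have [ai|ai] := posnP (a (w i)).
  by rewrite coefXM0// mulr0.
have [b ab] := mindex_subK ai; rewrite ab coefXM /= /fps_var.
case: eqP => [bj|]; rewrite ?mulr0//.
by move: a3; rewrite ab bndD bnd_em bj (bnd_em (w j)).
Qed.

Definition jacmx (phi : {lrmorphism cps v 'I_n -> cps v 'I_n}) : 'M[K]_n :=
  \matrix_(i, j) jac phi i j.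

(* The linear part of an equivalence preserves the radical of the polar form,
   so it is block triangular. *)
Lemma jac_radical (B B' : 'M[K]_k) (L : 'M_n) :
  B \in unitmx -> B' \in unitmx ->
  L^T *m (U^T *m B *m U) *m L = U^T *m B' *m U ->
  let M := U *m L *m U^T in M^T *m B *m M = B' /\ U *m L = M *m U.
Proof.
move=> Bu B'u LB M; pose Y := U *m L.
have YB : Y^T *m B *m Y = U^T *m B' *m U by rewrite -LB /Y trmx_mul !mulmxA.
have MY : M^T *m B *m Y = B' *m U.
  rewrite /M trmx_mul trmxK -/Y -!mulmxA (mulmxA Y^T) YB.
  by rewrite !mulmxA selmx_mul_tr mul1mx.
have MM : M^T *m B *m M = B' by rewrite {2}/M -/Y mulmxA MY -mulmxA selmx_mul_tr mulmx1.
split=> //; have : M^T *m B \in unitmx.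
  by move: B'u; rewrite -MM unitmx_mul => /andP[].
move=> MBu; apply: (can_inj (mulKmx MBu)).
by rewrite MY mulmxA MM.
Qed.

Lemma jac_block (phi : {lrmorphism cps v 'I_n -> cps v 'I_n}) (M : 'M[K]_k) :
  U *m jacmx phi = M *m U ->
  (forall i j, jac phi (w i) (w j) = M i j) /\
  (forall i (j : J), jac phi (w i) (val j) = 0).
Proof.
move=> UM; have E i s : jac phi (w i) s = \sum_j M i j * (w j == s)%:R.
  have /matrixP/(_ i s) := UM; rewrite mxE (bigD1 (w i))//= selmxE eqxx mul1r.
  rewrite big1 ?addr0 => [|t /negbTE ti]; last by rewrite selmxE eq_sym ti mul0r.
  by rewrite mxE => ->; rewrite mxE; apply: eq_bigr => j _; rewrite selmxE.
split=> i j; rewrite E.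
  rewrite (bigD1 j)//= eqxx mulr1 big1 ?addr0// => l lj.
  by rewrite (inj_eq (@widen_inj _ _ kn)) (negbTE lj) mulr0.
by rewrite big1// => l _; rewrite widen_val mulr0.
Qed.

Lemma hom_block_linear (phi : {lrmorphism cps v 'I_n -> cps v 'I_n})
    (M : 'M[K]_k) : U *m jacmx phi = M *m U ->
  forall i, ordge 2 (phi (x (w i)) - \sum_j M i j *: x (w j)).
Proof.
move=> /jac_block[ML MR] i; have := jac_linear phi (w i).
rewrite (sum_split kn) [X in _ - (_ + X)]big1 ?addr0 => [|j _]; last first.
  by rewrite MR scale0r.
by under eq_bigr do rewrite ML.
Qed.

(** The linear part of [phi] on the first [k] variables involves only these variables, and already
    carries one form to the other. Keeping just this block gives an automorphism that fixes the
    remaining variables. *)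
Lemma qform_transfer (A A' : 'M[K]_k) (phi : {lrmorphism cps v 'I_n -> cps v 'I_n}) :
  A + A^T \in unitmx -> A' + A'^T \in unitmx ->
  ordge 3 (phi (q A) - q A') ->
  exists (beta beta' : {lrmorphism cps v 'I_n -> cps v 'I_n}),
    [/\ cancel beta beta', cancel beta' beta, beta (q A) = q A' &
        forall j : J, beta (x (val j)) = x (val j)].
Proof.
move=> Bu B'u phiq.
have := hessian_congr phiq; rewrite (hessian_hom phi (ordge_qform_var A)).
rewrite !hessian_block => /(jac_radical Bu B'u)[]; set M := U *m _ *m _.
move=> MB UM.
have Mu : M \in unitmx by move: B'u; rewrite -MB unitmx_mul => /andP[].
exists (block_hom kn v M), (block_hom kn v (invmx M)); split.
- exact/block_homK/mulmxV.
- exact/block_homK/mulVmx.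
- apply/eqP; rewrite -subr_eq0; apply/eqP.
  rewrite block_hom_qform; set C := M^T *m A *m M.
  have qB : q C - q A' = q (C - A').
    rewrite -sumrB; apply: eq_bigr => i _; rewrite -sumrB.
    by apply: eq_bigr => j _; rewrite -scalerBl !mxE.
  (* Both forms agree with [phi (q A)] up to order 3, and a quadratic form of order 3 vanishes. *)
  rewrite qB; apply: qform_homogeneous; rewrite -qB.
  rewrite -(subrKA (phi (q A))) cpsD; apply: ordgeD => //.
  rewrite -opprB cpsN; apply: ordgeN.
  rewrite hom_qform /C -qform_linear cpsD cpsN !cps_qform.
  apply: (@qform_congr _ _ _ _ 1 _ _ _ _ 2) => i.
  + exact: hom_local.
  + by rewrite cps_sum; apply: ordge_sum => j _; apply/ordgeZ/ordge_var.
  + by rewrite -cpsN -cpsD; exact: hom_block_linear.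
- exact: block_homR.
Qed.

(** Expresses the difference as one form on the doubled space, which can vanish on totally singular
    subspaces. *)
Lemma qform_difference (B : comAlgType K) (A : 'M[K]_k) (y z : 'I_k -> B) :
  qform (block_mx A 0 0 (- A))
    (fun s : 'I_(k + k) => match fintype.split s with inl i => y i | inr i => z i end) =
  qform A y - qform A z.
Proof.
have sl i : fintype.split (lshift k i) = inl i by exact: (unsplitK (inl i)).
have sr i : fintype.split (rshift k i) = inr i by exact: (unsplitK (inr i)).
rewrite /qform big_split_ord/= -sumrN; congr (_ + _); apply: eq_bigr => i _.
  rewrite big_split_ord/= [X in _ + X]big1 ?addr0 => [|j _]; last first.
    by rewrite block_mxEur mxE scale0r.
  by apply: eq_bigr => j _; rewrite block_mxEul !sl.
rewrite big_split_ord/= [X in X + _]big1 ?add0r => [|j _]; last first.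
  by rewrite block_mxEdl mxE scale0r.
rewrite -sumrN; apply: eq_bigr => j _.
by rewrite block_mxEdr !sr mxE scaleNr.
Qed.

(* The columns of [rsubmx (invmx (col_mx P G))] are equations of the span of
   [P]. *)
Lemma qform_singular (B : comAlgType K) m (A : 'M[K]_(k + m)) (P : 'M_(k, k + m))
    (G : 'M_(m, k + m)) (y : 'I_(k + m) -> B) :
  col_mx P G \in unitmx -> (forall z : 'rV_k, bilin A (z *m P) (z *m P) = 0) ->
  (forall i, \sum_s rsubmx (invmx (col_mx P G)) s i *: y s = 0) ->
  qform A y = 0.
Proof.
set C := col_mx P G => Cu PA yE.
set E := rsubmx (invmx C) in yE; pose F := lsubmx (invmx C).
have FE : F *m P + E *m G = 1%:M.
  by rewrite -mul_row_col hsubmxK mulVmx.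
(* [F] and [E] are the coordinates along [P] and [G]. As the latter vanish on [y], it is the
   combination of the rows of [P] with coefficients [kappa], and the form becomes the alternating
   Gram form of [P]. *)
pose kappa r := \sum_t F t r *: y t.
have yP s : y s = \sum_r P^T s r *: kappa r.
  transitivity (\sum_t (F *m P + E *m G) t s *: y t).
    rewrite FE (bigD1 s)//= mxE eqxx scale1r big1 ?addr0// => t /negbTE ts.
    by rewrite mxE ts scale0r.
  under eq_bigr do rewrite mxE scalerDl.
  rewrite big_split/= [X in _ + X](_ : _ = 0) ?addr0; last first.
    transitivity (\sum_i G i s *: \sum_t E t i *: y t).
      under [RHS]eq_bigr do rewrite scaler_sumr.
      rewrite [RHS]exchange_big/=; apply: eq_bigr => t _.
      rewrite mxE scaler_suml; apply: eq_bigr => i _.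
      by rewrite scalerA mulrC.
    by apply: big1 => i _; rewrite yE scaler0.
  under [RHS]eq_bigr do rewrite scaler_sumr.
  rewrite [RHS]exchange_big/=; apply: eq_bigr => t _.
  rewrite mxE scaler_suml; apply: eq_bigr => i _.
  by rewrite [P^T _ _]mxE scalerA [in RHS]mulrC.
transitivity (qform A (fun s => \sum_r P^T s r *: kappa r)).
  by apply: eq_bigr => s _; apply: eq_bigr => t _; rewrite -!yP.
rewrite qform_linear trmxK; have [Z0 Zd] := singular_basis PA.
exact: qform_alternating.
Qed.

(* The reflections of [singular_complement] start from the diagonal. *)
Lemma graph_complement (A M : 'M[K]_k) : A + A^T \in unitmx ->
  M^T *m (A + A^T) *m M = A + A^T ->
  exists P : 'M_(k, k + k), col_mx P (row_mx M^T 1%:M) \in unitmx /\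
    forall z : 'rV_k, bilin (block_mx A 0 0 (- A)) (z *m P) (z *m P) = 0.
Proof.
move=> Bu MB; set G := row_mx _ _; set AA := block_mx A 0 0 (- A).
pose P0 : 'M[K]_(k, k + k) := row_mx 1%:M 1%:M.
have AAE : AA + AA^T = block_mx (A + A^T) 0 0 (- (A + A^T)).
  rewrite /AA tr_block_mx !trmx0 add_block_mx !addr0; congr block_mx.
  by rewrite linearN opprD.
have AAu : AA + AA^T \in unitmx.
  rewrite AAE unitmxE det_ublock unitrM -!unitmxE Bu/=.
  by rewrite -scaleN1r unitmxZ ?unitrN1.
have free (N : 'M[K]_k) : row_free (row_mx N 1%:M).
  apply: inj_row_free => z; rewrite mul_mx_row mulmx1 -(row_mx0 _ 1 k k).
  by move=> /eq_row_mx[].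
have P0A (z : 'rV_k) : bilin AA (z *m P0) (z *m P0) = 0.
  rewrite /bilin mul_mx_row !mulmx1 mul_row_block tr_row_mx mul_row_col.
  by rewrite !mulmx0 addr0 add0r mulmxN mulNmx subrr mxE.
have GG : G *m (AA + AA^T) *m G^T = 0.
  rewrite AAE /G mul_row_block tr_row_mx mul_row_col !mulmx0 addr0 add0r.
  by rewrite trmxK mul1mx trmx1 mulmx1 MB subrr.
have [P [Pfree PA PG]] := singular_complement AAu (free _) (free _) P0A GG.
exists P; split=> //; rewrite -row_free_unit /row_free.
rewrite -(eqmx_rank (_ : (P + G == col_mx P G)%MS)); last exact/eqmxP/addsmxE.
by rewrite mxrank_disjoint_sum// (eqP Pfree) (eqP (free _)).
Qed.

(* Let [P] be as in [graph_complement] for the linear part [M] of [phi] on the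
   first [k] variables.  Since the span of [P] is complementary to the graph of
   [M], the equations [(phi x_I, x_I) \in span P] can be solved for [x_I] in
   terms of the other variables; [sigma] restricts to this solution, on which
   [q (phi x_I) = q x_I], so that [sigma \o phi] maps [g] to [g']. *)
Lemma residual_cancellation (A : 'M[K]_k) (g g' : cps v J)
    (phi : {lrmorphism cps v 'I_n -> cps v 'I_n}) :
  A + A^T \in unitmx -> ordge 2 g -> ordge 2 g' ->
  hessian (incl g) = 0 -> hessian (incl g') = 0 -> bijective phi ->
  phi (q A + incl g) = q A + incl g' -> right_equiv g g'.
Proof.
move=> Bu g2 g'2 hg hg' bphi phiE.
have [psi [phiK psiK]] := hom_inverse bphi.
have F2 (h : cps v J) : ordge 2 h -> ordge 2 (q A + incl h).
  by move=> h2; apply: ordgeD; [exact: ordge_qform_var|exact: hom_ordge].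
have hF (h : cps v J) : hessian (incl h) = 0 ->
    hessian (q A + incl h) = U^T *m (A + A^T) *m U.
  by move=> h0; rewrite cpsD hessianD h0 addr0 hessian_block.
have psiE : psi (q A + incl g') = q A + incl g by rewrite -phiE phiK.
have := hessian_hom phi (F2 _ g2); rewrite phiE (hF _ hg) (hF _ hg').
move=> /esym /(jac_radical Bu Bu)[]; set M := U *m _ *m _ => MB UM.
have [ML MR] := jac_block UM.
have := hessian_hom psi (F2 _ g'2); rewrite psiE (hF _ hg) (hF _ hg').
move=> /esym /(jac_radical Bu Bu)[] _ /jac_block[_ M'R].
have [P [Cu PA]] := graph_complement Bu MB.
set G := row_mx _ _ in Cu; set E := rsubmx (invmx (col_mx P G)).
(* The equations of the span of [P] restrict to coordinates on the graph. *)
have GE : G *m E = 1%:M.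
  have := mulmxV Cu; rewrite -[invmx _]hsubmxK mul_col_row.
  by rewrite -/E scalar_mx_block => /eq_block_mx[].
pose z (s : 'I_(k + k)) : cps v 'I_n :=
  match fintype.split s with inl i => phi (x (w i)) | inr i => x (w i) end.
have sl i : fintype.split (lshift k i) = inl i by exact: (unsplitK (inl i)).
have sr i : fintype.split (rshift k i) = inr i by exact: (unsplitK (inr i)).
have z1 s : ordge 1 (z s).
  by rewrite /z; case: fintype.split => i; [exact: hom_local|exact: ordge_var].
have zlin s : ordge 2 (z s - \sum_i G i s *: x (w i)).
  case: (split_ordP s) => i ->; rewrite /z ?sl ?sr.
    under eq_bigr do rewrite row_mxEl mxE.
    exact: hom_block_linear.
  under eq_bigr do rewrite row_mxEr mxE.
  rewrite (bigD1 i)//= eqxx scale1r big1 ?addr0 ?subrr// => j /negbTE ->.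
  by rewrite scale0r.
(* [chi] takes the equations as new coordinates in place of the first [k] variables. By [GE] their
   linear parts are these variables, so [chi] is tangent to the identity. *)
pose chi := glue_hom (fun i : 'I_k => \sum_s E s i *: z s) (fun j : J => x (val j)).
have chiL i : chi (x (w i)) = \sum_s E s i *: z s.
  apply: glue_homL; rewrite cps_sum; apply: ordge_sum => s _.
  by rewrite cpsZ; exact: ordgeZ.
have chiR (j : J) : chi (x (val j)) = x (val j) by exact/glue_homR/ordge_var.
have chi1 s : ordge 2 (chi (x s) - x s).
  have [[i ->]|[j ->]] := split_varP kn s; last by rewrite chiR subrr.
  have -> : chi (x (w i)) - x (w i) =
      \sum_s E s i *: (z s - \sum_l G l s *: x (w l)).
    under eq_bigr do rewrite scalerBr scaler_sumr.
    rewrite chiL sumrB exchange_big/=; congr (_ - _).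
    rewrite (bigD1 i)//= [X in _ + X]big1 ?addr0 => [|l li].
      under eq_bigr do rewrite scalerA mulrC.
      by rewrite -scaler_suml; have /matrixP/(_ i i) := GE;
        rewrite !mxE eqxx => ->; rewrite scale1r.
    under eq_bigr do rewrite scalerA mulrC.
    by rewrite -scaler_suml; have /matrixP/(_ l i) := GE;
      rewrite !mxE (negbTE li) => ->; rewrite scale0r.
  rewrite cps_sum; apply: ordge_sum => t _; rewrite cpsZ; exact: ordgeZ.
have [chi' [chiK chi'K]] := inverse_function_id chi1.
(* Restriction to the common zeros of the equations: pass to the new coordinates by [chi'] and set
   them to 0. *)
have [sigma [sigmaR sigma_chi]] : exists sigma : {lrmorphism cps v 'I_n -> cps v J},
    (forall j, sigma (x (val j)) = cps_var v j) /\
    (forall i, sigma (chi (x (w i))) = 0).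
  exists (glue_hom (fun _ : 'I_k => 0 : cps v J) (cps_var v (I:=J)) \o chi').
  split=> [j|i]; last by rewrite /= chiK glue_homL.
  by rewrite /= -chiR chiK glue_homR//; exact: ordge_var.
have chilin i s : fps_of (chi (x i)) (em s) = (i == s)%:R.
  rewrite -(subrK (x i) (chi (x i))) cpsD fpsDE.
  by rewrite chi1 ?bnd_em// add0r [fps_of _ _]var_em.
(* The solution has no linear part, since [chi] is tangent to the identity. *)
have sigmaL i t : fps_of (sigma (x (w i))) (em t) = 0.
  have := congr1 (fun h : cps v J => fps_of h (em t)) (sigma_chi i).
  rewrite lin_hom; under eq_bigr do rewrite chilin.
  rewrite (bigD1 (w i)) // eqxx mul1r big1 => [|s].
    by move=> h; apply: etrans _ h; exact: esym (addr0 _).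
  by move=> /negbTE si; rewrite eq_sym si mul0r.
(* On the zeros of the equations, the pair of the images of [x_I] under [phi] and of [x_I] itself
   lies in the totally singular span of [P]. *)
have qsigma : qform A (sigma \o (phi \o (x \o w))) = qform A (sigma \o (x \o w)).
  apply/eqP; rewrite -subr_eq0 -qform_difference; apply/eqP.
  apply: (qform_singular Cu PA) => i.
  rewrite -[RHS](sigma_chi i) chiL linear_sum; apply: eq_bigr => s _.
  by rewrite linearZ/= /z; congr (_ *: _); case: fintype.split.
have [theta thetaE] : exists theta : {lrmorphism cps v J -> cps v J},
    forall h, theta h = sigma (phi (incl h)).
  by exists (sigma \o (phi \o incl)).
have thetag : theta g = g'.
  have e1 : sigma (phi (q A + incl g)) =
      qform A (sigma \o (phi \o (x \o w))) + theta g.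
    by rewrite thetaE !rmorphD/= !hom_qform.
  have e2 : sigma (q A + incl g') = qform A (sigma \o (x \o w)) + sigma (incl g').
    by rewrite rmorphD/= hom_qform.
  apply: (addrI (qform A (sigma \o (phi \o (x \o w))))).
  rewrite -e1 phiE e2 qsigma; congr (_ + _).
  have := @hom_eq _ _ v J J (sigma \o incl) idfun; apply=> j.
  by rewrite /= incl_hom_var; exact: sigmaR.
(* As [sigma] kills the linear parts of the first [k] variables, the linear part of [theta] is the
   lower right block of that of [phi]. *)
have thetaL (j t : J) : fps_of (theta (cps_var v j)) (em t) = jac phi (val j) (val t).
  rewrite thetaE incl_hom_var.
  rewrite lin_hom (sum_split kn) big1 ?add0r => [|i _]; last by rewrite sigmaL mulr0.
  rewrite (bigD1 t)//= sigmaR [X in _ * X]var_em eqxx mulr1 big1 ?addr0//.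
  by move=> l /negbTE lt; rewrite sigmaR [X in _ * X]var_em lt mulr0.
have jacM (a b : {lrmorphism cps v 'I_n -> cps v 'I_n}) : cancel a b ->
    forall i j, \sum_s jac a i s * jac b s j = (i == j)%:R.
  by move=> aK i j; rewrite -var_em -[fps_var K i]/(fps_of (x i)) -[x i]aK [RHS]lin_hom.
(* The linear parts of [phi] and [psi] are block triangular and inverse to each other, so their
   lower right blocks are inverse to each other as well. *)
have sumJ (a b : {lrmorphism cps v 'I_n -> cps v 'I_n}) : cancel a b ->
    (forall i (j : J), jac b (w i) (val j) = 0) ->
    forall j l : J, \sum_(t : J) jac a (val j) (val t) * jac b (val t) (val l) =
      (j == l)%:R.
  move=> aK bR j l; rewrite -(inj_eq val_inj) -(jacM _ _ aK) (sum_split kn).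
  by rewrite [X in _ = X + _]big1 ?add0r// => i _; rewrite bR mulr0.
have [theta' [thetaK theta'K]] : exists theta' : {lrmorphism cps v J -> cps v J},
    cancel theta theta' /\ cancel theta' theta.
  apply: (@inverse_function _ _ _ _ theta (fun j t => jac psi (val j) (val t))) => j l.
    by under eq_bigr do rewrite thetaL; exact: sumJ.
  by under eq_bigr do rewrite thetaL; exact: sumJ.
exact: (right_equivI thetaK theta'K thetag).
Qed.

End Cancellation.

(** * Normal forms *)

Section NormalFormExistence.
Variables (R : realType) (K : fieldType) (v : real_valuation R K).
Variables (n k : nat) (kn : (k <= n)%N).

Local Notation w := (widen_ord kn).
Local Notation J := {i : 'I_n | (k <= i)%N}.
Local Notation x := (@cps_var R K v 'I_n).
Local Notation incl := (@incl_hom R K v 'I_n (fun i => (k <= i)%N)).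
Local Notation q A := (qform A (x \o w)).
Local Notation U := (selmx K kn).
Implicit Types (f : cps v 'I_n) (g h : cps v J) (A : 'M[K]_k).

Lemma mxrank_congr m (L H : 'M[K]_m) : L \in unitmx ->
  \rank (L *m H *m L^T) = \rank H.
Proof.
move=> Lu; rewrite mxrankMfree ?row_free_unit ?unitmx_tr//.
by rewrite eqmxMfull// row_full_unit.
Qed.

Lemma selmx_unit A : \rank (U^T *m A *m U) = k -> A \in unitmx.
Proof.
move=> rA; rewrite -row_free_unit /row_free eqn_leq rank_leq_row/=.
rewrite -[X in (X <= _)%N]rA; apply: leq_trans (mxrankM_maxl _ _) _.
exact: mxrankM_maxr.
Qed.

Lemma selmx_congrLL A i j : (U^T *m A *m U) (w i) (w j) = A i j.
Proof.
rewrite mxE (bigD1 j)//= selmxE eqxx mulr1 [X in _ + X]big1 ?addr0 => [|t tj].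
  rewrite mxE (bigD1 i)//= mxE selmxE eqxx mul1r big1 ?addr0// => s si.
  by rewrite mxE selmxE (inj_eq (@widen_inj _ _ kn)) (negbTE si) mul0r.
by rewrite selmxE (inj_eq (@widen_inj _ _ kn)) (negbTE tj) mulr0.
Qed.

Lemma selmx_congrR A s (j : J) : (U^T *m A *m U) s (val j) = 0.
Proof.
by rewrite mxE big1// => t _; rewrite selmxE widen_val mulr0.
Qed.

Lemma selmx_congrL A (j : J) s : (U^T *m A *m U) (val j) s = 0.
Proof.
rewrite mxE big1// => t _; rewrite mxE big1 ?mul0r// => i _.
by rewrite mxE selmxE widen_val mul0r.
Qed.

Definition tail_diag (d : J -> K) : 'M[K]_n :=
  \matrix_(s, t) (if s == t then glue (fun _ : 'I_k => 0) d s else 0).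

Lemma incl_diag_form (d : J -> K) :
  incl (diag_form v xpredT d) = qform (tail_diag d) x.
Proof.
have -> : qform (tail_diag d) x =
    \sum_s glue (fun _ : 'I_k => 0) d s *: (x s * x s).
  apply: eq_bigr => s _; rewrite (bigD1 s)//= mxE eqxx big1 ?addr0// => t.
  by move=> /negbTE ts; rewrite mxE eq_sym ts scale0r.
rewrite (sum_split kn) big1 ?add0r => [|i _]; last by rewrite glueL scale0r.
rewrite rmorph_sum; apply: eq_bigr => j _.
by rewrite glueR /= linearZ/= rmorphXn/= incl_hom_var expr2.
Qed.

Lemma incl_residual2 (d : J -> K) h :
  incl (residual2 d h) = qform (tail_diag d) x + incl h.
Proof. by rewrite /residual2 rmorphD -incl_diag_form. Qed.

Lemma linear_change (L : 'M[K]_n) f : L \in unitmx -> ordge 2 f ->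
  exists (alpha alpha' : {lrmorphism cps v 'I_n -> cps v 'I_n}) (C : 'M_n),
    [/\ cancel alpha alpha', cancel alpha' alpha,
        ordge 3 (alpha f - qform C x) & C + C^T = L *m hessian f *m L^T].
Proof.
move=> Lu f2; pose alpha := block_hom (leqnn n) v L^T.
have wn i : widen_ord (leqnn n) i = i by exact/val_inj.
have jE : jacmx alpha = L^T.
  apply/matrixP => i j; rewrite mxE /jac -[i in LHS]wn block_homL cps_sum fps_sumE.
  rewrite (bigD1 j)//= wn fpsZE var_em eqxx mulr1 big1 ?addr0// => s /negbTE sj.
  by rewrite wn fpsZE var_em sj mulr0.
have a2 : ordge 2 (alpha f) by exact: hom_ordge.
have [C fC] := quadratic_part a2.
exists alpha, (block_hom (leqnn n) v (invmx L^T)), C; split=> //.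
- by apply: block_homK; rewrite mulmxV// unitmx_tr.
- by apply: block_homK; rewrite mulVmx// unitmx_tr.
by rewrite -(hessian_qform v C) -(hessian_congr fC) hessian_hom// -/(jacmx _) jE trmxK.
Qed.

(** The form [C] differs from the padded [A] by an alternating matrix and by the tail squares [d],
    which the polar form cannot see because [d j + d j = 0]. The splitting automorphism fixes the
    tail variables, so these squares pass through unchanged into the residual part. *)
Lemma splitting_equiv A f (C : 'M[K]_n) :
  ordge 3 (f - qform C x) -> A + A^T \in unitmx ->
  U^T *m (A + A^T) *m U = C + C^T ->
  (forall i, A i i = C (w i) (w i)) ->
  exists (d : J -> K) h, [/\ forall j, d j = C (val j) (val j), ordge 3 h &
    right_equiv f (q A + incl (residual2 d h))].
Proof.
move=> fC Bu UA Ad; pose d (j : J) := C (val j) (val j).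
pose r := f - qform C x.
have d2 j : d j + d j = 0.
  by have /matrixP/(_ (val j) (val j)) := UA; rewrite selmx_congrL !mxE => <-.
pose D := tail_diag d.
have Dd s t : D s t = if s == t then glue (fun _ : 'I_k => 0) d s else 0.
  by rewrite mxE.
have CE : qform C x = q A + qform D x.
  have entry (M S T : 'M[K]_n) s t : (M - (S + T)) s t = M s t - (S s t + T s t).
    by rewrite !mxE.
  have X0 : qform (C - (U^T *m A *m U + D)) x = 0.
    apply: qform_alternating => [|s].
      have gen (M S T : 'M[K]_n) : M - (S + T) + (M - (S + T))^T =
          M + M^T - (S + S^T) - (T + T^T).
        by apply/matrixP => i j; rewrite !mxE; ring.
      have US : U^T *m (A + A^T) *m U = U^T *m A *m U + (U^T *m A *m U)^T.
        by rewrite !trmx_mul trmxK mulmxA -mulmxDl -mulmxDr.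
      rewrite gen -US.
      rewrite -UA subrr add0r; apply/eqP; rewrite oppr_eq0; apply/eqP.
      apply/matrixP => s t; rewrite mxE [_^T _ _]mxE [RHS]mxE !Dd eq_sym.
      case: eqP => [->|]; last by rewrite addr0.
      have [[i ->]|[j ->]] := split_varP kn s; first by rewrite glueL addr0.
      by rewrite glueR d2.
    rewrite entry Dd eqxx.
    have [[i ->]|[j ->]] := split_varP kn s.
      by rewrite selmx_congrLL glueL addr0 Ad subrr.
    by rewrite selmx_congrL glueR add0r subrr.
  apply/eqP; rewrite -subr_eq0 qform_embed -[X in _ == X]X0; apply/eqP.
  rewrite -big_split -sumrB; apply: eq_bigr => s _.
  rewrite -big_split -sumrB; apply: eq_bigr => t _ /=.
  by rewrite entry scalerBl scalerDl.
have [psi [psi' [h [psiK psi'K h3 psiR psiE]]]] := splitting kn Bu fC.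
exists d, h; split=> //; apply: right_equiv_sym; apply: (right_equivI psiK psi'K).
have psiD : psi (qform D x) = qform D x by rewrite -incl_diag_form hom_fix_incl.
rewrite incl_residual2 -/D [X in psi X](_ : _ = (q A + incl h) + qform D x).
  by rewrite rmorphD/= psiD psiE /r CE; ring.
by rewrite addrAC addrA.
Qed.

Lemma hessian_right_equiv f f' : ordge 2 f -> right_equiv f f' ->
  \rank (hessian f') = \rank (hessian f).
Proof.
move=> f2 [phi [bphi <-]]; rewrite hessian_hom// -/(jacmx phi).
have [psi [phiK psiK]] := hom_inverse bphi.
have jM : jacmx phi *m jacmx psi = 1%:M.
  apply/matrixP => i j; rewrite !mxE -var_em -[fps_var K i]/(fps_of (x i)).
  rewrite -[x i]phiK lin_hom; apply: eq_bigr => s _.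
  by rewrite !mxE.
have [ju _] := mulmx1_unit jM.
by rewrite -{2}[jacmx phi]trmxK mxrank_congr// unitmx_tr.
Qed.

(** [gamma] shows that the two quadratic forms are linearly equivalent; it is obtained differently
    in the two cases of the characteristic. Once the forms coincide, the cancellation result
    applies. Nondegeneracy comes from the rank of the Hessian, to which the residual parts
    contribute nothing. *)
Lemma residual_unique f A A' g g' :
  ordge 2 f -> \rank (hessian f) = k ->
  ordge 2 g -> ordge 2 g' -> hessian (incl g) = 0 -> hessian (incl g') = 0 ->
  right_equiv f (q A + incl g) -> right_equiv f (q A' + incl g') ->
  (exists gamma : {lrmorphism cps v 'I_n -> cps v 'I_n},
     ordge 3 (gamma (q A) - q A')) ->
  right_equiv g g'.
Proof.
move=> f2 rk g2 g'2 hg hg' fg fg' [gamma gammaE].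
have unit_of B h : hessian (incl h) = 0 -> right_equiv f (q B + incl h) ->
    B + B^T \in unitmx.
  move=> h0 fh; apply: selmx_unit; rewrite -(hessian_block v).
  by rewrite -[RHS]rk -(hessian_right_equiv f2 fh) cpsD hessianD h0 addr0.
have Bu := unit_of _ _ hg fg; have B'u := unit_of _ _ hg' fg'.
have [beta [beta' [betaK beta'K betaq betaR]]] := qform_transfer Bu B'u gammaE.
have eqv : right_equiv (q A + incl g) (q A' + incl g).
  apply: (right_equivI betaK beta'K).
  by rewrite rmorphD/= betaq (hom_fix_incl _ betaR).
have [phi [bphi phiE]] := right_equiv_trans (right_equiv_sym eqv)
  (right_equiv_trans (right_equiv_sym fg) fg').
exact: (residual_cancellation B'u g2 g'2 hg hg' bphi phiE).
Qed.

End NormalFormExistence.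

(** * Matrices of the diagonal form and of the pair form *)

Section StandardForms.
Variables (R : realType) (K : fieldType) (v : real_valuation R K).
Variables (n : nat).

Local Notation x := (@cps_var R K v 'I_n).

Definition diag_mat k (kn : (k <= n)%N) (a : 'I_n -> K) : 'M[K]_k :=
  \matrix_(i, j) (if i == j then a (widen_ord kn i) else 0).

Lemma diag_formE k (kn : (k <= n)%N) (a : 'I_n -> K) :
  diag_form v (fun i : 'I_n => (i < k)%N) a =
  qform (diag_mat kn a) (x \o widen_ord kn).
Proof.
rewrite /diag_form (big_ord_narrow kn); apply: eq_bigr => i _.
rewrite (bigD1 i)//= mxE eqxx expr2 big1 ?addr0// => j /negbTE ji.
by rewrite mxE eq_sym ji scale0r.
Qed.

(** Upper triangular, so that each product of two paired variables is counted once. *)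
Definition pair_mat l (kn : (l.*2 <= n)%N) (a : 'I_n -> K) : 'M[K]_(l.*2) :=
  \matrix_(i, j) ((if i == j then a (widen_ord kn i) else 0) +
                  (pairrel l i j)%:R).

(** Every index lies in exactly one pair: even ones are first entries, odd ones second entries. *)
Lemma sum_pairrel (V : zmodType) l (F : 'I_(l.*2) -> V) :
  \sum_(i < l.*2) \sum_(j < l.*2 | pairrel l i j) (F i + F j) = \sum_i F i.
Proof.
rewrite [RHS](bigID (fun i : 'I_(l.*2) => ~~ odd i))/=.
under eq_bigr do rewrite big_split/=.
rewrite big_split/=; congr (_ + _).
  rewrite [RHS]big_mkcond; apply: eq_bigr => i _.
  have [oi|ei] := boolP (odd i); first by rewrite big1// => j /andP[]; rewrite oi.
  have il : (i.+1 < l.*2)%N.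
    rewrite ltn_neqAle ltn_ord andbT; apply: contraNneq ei => il.
    by have := congr1 odd il; rewrite odd_double /= => /negbFE.
  rewrite (bigD1 (Ordinal il))/= /pairrel ?ei ?eqxx//= big1 ?addr0// => j.
  by move=> /andP[/andP[/eqP ji _]] /eqP[]; exact/val_inj.
rewrite (exchange_big_dep xpredT)//= [RHS]big_mkcond; apply: eq_bigr => j _.
rewrite negbK; case: (boolP (odd j)) => [oj|ej].
  case: j oj => [[|j] jl]//= oj; have jl' := ltnW jl.
  rewrite (bigD1 (Ordinal jl'))/= /pairrel/= ?oj ?eqxx ?jl//= big1 ?addr0// => i.
  by move=> /andP[/and3P[_ /eqP[ji] _]] /eqP[]; exact/val_inj.
by rewrite big1// => i /and3P[oi /eqP ji _]; move: ej; rewrite ji /= oi.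
Qed.

Lemma pair_formE l (kn : (l.*2 <= n)%N) (a : 'I_n -> K) :
  pair_form v l a = qform (pair_mat kn a) (x \o widen_ord kn).
Proof.
pose T s t := a s *: x s ^+ 2 + x s * x t + a t *: x t ^+ 2.
rewrite /pair_form -(pair_big_dep xpredT (fun s t : 'I_n => pairrel l s t) T)/=.
have -> : \sum_(s < n) \sum_(t < n | pairrel l s t) T s t =
    \sum_(i < l.*2) \sum_(j < l.*2 | pairrel l i j) T (widen_ord kn i) (widen_ord kn j).
  rewrite (bigID (fun s : 'I_n => (s < l.*2)%N))/= [X in _ + X]big1 ?addr0.
    rewrite (big_ord_narrow kn); apply: eq_bigr => i _.
    rewrite (eq_bigl (fun t : 'I_n => pairrel l i t && (t < l.*2)%N)) => [|t].
      by rewrite (big_ord_narrow_cond kn).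
    by rewrite /pairrel -!andbA andbb.
  move=> s sl; rewrite big1// => t /and3P[_ /eqP ts tl].
  by case/negP: sl; apply: leq_trans tl; rewrite ts.
rewrite /qform; pose X i := x (widen_ord kn i); pose c i := a (widen_ord kn i).
transitivity (\sum_i c i *: X i ^+ 2 +
   \sum_(i < l.*2) \sum_(j < l.*2 | pairrel l i j) X i * X j).
  rewrite -(sum_pairrel (fun i => c i *: X i ^+ 2)) -big_split; apply: eq_bigr => i _ /=.
  by rewrite -big_split; apply: eq_bigr => j _; rewrite /T /= addrAC.
rewrite -big_split; apply: eq_bigr => i _ /=.
under [RHS]eq_bigr do rewrite mxE scalerDl.
rewrite big_split/=; congr (_ + _).
  rewrite (bigD1 i)//= eqxx expr2 big1 ?addr0// => j /negbTE ji.
  by rewrite eq_sym ji scale0r.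
rewrite big_mkcond; apply: eq_bigr => j _.
by case: pairrel; rewrite ?scale1r ?scale0r.
Qed.

Lemma cps_incl_ordge k d (g : cps v {i : 'I_n | (k <= i)%N}) :
  maxideal_exp d (cps_incl g) -> ordge d (incl_hom v _ g).
Proof. by move/maxideal_expP; rewrite cps_inclE. Qed.

End StandardForms.

(** * Existence and uniqueness in the two cases of the characteristic *)

Section MainTheorem.
Variables (R : realType) (K : fieldType) (v : real_valuation R K) (n : nat).

Lemma morse_splitting_exists (f : cps v 'I_n) (k : nat) :
  (2 : K) != 0 -> ordge 2 f -> \rank (hessian f) = k ->
  exists (a : 'I_n -> K) (g : cps v {i : 'I_n | (k <= i)%N}),
    [/\ forall i : 'I_n, (i < k)%N -> a i != 0,
        maxideal_exp 3 (cps_incl g) & right_equiv f (normal_form a g)].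
Proof.
move=> two f2 rk; have kn : (k <= n)%N by rewrite -rk rank_leq_row.
have HT : (hessian f)^T = hessian f.
  by apply/matrixP => i j; rewrite mxE !hessianE eq_sym addrC.
have [L [b [Lu b0 LE]]] := symmetric_normal two HT.
have [alpha [alpha' [C [aK a'K fC CE]]]] := linear_change Lu f2.
move: LE b0; rewrite rk => LE b0.
have CC s t : C s t + C t s = if (s == t) && (s < k)%N then b s else 0.
  by have /matrixP/(_ s t) := CE; rewrite LE !mxE.
(* For [s < k] the double of [a s] is the diagonal entry [b s], hence [a s] is nonzero. *)
pose a s := C s s; pose A := diag_mat kn a.
have AA i j : (A + A^T) i j = C (widen_ord kn i) (widen_ord kn j) +
                              C (widen_ord kn j) (widen_ord kn i).
  rewrite CC !mxE (inj_eq (@widen_inj _ _ kn)) [j == i]eq_sym /= ltn_ord andbT.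
  case: eqP => [->|]; last by rewrite addr0.
  by rewrite /a CC eqxx /= ltn_ord.
have UA : (selmx K kn)^T *m (A + A^T) *m selmx K kn = C + C^T.
  apply/matrixP => s t; rewrite [RHS]mxE [C^T _ _]mxE.
  have [[i ->]|[i ->]] := split_varP kn s; have [[j ->]|[j ->]] := split_varP kn t.
  - by rewrite selmx_congrLL AA.
  - by rewrite selmx_congrR CC widen_val.
  - by rewrite selmx_congrL CC eq_sym widen_val.
  - by rewrite selmx_congrL CC ltnNge (valP i) andbF.
have Au : A + A^T \in unitmx.
  by apply: (@selmx_unit _ _ _ kn); rewrite UA CE mxrank_congr.
have [|d [h [dE h3 fh]]] := splitting_equiv fC Au UA.
  by move=> i; rewrite mxE eqxx.
have d0 j : d j = 0.
  apply/eqP; have := CC (val j) (val j); rewrite eqxx ltnNge (valP j)/=.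
  by rewrite -mulr2n -mulr_natl dE => /eqP; rewrite mulf_eq0 (negbTE two).
have resE : residual2 d h = h.
  by rewrite /residual2 /diag_form big1 ?add0r// => j _; rewrite d0 scale0r.
exists a, h; split.
- move=> i ik; have := b0 i ik; apply: contraNneq => a0.
  by have := CC i i; rewrite eqxx ik -/(a i) a0 addr0 /= => <-.
- by apply/maxideal_expP; rewrite cps_inclE; exact: hom_ordge.
apply: right_equiv_trans (right_equivI aK a'K (erefl _)) _.
by rewrite /normal_form (diag_formE v kn) cps_inclE -resE.
Qed.

Lemma morse_splitting_unique (f : cps v 'I_n) (k : nat) (a a' : 'I_n -> K)
    (g g' : cps v {i : 'I_n | (k <= i)%N}) :
  ordge 2 f -> \rank (hessian f) = k ->
  maxideal_exp 3 (cps_incl g) -> maxideal_exp 3 (cps_incl g') ->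
  right_equiv f (normal_form a g) -> right_equiv f (normal_form a' g') ->
  right_equiv g g'.
Proof.
move=> f2 rk /cps_incl_ordge g3 /cps_incl_ordge g'3.
have kn : (k <= n)%N by rewrite -rk rank_leq_row.
rewrite /normal_form !(diag_formE v kn) !cps_inclE => fg fg'.
have [phi [_ phiE]] := right_equiv_trans (right_equiv_sym fg) fg'.
apply: (residual_unique (A := diag_mat kn a) (A' := diag_mat kn a')) fg fg' _ => //.
- by apply: (@ordge_le _ _ _ 3) => //; exact: ordge_incl.
- by apply: (@ordge_le _ _ _ 3) => //; exact: ordge_incl.
- exact: hessian_ordge3.
- exact: hessian_ordge3.
(* Here the residual parts have order at least 3, so the equivalence of the two normal forms itself
   matches the quadratic forms up to order 3. *)
exists phi; rewrite (_ : _ - _ = incl_hom v _ g' - phi (incl_hom v _ g)).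
  by apply: ordgeB => //; exact: hom_ordge.
apply/eqP; rewrite subr_eq addrAC eq_sym subr_eq -rmorphD.
by rewrite /= phiE addrC.
Qed.

Lemma hessian_alternating (f : cps v 'I_n) : (2 : K) = 0 -> ordge 2 f ->
  (hessian f)^T = hessian f /\ forall u, bilin (hessian f) u u = 0.
Proof.
move=> two f2; have [C fC] := quadratic_part f2.
rewrite (hessian_congr fC) hessian_qform; split=> [|u].
  by rewrite linearD/= trmxK addrC.
by rewrite polarE -mulr2n -mulr_natl two mul0r.
Qed.

Lemma splitting2_exists (f : cps v 'I_n) (l : nat) :
  (2 : K) = 0 -> ordge 2 f -> \rank (hessian f) = l.*2 ->
  exists (a : 'I_n -> K) (d : {i : 'I_n | (l.*2 <= i)%N} -> K)
    (h : cps v {i : 'I_n | (l.*2 <= i)%N}),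
    maxideal_exp 3 h /\ right_equiv f (normal_form2 a (residual2 d h)).
Proof.
move=> two f2 rk; have kn : (l.*2 <= n)%N by rewrite -rk rank_leq_row.
have [HT HA] := hessian_alternating two f2.
have [L [l' [Lu rl' LE]]] := alternating_normal two HT HA.
have {rl'}ll : l' = l by apply: double_inj; rewrite -rl'.
rewrite {l'}ll in LE.
have [alpha [alpha' [C [aK a'K fC CE]]]] := linear_change Lu f2.
have add2 (c : K) : c + c = 0 by rewrite -mulr2n -mulr_natl two mul0r.
have CC s t : C s t + C t s = (pairrel l s t || pairrel l t s)%:R.
  by have /matrixP/(_ s t) := CE; rewrite LE !mxE.
pose a s := C s s; pose A := pair_mat kn a.
have relC i j : (pairrel l i j)%:R + (pairrel l j i)%:R =
    (pairrel l i j || pairrel l j i)%:R :> K.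
  case ij: (pairrel l i j); case ji: (pairrel l j i); rewrite ?addr0 ?add0r//.
  by move: ij ji => /and3P[+ /eqP -> _] /and3P[]; rewrite /= => ->.
have AA i j : (A + A^T) i j = C (widen_ord kn i) (widen_ord kn j) +
                              C (widen_ord kn j) (widen_ord kn i).
  rewrite CC !mxE addrACA relC [j == i]eq_sym.
  by case: eqP => [->|_]; rewrite ?add2 ?addr0 ?add0r.
have UA : (selmx K kn)^T *m (A + A^T) *m selmx K kn = C + C^T.
  apply/matrixP => s t; rewrite [RHS]mxE [C^T _ _]mxE.
  have out (j : {i : 'I_n | (l.*2 <= i)%N}) t' :
      (pairrel l (val j) t' = false) /\ (pairrel l t' (val j) = false).
    rewrite /pairrel; have := valP j; rewrite /= leqNgt => /negbTE jl.
    rewrite jl !andbF; split=> //; case: eqP => [tj|]; rewrite ?andbF//.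
    by apply/negbTE; rewrite andTb negb_and -leqNgt tj ltnW ?orbT// ltnS leqNgt jl.
  have [[i ->]|[i ->]] := split_varP kn s; have [[j ->]|[j ->]] := split_varP kn t.
  - by rewrite selmx_congrLL AA.
  - by rewrite selmx_congrR CC !(out j _).1 !(out j _).2.
  - by rewrite selmx_congrL CC !(out i _).1 !(out i _).2.
  - by rewrite selmx_congrL CC !(out i _).1 !(out i _).2.
have Au : A + A^T \in unitmx.
  by apply: (@selmx_unit _ _ _ kn); rewrite UA CE mxrank_congr.
have [|d [h [_ h3 fh]]] := splitting_equiv fC Au UA.
  by move=> i; rewrite mxE eqxx /pairrel ltn_eqF ?andbF ?addr0.
exists a, d, h; split; first exact/maxideal_expP.
apply: right_equiv_trans (right_equivI aK a'K (erefl _)) _.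
by rewrite /normal_form2 (pair_formE v kn) cps_inclE.
Qed.

(** The residual parts have quadratic terms, which an equivalence of the full series may mix into
    the pair forms. The automorphism matching the pair forms is therefore taken from the
    hypothesis. *)
Lemma splitting2_unique (f : cps v 'I_n) (l : nat) (a a' : 'I_n -> K)
    (d d' : {i : 'I_n | (l.*2 <= i)%N} -> K)
    (h h' : cps v {i : 'I_n | (l.*2 <= i)%N}) :
  (2 : K) = 0 -> ordge 2 f -> \rank (hessian f) = l.*2 ->
  maxideal_exp 3 h -> maxideal_exp 3 h' ->
  right_equiv f (normal_form2 a (residual2 d h)) ->
  right_equiv f (normal_form2 a' (residual2 d' h')) ->
  right_equiv (pair_form v l a) (pair_form v l a') ->
  right_equiv (residual2 d h) (residual2 d' h').
Proof.
move=> two f2 rk /maxideal_expP h3 /maxideal_expP h'3.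
have kn : (l.*2 <= n)%N by rewrite -rk rank_leq_row.
rewrite /normal_form2 !(pair_formE v kn) !cps_inclE => fg fg' [gamma [_ gammaE]].
have res2 (e : {i : 'I_n | (l.*2 <= i)%N} -> K) (r : cps v {i : 'I_n | (l.*2 <= i)%N}) :
    ordge 3 r -> ordge 2 (residual2 e r).
  move=> r3; rewrite /residual2 cpsD; apply: ordgeD; last exact: ordge_le r3.
  rewrite /diag_form cps_sum; apply: ordge_sum => j _.
  rewrite cpsZ expr2 cpsM; apply: ordgeZ.
  by apply: (@ordgeM _ _ 1 1); exact: ordge_var.
(* The squares in the residual part do not show in the Hessian, their coefficients being doubled
   there. *)
have resH (e : {i : 'I_n | (l.*2 <= i)%N} -> K) (r : cps v {i : 'I_n | (l.*2 <= i)%N}) :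
    ordge 3 r -> hessian (incl_hom v _ (residual2 e r)) = 0.
  move=> r3; rewrite (incl_residual2 kn) cpsD hessianD hessian_qform.
  rewrite hessian_ordge3 ?addr0; last exact: hom_ordge.
  apply/matrixP => s t; rewrite !mxE eq_sym; case: eqP => [->|]; rewrite ?addr0//.
  by rewrite -mulr2n -mulr_natl two mul0r.
apply: (residual_unique (A := pair_mat kn a) (A' := pair_mat kn a')) fg fg' _;
  try by [|exact: res2|exact: resH].
by exists gamma; rewrite gammaE subrr.
Qed.

End MainTheorem.

Theorem theorem4p7 (R : realType) (K : fieldType) (v : real_valuation R K)
    (n : nat) (f : cps v 'I_n) (hf : maxideal_exp 2 f) :
  (2%N \notin [pchar K] ->
    forall k : nat, \rank (hessian f) = k ->
      (exists (a : 'I_n -> K) (g : cps v {i : 'I_n | (k <= i)%N}),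
         [/\ forall i : 'I_n, (i < k)%N -> a i != 0,
             maxideal_exp 3 (cps_incl g) &
             right_equiv f (normal_form a g)]) /\
      (forall (a a' : 'I_n -> K) (g g' : cps v {i : 'I_n | (k <= i)%N}),
         (forall i : 'I_n, (i < k)%N -> a i != 0) ->
         (forall i : 'I_n, (i < k)%N -> a' i != 0) ->
         maxideal_exp 3 (cps_incl g) ->
         maxideal_exp 3 (cps_incl g') ->
         right_equiv f (normal_form a g) ->
         right_equiv f (normal_form a' g') ->
         right_equiv g g')) /\
  (2%N \in [pchar K] ->
    ~~ odd (\rank (hessian f)) /\
    forall l : nat, \rank (hessian f) = l.*2 ->
      (exists (a : 'I_n -> K) (d : {i : 'I_n | (l.*2 <= i)%N} -> K)
              (h : cps v {i : 'I_n | (l.*2 <= i)%N}),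
         maxideal_exp 3 h /\
         right_equiv f (normal_form2 a (residual2 d h))) /\
      (forall (a a' : 'I_n -> K) (d d' : {i : 'I_n | (l.*2 <= i)%N} -> K)
              (h h' : cps v {i : 'I_n | (l.*2 <= i)%N}),
         maxideal_exp 3 h ->
         maxideal_exp 3 h' ->
         right_equiv f (normal_form2 a (residual2 d h)) ->
         right_equiv f (normal_form2 a' (residual2 d' h')) ->
         right_equiv (pair_form v l a) (pair_form v l a') ->
         right_equiv (residual2 d h) (residual2 d' h'))).
Proof.
have f2 : ordge 2 f by exact/maxideal_expP.
split=> [p2 k rk|p2].
  have two : (2 : K) != 0 by move: p2; rewrite inE.
  split; first exact: morse_splitting_exists.
  by move=> a a' g g' _ _; exact: morse_splitting_unique.
have two : (2 : K) = 0 by exact: pcharf0 p2.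
split=> [|l rk].
  have [HT HA] := hessian_alternating two f2.
  by have [L [l [_ -> _]]] := alternating_normal two HT HA; rewrite odd_double.
split; first exact: splitting2_exists.
by move=> a a' d d' h h'; exact: splitting2_unique.
Qed.
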